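(* Let $(M,T^{1,0}M,\theta)$ be a three-dimensional strongly pseudoconvex pseudohermitian CR manifold (with positive definite Levi form) and let $n\ge 1$. The assignment $\omega=d'f$ gives a bijective correspondence between local isometric immersions $f\colon M\to\mathbb{R}^n$ (with respect to the Webster metric $g_\theta$), up to translation, and forms $\omega\in E^{1,0}\otimes_{\mathbb{C}}\mathbb{C}^n$ satisfying (1) $D''\omega=-D'\bar\omega$, (2) $\langle\omega,\omega\rangle=0$, (3) $\|\omega\|^2=1$, (4) $\|\delta(\omega-\bar\omega)\|^2=1$, (5) $\delta\bar\omega\cdot\omega=0$. That is: for every open $U\subset M$ and every isometric immersion $f\colon U\to\mathbb{R}^n$, the form $\omega=d'f$ satisfies (1)--(5) on $U$; conversely, if $\omega$ is defined on an open $U\subset M$ and satisfies (1)--(5), then every point of $U$ has a connected open neighbourhood $V\subset U$ and an isometric immersion $f\colon V\to\mathbb{R}^n$ with $d'f=\omega|_V$, and $f$ is unique up to translation.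
   Context: All objects are smooth. A three-dimensional CR manifold (of hypersurface type) is a real 3-manifold $M$ with a complex line subbundle $T^{1,0}M\subset T^{\mathbb{C}}M=\mathbb{C}\otimes TM$ such that $T^{1,0}M\cap\overline{T^{1,0}M}=0$ (and $[\Gamma(T^{1,0}M),\Gamma(T^{1,0}M)]\subset\Gamma(T^{1,0}M)$, automatic here); $T^{0,1}M=\overline{T^{1,0}M}$. A pseudohermitian structure is a nowhere vanishing real 1-form $\theta$ with $\ker\theta=T^{1,0}M\oplus T^{0,1}M$. Levi form: $\mathcal{L}_\theta(Z,W)=\mathrm{i}\,\mathrm{d}\theta(Z,\bar W)$ for $Z,W\in T^{1,0}M$, with $\mathrm{d}\theta(X,Y)=X\theta(Y)-Y\theta(X)-\theta([X,Y])$. $M$ is strongly pseudoconvex if $\mathcal{L}_\theta$ is definite at each point; the sign of $\theta$ is chosen so that $\mathcal{L}_\theta$ is positive definite. The Reeb field $T$ is defined by $\theta(T)=1$, $i_T\mathrm{d}\theta=0$. The Webster metric $g_\theta$ is the Riemannian metric with $g_\theta(X,Y)=\Re\mathcal{L}_\theta(Z,W)$ for $X=(Z+\bar Z)/\sqrt2$, $Y=(W+\bar W)/\sqrt2$, $Z,W\in T^{1,0}M$, and $g_\theta(X,T)=0$, $g_\theta(T,T)=1$. Isometric means that the pullback of the Euclidean metric is $g_\theta$. A pseudohermitian local frame is a local frame $(Z,\bar Z,T)$ of $T^{\mathbb{C}}M$ with $Z\in T^{1,0}M$, $\mathcal{L}_\theta(Z,Z)=1$ and $T$ the Reeb field; $(\zeta,\bar\zeta,\theta)$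 is its dual coframe, and $a=\mathrm{i}\,\zeta([Z,\bar Z])$. Complex: $E^{0}=E^{0,0}$ is the complex functions; $E^1=\Omega^1(M)/\langle\theta\rangle=E^{1,0}\oplus E^{0,1}$ (complex forms), where locally $E^{1,0}=\{[g\zeta]\}$, $E^{0,1}=\{[g\bar\zeta]\}$; $F^2=\{\alpha\in\Omega^2(M):\alpha\wedge\theta=0\}=F^{2,0}\oplus F^{1,1}$ with $F^{2,0}=\langle\zeta\wedge\theta\rangle$, $F^{1,1}=\langle\bar\zeta\wedge\theta\rangle$. $d\colon E^0\to E^1$ is $f\mapsto[\mathrm{d}f]$, with $d'f=[Zf\,\zeta]$ and $d''f=[\bar Zf\,\bar\zeta]$ its $E^{1,0}$ and $E^{0,1}$ components. $D\colon E^1\to F^2$ is $D[\eta]=\mathrm{d}(\eta+h\theta)$, where $h$ is the unique function with $\mathrm{d}(\eta+h\theta)\in F^2$. On $E^{1,0}$: $D'$ and $D''$ are the components of $D$ in $F^{2,0}$ and $F^{1,1}$ respectively. On $E^{0,1}$: $D'$ and $D^+$ are the components of $D$ in $F^{1,1}$ and $F^{2,0}$ respectively. All operators and complex conjugation extend componentwise to $\mathbb{C}^n$-valued forms. $\delta\colon E^1\to E^0$ is the formal adjoint of $d\colon E^0\to E^1$ with respect to the hermitian products induced by the Webster metric; in a pseudohermitian frame $\delta[g\zeta+h\bar\zeta]=-(\bar Zg-\mathrm{i}ag)-(Zh+\mathrm{i}\bar a h)$. On $\mathbb{C}^n$, $\langle\cdot,\cdot\rangle$ is the standard bilinear symmetric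 product and $\|\cdot\|$ the standard hermitian norm. For $\omega=[\zeta]\otimes\phi$ with $\phi$ a $\mathbb{C}^n$-valued function: $\langle\omega,\omega\rangle=0$ means $\langle\phi,\phi\rangle=0$, and $\|\omega\|^2=\|\phi\|^2$. If $h=\sum h_i\otimes e_i$ is a $\mathbb{C}^n$-valued function and $\alpha=\sum\alpha_i\otimes e_i$ a $\mathbb{C}^n$-valued form, $h\cdot\alpha=\sum h_i\alpha_i$. *)

(* Defs.v *)
From HB Require Import structures.
From mathcomp Require Import all_boot all_order all_algebra.
From mathcomp Require Import complex.
From mathcomp Require Import all_classical all_reals all_analysis.
Set Implicit Arguments.
Unset Strict Implicit.
Unset Printing Implicit Defensive.
Import Order.TTheory GRing.Theory Num.Theory.
Import numFieldNormedType.Exports.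
Local Open Scope classical_set_scope.
Local Open Scope ring_scope.
Local Open Scope complex_scope.

Definition partial (R : realType) (i : 'I_3) (g : 'rV[R]_3 -> R)
  (x : 'rV[R]_3) : R := 'D_(delta_mx 0 i) g x.

Fixpoint Ck (R : realType) (k : nat) (O : set 'rV[R]_3) (g : 'rV[R]_3 -> R)
  : Prop :=
  (forall x, O x -> {for x, continuous g}) /\
  match k with
  | 0%N => True
  | k'.+1 => forall i : 'I_3,
      (forall x, O x -> derivable g x (delta_mx 0 i)) /\ Ck k' O (partial i g)
  end.

Definition Cinfty (R : realType) (O : set 'rV[R]_3) (g : 'rV[R]_3 -> R) :=
  forall k, Ck k O g.

Record chart (R : realType) (M : topologicalType) := Chart {
  cdom : set M;
  cmap : M -> 'rV[R]_3;
  cinv : 'rV[R]_3 -> M;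
  cdom_open : open cdom;
  cimg_open : open (cmap @` cdom);
  cmapK : forall p, cdom p -> cinv (cmap p) = p;
  cmap_cont : forall p, cdom p -> {for p, continuous cmap};
  cinv_cont : forall x, (cmap @` cdom) x -> {for x, continuous cinv}
}.

Record manifold3 (R : realType) := Manifold3 {
  carrier :> topologicalType;
  carrier_hausdorff : hausdorff_space carrier;
  carrier_countable : @second_countable carrier;
  atlas : set (chart R carrier);
  atlas_cover : forall p : carrier, exists c, atlas c /\ cdom c p;
  atlas_smooth : forall c c', atlas c -> atlas c' -> forall i : 'I_3,
    Cinfty (cmap c @` (cdom c `&` cdom c')) (fun x => cmap c' (cinv c x) 0 i)
}.

Definition chart_at (R : realType) (M : manifold3 R) (p : M)
  : chart R (carrier M) := sval (cid (atlas_cover p)).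

(* The complexified tangent space of M at p is 'cV[R[i]]_3: a column holds the
   components of a vector in the coordinate basis of [chart_at p].  A covector
   is a row and a 2-form at p the matrix of its values on that basis.  Fields
   and forms are thus plain functions on M, and their smoothness is the
   smoothness of the functions obtained by letting them act.  All sections are
   total functions, only looked at on the open set under consideration. *)

Section Calculus.
Variables (R : realType) (M : manifold3 R).
Local Notation C := R[i].
Implicit Types (p : M) (W U : set M) (X Y : M -> 'cV[C]_3).

Definition smooth W (f : M -> C) := forall c, atlas c ->
  Cinfty (cmap c @` (W `&` cdom c)) (fun x => complex.Re (f (cinv c x))) /\
  Cinfty (cmap c @` (W `&` cdom c)) (fun x => complex.Im (f (cinv c x))).

Definition smooth_map W (n : nat) (f : M -> 'rV[R]_n) :=
  forall k, smooth W (fun p => (f p 0 k)%:C).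

Definition ev (eta : 'rV[C]_3) (v : 'cV[C]_3) : C := (eta *m v) 0 0.

Definition ev2 (beta : 'M[C]_3) (u v : 'cV[C]_3) : C :=
  (u^T *m beta *m v) 0 0.

Definition conjm m n (A : 'M[C]_(m, n)) : 'M[C]_(m, n) :=
  map_mx (fun x : C => x^*%C) A.

Definition realm m n (A : 'M[R]_(m, n)) : 'M[C]_(m, n) :=
  map_mx (fun x : R => x%:C) A.

Definition differential (f : M -> C) p : 'rV[C]_3 :=
  let c := chart_at p in
  \row_i (partial i (fun x => complex.Re (f (cinv c x))) (cmap c p)
          +i* partial i (fun x => complex.Im (f (cinv c x))) (cmap c p)).

Definition vderiv X (f : M -> C) p : C := ev (differential f p) (X p).

Definition coord (c : chart R M) (i : 'I_3) p : C := (cmap c p 0 i)%:C.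

Definition smooth_field W X := forall c, atlas c -> forall i,
  smooth (W `&` cdom c) (vderiv X (coord c i)).

Definition bracket X Y p : 'cV[C]_3 :=
  let x := coord (chart_at p) in
  \col_i (vderiv X (vderiv Y (x i)) p - vderiv Y (vderiv X (x i)) p).

Definition smooth_form U (eta : M -> 'rV[C]_3) :=
  forall W X, open W -> W `<=` U -> smooth_field W X ->
    smooth W (fun p => ev (eta p) (X p)).

(* The coordinate vector field d/dx_j of c, in the basis of [chart_at p]. *)
Definition coord_field (c : chart R M) (j : 'I_3) p : 'cV[C]_3 :=
  \col_i (partial j (fun x => cmap (chart_at p) (cinv c x) 0 i) (cmap c p))%:C.

Definition d_eval (eta : M -> 'rV[C]_3) X Y p : C :=
  vderiv X (fun q => ev (eta q) (Y q)) p
  - vderiv Y (fun q => ev (eta q) (X q)) p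
  - ev (eta p) (bracket X Y p).

Definition dform (eta : M -> 'rV[C]_3) p : 'M[C]_3 :=
  let e := coord_field (chart_at p) in
  \matrix_(i, j) d_eval eta (e i) (e j) p.

Definition wedge (alpha beta : 'rV[C]_3) : 'M[C]_3 :=
  alpha^T *m beta - beta^T *m alpha.

(* The 3-form beta /\ eta vanishes. *)
Definition wedge21_eq0 (beta : 'M[C]_3) (eta : 'rV[C]_3) :=
  forall u v w, ev2 beta u v * ev eta w + ev2 beta v w * ev eta u
                + ev2 beta w u * ev eta v = 0.

End Calculus.

Record cr_structure (R : realType) (M : manifold3 R) := CR {
  T10 : M -> set 'cV[R[i]]_3;
  T10_line : forall p, exists (W : set M) (Z : M -> 'cV[R[i]]_3),
    [/\ open W, W p, smooth_field W Z &
        forall q, W q -> Z q != 0 /\ T10 q = [set c *: Z q | c in setT]];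
  T10_conj : forall p v, T10 p v -> T10 p (conjm v) -> v = 0;
  T10_bracket : forall (W : set M) (X Y : M -> 'cV[R[i]]_3),
    open W -> smooth_field W X -> smooth_field W Y ->
    (forall q, W q -> T10 q (X q) /\ T10 q (Y q)) ->
    forall q, W q -> T10 q (bracket X Y q)
}.

Record pseudohermitian (R : realType) (M : manifold3 R) (H : cr_structure M) :=
  Pseudohermitian {
  theta : M -> 'rV[R[i]]_3;
  theta_smooth : smooth_form setT theta;
  theta_real : forall p, conjm (theta p) = theta p;
  theta_neq0 : forall p, theta p != 0;
  theta_ker : forall p v, ev (theta p) v = 0 <->
    exists z w, [/\ T10 H p z, T10 H p w & v = z + conjm w]
}.

Section Pseudohermitian.
Variables (R : realType) (M : manifold3 R) (H : cr_structure M).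
Variable (S : pseudohermitian H).
Local Notation C := R[i].
Local Notation theta := (theta S).
Implicit Types (p : M) (W U : set M) (Z : M -> 'cV[C]_3).
Implicit Types (eta : M -> 'rV[C]_3).

Definition levi p (z w : 'cV[C]_3) : C := 'i%C * ev2 (dform theta p) z (conjm w).

Definition levi_positive := forall p z, T10 H p z -> z != 0 -> 0 < levi p z z.

Definition reeb p : 'cV[C]_3 := xget 0 [set t | ev (theta p) t = 1 /\
  forall v, ev2 (dform theta p) t v = 0].

(* G is the matrix, in the coordinates of [chart_at p], of the Webster metric
   at p; u, v and t are real tangent vectors. *)
Definition is_webster_metric p (G : 'M[R]_3) :=
  let g (u v : 'cV[R]_3) := (u^T *m G *m v) 0 0 in
  let half z : 'cV[C]_3 := (Num.sqrt 2)^-1%:C *: (z + conjm z) in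
  [/\ G^T = G,
      forall u, u != 0 -> 0 < g u u,
      forall z w u v, T10 H p z -> T10 H p w ->
        realm u = half z -> realm v = half w -> g u v = complex.Re (levi p z w),
      forall z u t, T10 H p z ->
        realm u = half z -> realm t = reeb p -> g u t = 0 &
      forall t, realm t = reeb p -> g t t = 1].

Definition jacobian_at n (f : M -> 'rV[R]_n) p : 'M[R]_(n, 3) :=
  let c := chart_at p in
  \matrix_(k, i) partial i (fun x => f (cinv c x) 0 k) (cmap c p).

Definition isometric_immersion U n (f : M -> 'rV[R]_n) :=
  [/\ smooth_map U f,
      forall p, U p -> \rank (jacobian_at f p) = 3%N &
      forall p, U p ->
        is_webster_metric p ((jacobian_at f p)^T *m jacobian_at f p)].

(* z is a unit vector of T10 at p and zeta the first covector of the basis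
   dual to (z, conj z, T). *)
Definition frame_at p (z : 'cV[C]_3) (zeta : 'rV[C]_3) :=
  [/\ T10 H p z, levi p z z = 1, ev zeta z = 1,
      ev zeta (conjm z) = 0 & ev zeta (reeb p) = 0].

Definition local_frame W Z (zeta : M -> 'rV[C]_3) :=
  [/\ open W, smooth_field W Z & forall p, W p -> frame_at p (Z p) (zeta p)].

(* Sections of E^1 are given by representing 1-forms; [eqE1 p] is equality of
   the classes at p. *)
Definition eqE1 p (alpha beta : 'rV[C]_3) := exists t, alpha = beta + t *: theta p.

Definition section10 U eta := smooth_form U eta /\
  forall p z zeta, U p -> frame_at p z zeta -> exists g, eqE1 p (eta p) (g *: zeta).

(* d'f, represented by (Zf) zeta, which does not depend on the frame. *)
Definition dprime (f : M -> C) p : 'rV[C]_3 :=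
  xget 0 [set alpha | forall z zeta, frame_at p z zeta ->
                        alpha = ev (differential f p) z *: zeta].

Definition F2 p (beta : 'M[C]_3) := beta^T = - beta /\ wedge21_eq0 beta (theta p).

Definition F20 p (beta : 'M[C]_3) := exists z zeta (c : C),
  frame_at p z zeta /\ beta = c *: wedge zeta (theta p).

Definition F11 p (beta : 'M[C]_3) := exists z zeta (c : C),
  frame_at p z zeta /\ beta = c *: wedge (conjm zeta) (theta p).

Definition component11 p (beta : 'M[C]_3) : 'M[C]_3 :=
  xget 0 [set b | F11 p b /\ F20 p (beta - b)].

Definition add_theta eta (h : M -> C) p : 'rV[C]_3 := eta p + h p *: theta p.

Definition rumin_h U eta : M -> C := xget (fun=> 0) [set h |
  smooth U h /\ forall p, U p -> F2 p (dform (add_theta eta h) p)].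

Definition rumin_D U eta : M -> 'M[C]_3 := dform (add_theta eta (rumin_h U eta)).

(* The F^{1,1} component of D is called D'' on E^{1,0} and D' on E^{0,1}. *)
Definition Dsecond_10 U eta p := component11 p (rumin_D U eta p).
Definition Dprime_01 U eta p := component11 p (rumin_D U eta p).

Definition frame_a Z (zeta : M -> 'rV[C]_3) p : C :=
  'i%C * ev (zeta p) (bracket Z (fun q => conjm (Z q)) p).

(* The formal adjoint of d : E^0 -> E^1 for the products induced by the Webster
   metric, through its expression in pseudohermitian frames around p; the value
   is the same in all of them. *)
Definition delta eta p : C := xget 0 [set y |
  forall W Z zeta (g h : M -> C), W p -> local_frame W Z zeta ->
    smooth W g -> smooth W h ->
    (forall q, W q -> eqE1 q (eta q) (g q *: zeta q + h q *: conjm (zeta q))) ->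
    y = - (vderiv (fun q => conjm (Z q)) g p - 'i%C * frame_a Z zeta p * g p)
        - (vderiv Z h p + 'i%C * (frame_a Z zeta p)^*%C * h p)].

Section Vectorial.
Variable n : nat.
Implicit Type omega : 'I_n -> M -> 'rV[C]_3.

Definition conjf eta p : 'rV[C]_3 := conjm (eta p).

Definition dprime_map (f : M -> 'rV[R]_n) (k : 'I_n) : M -> 'rV[C]_3 :=
  dprime (fun p => (f p 0 k)%:C).

Definition eq_on U omega omega' :=
  forall k p, U p -> eqE1 p (omega k p) (omega' k p).

(* At p, omega = [zeta] (x) phi for some pseudohermitian coframe zeta. *)
Definition has_coef p omega (phi : 'I_n -> C) := exists z zeta,
  frame_at p z zeta /\ forall k, eqE1 p (omega k p) (phi k *: zeta).

Definition isometric_system U omega :=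
  [/\ forall k p, U p ->
        Dsecond_10 U (omega k) p = - Dprime_01 U (conjf (omega k)) p,
      forall p phi, U p -> has_coef p omega phi -> \sum_k phi k * phi k = 0,
      forall p phi, U p -> has_coef p omega phi -> \sum_k `|phi k| ^+ 2 = 1,
      forall p, U p ->
        \sum_k `|delta (fun q => omega k q - conjf (omega k) q) p| ^+ 2 = 1 &
      forall p, U p ->
        eqE1 p (\sum_k delta (conjf (omega k)) p *: omega k p) 0].

End Vectorial.
End Pseudohermitian.

(* Main.v *)
From HB Require Import structures.
Require Import Defs.
From mathcomp Require Import all_boot all_order all_algebra.
From mathcomp Require Import complex.
From mathcomp Require Import all_classical all_reals all_analysis.
From mathcomp Require Import ring lra.
Import Order.TTheory GRing.Theory Num.Theory.
Import numFieldNormedType.Exports.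

(** In a pseudohermitian frame (Z, conj Z, T) write omega = phi zeta modulo
    theta, let b = -(conj(Z) phi - i a phi) be the value of d(phi zeta) on
    (Z, conj Z), and let tau = -i (b - conj b).  The operator D extends omega to
    a 1-form whose differential has no zeta /\ conj zeta component; adding the
    complex conjugate gives the real 1-form

      gamma = phi zeta + conj(phi) conj(zeta) + tau theta

    ([rumin_lift], [rumin_lift_frame]).  It carries the whole proof.

    - D'' omega = - D' conj(omega) says that the conj zeta /\ theta component of
      d gamma vanishes.  As gamma is real, its zeta /\ theta component then
      vanishes too, so the equation means d gamma = 0 ([closed_iff]).
    - delta (omega - conj omega) = b - conj b = i tau, so the norm condition on
      it says that <tau, tau> = 1; and delta (conj omega) = conj b.  If
      <phi, phi> = 0, differentiating along conj Z gives <b, phi> = 0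
      ([sum_dbar_coef]), and then delta (conj omega) . omega = 0 says that
      <tau, phi> = 0.

    Hence omega solves the system if and only if gamma is closed and <phi, phi>
    = 0, |phi|^2 = 1, <tau, phi> = 0, <tau, tau> = 1 ([isometric_systemP]).
    These four equations say precisely that a map with differential gamma
    induces the Webster metric ([webster_metricP]).

    For a map f, the relation [Z, conj Z] = -i a Z - i conj(a) conj(Z) + i T
    shows that the form gamma attached to d'f is df ([rumin_lift_dprime]), which
    is closed: an isometric immersion yields a solution.  Conversely the closed
    forms gamma of a solution have primitives on small balls ([poincare]), and
    these are the components of an isometric immersion.  Since gamma depends
    on omega modulo theta alone ([rumin_lift_local]), two immersions with the
    same d'f have the same differential and differ by a translation on a
    connected set ([chart_ball_const]).

    The operators delta, D'' and D' are specified through frames.  They are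
    evaluated by writing them in terms of the exterior derivative, which is
    tensorial ([ev2_dform]), on the pair (Z, conj Z), on which every alternating
    form takes a value unchanged by Z |-> u Z with |u| = 1 ([dbar_coef_frame],
    [deltaE], [rumin_hE], [component11E]). *)

Set Implicit Arguments.
Unset Strict Implicit.
Unset Printing Implicit Defensive.
Local Open Scope classical_set_scope.
Local Open Scope ring_scope.

(** * Differential calculus on R^3 *)

Local Notation "''e_' i" := (delta_mx 0 i) (at level 8, i at level 2, format "''e_' i").

Section Euclid.
Variable R : realType.
Local Notation E := 'rV[R]_3.
Implicit Types (x y v : E) (g : E -> R) (O : set E).

Lemma is_derive_line g y v (t : R) : derivable g (t *: v + y) v ->
  is_derive t 1 (fun s : R => g (s *: v + y)) ('D_v g (t *: v + y)).
Proof.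
have eqf : (fun h : R => h^-1 *: (g ((h *: (1 : R) + t) *: v + y) - g (t *: v + y)))
  = (fun h : R => h^-1 *: (g (h *: v + (t *: v + y)) - g (t *: v + y))).
  by apply/funext => h; rewrite [h *: 1]mulr1 scalerDl addrA.
move=> dg; apply: DeriveDef; first by rewrite /derivable eqf.
by rewrite /derive eqf.
Qed.

(** The mean value theorem along an axis: it bounds increments of [g] in terms
    of one partial derivative at a time, without [g] being differentiable, and
    is thereby the tool behind [differentiable_of_partials] and [schwarz]. *)
Lemma mvt_line g y v (s : R) :
  (forall t : R, `|t| <= `|s| -> derivable g (t *: v + y) v) ->
  exists2 t : R, `|t| <= `|s| & g (s *: v + y) - g y = s * 'D_v g (t *: v + y).
Proof.
move=> dg; pose f := fun t : R => g (t *: v + y).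
have df (t : R) : `|t| <= `|s| -> is_derive t 1 f ('D_v g (t *: v + y)).
  by move=> /dg; exact: is_derive_line.
have cf (t : R) : `|t| <= `|s| -> {for t, continuous f}.
  move=> /df H; apply/differentiable_continuous/derivable1_diffP; exact: ex_derive.
have [s0|s0] := leP 0 s.
- have [|||t tI] := @MVT_segment R f (fun t => 'D_v g (t *: v + y)) 0 s.
  + by [].
  + by move=> t tI; apply: df; rewrite !ger0_norm ?(itvP tI).
  + apply/continuous_in_subspaceT => t; rewrite inE /= => tI.
    by apply: cf; rewrite !ger0_norm ?(itvP tI).
  + rewrite /f scale0r add0r subr0 mulrC => ->; exists t => //.
    by rewrite !ger0_norm ?(itvP tI).
- have [|||t tI] := @MVT_segment R f (fun t => 'D_v g (t *: v + y)) s 0.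
  + exact: ltW.
  + move=> t tI; apply: df; rewrite !ler0_norm ?lerN2 ?(itvP tI) // ltW //.
  + apply/continuous_in_subspaceT => t; rewrite inE /= => tI.
    by apply: cf; rewrite !ler0_norm ?lerN2 ?(itvP tI) // ltW.
  + rewrite /f scale0r add0r sub0r mulrN => h; exists t.
      by rewrite !ler0_norm ?(itvP tI) // ?lerN2 ?(itvP tI) // ltW.
    by apply: oppr_inj; rewrite opprB h mulrC.
Qed.

Lemma normE x (e : R) : 0 <= e -> (forall i, `|x 0 i| <= e) -> `|x| <= e.
Proof.
move=> e0 xe; rewrite [`|x|]mx_normrE; apply: bigmax_le => // -[i j] _ /=.
by rewrite ord1.
Qed.

Lemma norm_coord x i : `|x 0 i| <= `|x|.
Proof. by rewrite [`|x|]mx_normrE; apply: (le_bigmax _ (fun ij => `|x ij.1 ij.2|) (0, i)). Qed.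

Lemma norm_basis i : `|'e_i : E| <= 1.
Proof. by apply: normE => // j; rewrite mxE eqxx /=; case: eqP => _; rewrite ?normr1 ?normr0. Qed.

Lemma vec3E v : v = v 0 0 *: 'e_0 + (v 0 1 *: 'e_1 + v 0 2%:R *: 'e_(2%:R)).
Proof.
rewrite [LHS]row_sum_delta !big_ord_recl big_ord0 addr0; congr (_ + (_ + _));
  congr (v 0 _ *: 'e__); exact/val_inj.
Qed.

(** The increment of [g] is split into three increments along the axes.  By the
    mean value theorem each is the step times a partial derivative at a nearby
    point, which continuity lets one replace by the partial derivative at [x]. *)
Lemma differentiable_of_partials g x : (\forall y \near x, forall i, derivable g y 'e_i) ->
  (forall i, {for x, continuous (partial i g)}) -> differentiable g x.
Proof.
move=> dg cg.
(* The candidate differential. *)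
pose L v := v 0 0 * partial 0 g x + (v 0 1 * partial 1 g x + v 0 2%:R * partial 2%:R g x).
have Llin : linear L.
  move=> a u v; rewrite /L; move: (partial _ _ _) (partial _ _ _) (partial _ _ _) => p q r.
  by rewrite !mxE -[a *: _]/(a * _); ring.
have [Ll LlE] : exists Ll : {linear E -> R}, Ll = L :> (E -> R).
  pose LM := GRing.isLinear.Build _ _ _ _ _ Llin.
  pose L' : {linear E -> R} := HB.pack L LM.
  by exists L'.
have cL : continuous Ll.
  rewrite LlE => v.
  have cc i (k : R) : {for v, continuous (fun v : E => v 0 i * k : R)}.
    by apply: continuousM; [exact: coord_continuous|exact: cst_continuous].
  exact: (continuousD (cc _ _) (continuousD (cc _ _) (cc _ _))).
have key : g \o shift x = cst (g x) + Ll +o_ (0 : E) id.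
  apply/eqaddoP => e e0.
  have e30 : 0 < e / 3%:R by rewrite divr_gt0.
  have [d d0 dP] : exists2 d : R, 0 < d & forall w : E, `|w| < d -> forall i,
      derivable g (w + x) 'e_i /\ `|partial i g (w + x) - partial i g x| <= e / 3%:R.
    have : \forall y \near x, forall i, derivable g y 'e_i /\
        `|partial i g y - partial i g x| <= e / 3%:R.
      have H i : \forall y \near x, derivable g y 'e_i /\
          `|partial i g y - partial i g x| <= e / 3%:R.
        have /cvgrPdist_le /(_ _ e30) := cg i.
        apply: filterS2 dg => y dgy; rewrite distrC => ?; split => //; exact: dgy.
      exact: (@filter_forall _ _ _ _ _ H).
    move=> /nbhs_ballP [d /= d0 dP]; exists d => // w wd; apply: dP.
    by rewrite mx_norm_ball /ball_ /= opprD addrCA subrr addr0 normrN.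
  have step i (u : E) (s : R) : (forall t : R, `|t| <= `|s| -> `|t *: 'e_i + u| < d) ->
     `|g (s *: 'e_i + u + x) - g (u + x) - s * partial i g x| <= e / 3%:R * `|s|.
    move=> Hd.
    have [|t ts ht] := @mvt_line g (u + x) 'e_i s.
      by move=> t /Hd /dP /(_ i) []; rewrite addrA.
    rewrite !addrA in ht; rewrite ht -mulrBr normrM mulrC ler_wpM2r //.
    by have [_] := dP _ (Hd t ts) i.
  near=> v.
  have vd : `|v| < d.
    by near: v; apply/nbhs_ballP; exists d => //= v; rewrite mx_norm_ball /ball_ /= sub0r normrN.
  have vc i : `|v 0 i| < d by apply: le_lt_trans vd; exact: norm_coord.
  have lex (a b : E) : (forall i, `|(a + b) 0 i| < d) -> `|a + b| < d.
    move=> ab; rewrite [X in X < _]mx_normrE; apply: bigmax_lt => // -[k l] _ /=.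
    by rewrite ord1.
  have h0 := @step 0 (v 0 1 *: 'e_1 + v 0 2%:R *: 'e_(2%:R)) (v 0 0).
  have h1 := @step 1 (v 0 2%:R *: 'e_(2%:R)) (v 0 1).
  have h2 := @step 2%:R 0 (v 0 2%:R).
  have coordE (a b c : R) i : (a *: 'e_0 + (b *: 'e_1 + c *: 'e_(2%:R)) : E) 0 i =
    [:: a; b; c]`_i.
    by rewrite !mxE /=; case: i => -[|[|[|]]] //= ?; rewrite ?mulr1 ?mulr0 ?addr0 ?add0r.
  have k0 : forall t : R, `|t| <= `|v 0 0| ->
      `|(t *: 'e_0 + (v 0 1 *: 'e_1 + v 0 2%:R *: 'e_(2%:R)) : E)| < d.
    move=> t tv; apply: lex => i; rewrite coordE; case: i => -[|[|[|]]] //= ?.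
    exact: le_lt_trans (vc 0).
  have k1 : forall t : R, `|t| <= `|v 0 1| ->
      `|(t *: 'e_1 + v 0 2%:R *: 'e_(2%:R) : E)| < d.
    move=> t tv; apply: lex => i; have := coordE 0 t (v 0 2%:R) i.
    rewrite scale0r add0r => ->; case: i => -[|[|[|]]] //= ?; rewrite ?normr0 //.
    exact: le_lt_trans (vc 1).
  have k2 : forall t : R, `|t| <= `|v 0 2%:R| ->
      `|t *: 'e_(2%:R) + (0 : E)| < d.
    move=> t tv; apply: lex => i; have := coordE 0 0 t i.
    rewrite !scale0r !add0r addr0 => ->; case: i => -[|[|[|]]] //= ?; rewrite ?normr0 //.
    exact: le_lt_trans (vc 2%:R).
  move: h0 h1 h2 => /(_ k0) h0 /(_ k1) h1 /(_ k2) h2.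
  have e3v i : e / 3%:R * `|v 0 i| <= e / 3%:R * `|v|.
    by rewrite ler_wpM2l ?norm_coord // ltW.
  rewrite !fctE /= LlE {1}[v]vec3E /L.
  rewrite addr0 add0r in h2.
  set g0 := g _ in h0 *; set g1 := g _ in h0 h1; set g2 := g _ in h1 h2.
  have alg (a b c d' p q r : R) : a - (d' + (p + (q + r))) = (a - b - p) +
    ((b - c - q) + (c - d' - r)).
    by ring.
  (* g0, g1 and g2 are the values of g at the corners of the path along the axes. *)
  rewrite (alg _ g1 g2) => {alg}.
  have -> : e * `|v| = e / 3%:R * `|v| + (e / 3%:R * `|v| + e / 3%:R * `|v|) by field.
  apply: le_trans (ler_normD _ _) _; apply: lerD; first exact: le_trans h0 _.
  apply: le_trans (ler_normD _ _) _; apply: lerD; first exact: le_trans h1 _.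
  exact: le_trans h2 _.
apply/diff_locallyP; rewrite (diff_unique cL key); split => //.
Unshelve. all: by end_near. Qed.

Lemma derive_sumE g x v : differentiable g x -> 'D_v g x = \sum_i v 0 i * partial i g x.
Proof.
move=> dg; rewrite deriveE // {1}(row_sum_delta v) linear_sum; apply: eq_bigr => i _.
by rewrite linearZ /= /partial deriveE.
Qed.

(** Coordinates are linear, hence equal to their own differential. *)
Lemma diff_coordE (j : 'I_3) x v : 'd (fun y : E => y 0 j : R) x v = v 0 j.
Proof.
have flin : linear (fun y : E => y 0 j : R) by move=> a u w; rewrite !mxE.
pose LM := GRing.isLinear.Build _ _ _ _ _ flin.
pose L' : {linear E -> R} := HB.pack (fun y : E => y 0 j : R) LM.
by rewrite (@diff_lin _ _ _ L') //; exact: coord_continuous.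
Qed.

Lemma differentiable_row (phi : E -> E) x :
  (forall j, differentiable (fun y => phi y 0 j : R) x) -> differentiable phi x.
Proof.
move=> dphi.
have -> : phi = \sum_(j < 3) (fun y => phi y 0 j *: 'e_j).
  by apply/funext => y; rewrite fct_sumE -row_sum_delta.
by apply: differentiable_sum => j; exact: differentiableZl.
Qed.

Lemma chain_rule g (phi : E -> E) x v : differentiable g (phi x) ->
  (forall j, differentiable (fun y => phi y 0 j : R) x) ->
  'D_v (g \o phi) x = \sum_j partial j g (phi x) * 'D_v (fun y => phi y 0 j : R) x.
Proof.
move=> dg dphi; have dphi' := differentiable_row dphi.
rewrite deriveE; last exact: differentiable_comp.
rewrite diff_comp //= -deriveE // derive_sumE //; apply: eq_bigr => j _.
rewrite mulrC deriveE //; congr (_ * _).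
have -> : (fun y => phi y 0 j) = (fun y : E => y 0 j : R) \o phi by [].
have dc : differentiable (fun y : E => y 0 j : R) (phi x) :=
  @differentiable_coord R 1 3 (phi x) 0 j.
by rewrite (diff_comp dphi' dc) /= diff_coordE.
Qed.

Lemma derive_translate g c x v : 'D_v (fun y => g (c + y)) x = 'D_v g (c + x).
Proof.
rewrite /derive.
suff -> : (fun h : R => h^-1 *: (g (c + (h *: v + x)) - g (c + x))) =
  (fun h : R => h^-1 *: (g (h *: v + (c + x)) - g (c + x))) by [].
by apply/funext => h; rewrite addrCA.
Qed.

Lemma derivable_translate g c x v : derivable g (c + x) v -> derivable (fun y => g (c + y)) x v.
Proof.
rewrite /derivable.
suff -> : (fun h : R => h^-1 *: (g (c + (h *: v + x)) - g (c + x))) =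
  (fun h : R => h^-1 *: (g (h *: v + (c + x)) - g (c + x))) by [].
by apply/funext => h; rewrite addrCA.
Qed.

(** Two mean value theorems: in direction [i] for g (h e_j + .) - g, then in
    direction [j] for the resulting difference of i-th partials. *)
Lemma second_difference g i j x (d h : R) : `|h| + `|h| < d ->
  (forall w, `|w| < d -> derivable g (w + x) 'e_i /\ derivable (partial i g) (w + x) 'e_j) ->
  exists2 w, `|w| < d & (g (h *: 'e_j + (h *: 'e_i + x)) - g (h *: 'e_i + x)) -
     (g (h *: 'e_j + x) - g x) = h * (h * partial j (partial i g) (w + x)).
Proof.
move=> hd dg.
have small (a b : R) k l : `|a| <= `|h| -> `|b| <= `|h| -> `|(a *: 'e_k + b *: 'e_l : E)| < d.
  move=> ah bh; apply: le_lt_trans hd; apply: le_trans (ler_normD _ _) _.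
  by apply: lerD; rewrite normrZ -[leRHS]mulr1; apply: ler_pM => //; exact: norm_basis.
have small1 (a : R) k : `|a| <= `|h| -> `|(a *: 'e_k : E)| < d.
  by move=> ah; have := small a 0 k k ah; rewrite normr0 normr_ge0 scale0r addr0; exact.
have dG t : `|t| <= `|h| -> derivable (fun y => g (h *: 'e_j + y)) (t *: 'e_i + x) 'e_i.
  move=> th; apply: derivable_translate; rewrite addrA.
  exact: (proj1 (dg _ (small h t j i (lexx _) th))).
have dg' t : `|t| <= `|h| -> derivable g (t *: 'e_i + x) 'e_i.
  by move=> th; exact: (proj1 (dg _ (small1 t i th))).
have [t th] := @mvt_line (fun y => g (h *: 'e_j + y) - g y) x 'e_i h
   (fun t th => derivableB (dG t th) (dg' t th)).
move=> ->; rewrite deriveB; [|exact: dG|exact: dg'].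
rewrite derive_translate -!/(partial i g _).
have [t' th'|s sh ->] := @mvt_line (partial i g) (t *: 'e_i + x) 'e_j h.
  by rewrite addrA; exact: (proj2 (dg _ (small t' t j i th' th))).
by exists (s *: 'e_j + t *: 'e_i); [exact: small|rewrite addrA].
Qed.

Lemma CkSE k O g : Ck k.+1 O g <-> (forall x, O x -> {for x, continuous g}) /\
  forall i, (forall x, O x -> derivable g x 'e_i) /\ Ck k O (partial i g).
Proof. by []. Qed.

Lemma Ck_continuous k O g x : O x -> Ck k O g -> {for x, continuous g}.
Proof. by case: k => [|k] Ox [cg _]; exact: cg. Qed.

Lemma CkS k O g : Ck k.+1 O g -> Ck k O g.
Proof.
elim: k g => [|k IH] g [cg dg]; split => // i.
by have [dgi Ci] := dg i; split => //; exact: IH.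
Qed.

Lemma near_continuous g h x : {near x, g =1 h} -> {for x, continuous g} ->
  {for x, continuous h}.
Proof.
move=> gh cg; rewrite /prop_for /continuous_at -(nbhs_singleton gh).
exact: cvg_trans (@near_eq_cvg _ _ (nbhs x) _ _ _ gh) cg.
Qed.

Lemma Ck_sub k O O' g : O' `<=` O -> Ck k O g -> Ck k O' g.
Proof.
move=> OO; elim: k g => [|k IH] g [cg dg]; split => //; try by move=> x /OO /cg.
by move=> i; have [dgi Ci] := dg i; split; [move=> x /OO /dgi|exact: IH].
Qed.

Lemma near_open O x (P : E -> Prop) : open O -> O x -> (forall y, O y -> P y) ->
  \forall y \near x, P y.
Proof. by move=> oO Ox OP; apply: filterS (open_nbhs_nbhs (conj oO Ox)). Qed.

Lemma Ck_ext k O g h : open O -> (forall x, O x -> g x = h x) -> Ck k O g -> Ck k O h.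
Proof.
move=> oO; elim: k g h => [|k IH] g h gh [cg dg].
  by split => // x Ox; apply: near_continuous (cg x Ox); exact: near_open oO Ox gh.
split; first by move=> x Ox; apply: near_continuous (cg x Ox); exact: near_open oO Ox gh.
move=> i; have [dgi Ci] := dg i; split.
  by move=> x Ox; apply: near_eq_derivable (dgi x Ox); exact: near_open oO Ox gh.
apply: IH Ci => x Ox; apply: near_eq_derive; exact: near_open oO Ox gh.
Qed.

Lemma Ck_differentiable k O g x : open O -> O x -> Ck k.+1 O g -> differentiable g x.
Proof.
move=> oO Ox /CkSE[cg dg]; apply: differentiable_of_partials.
  by apply: near_open oO Ox _ => y Oy i; apply: (proj1 (dg i)).
by move=> i; apply: Ck_continuous Ox _; exact: (proj2 (dg i)).
Qed.

Lemma quotient_eq (h a b c d p q : R) : 0 < h -> (a - b) - (c - d) = h * (h * p) ->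
  (a - c) - (b - d) = h * (h * q) -> p = q.
Proof.
move=> h0 E1 E2; apply: (mulfI (lt0r_neq0 h0)); apply: (mulfI (lt0r_neq0 h0)).
by rewrite -E1 -E2; ring.
Qed.

Lemma dist_half (e A a B b : R) : `|A - a| <= e / 2 -> `|B - b| <= e / 2 -> a = b -> `|A - B| <= e.
Proof.
move=> h1 h2 ab; rewrite ab in h1; rewrite [e]splitr.
have -> : A - B = (A - b) - (B - b) by ring.
by apply: le_trans (ler_normB _ _) _; exact: lerD.
Qed.

(** The second difference of [g] is symmetric in [i] and [j].  Evaluated by
    [second_difference] in both orders, it gives the two mixed partials at points
    close to [x], so by continuity they agree at [x] up to any e > 0. *)
Lemma schwarz O g x i j : open O -> O x -> Ck 2 O g ->
  partial i (partial j g) x = partial j (partial i g) x.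
Proof.
move=> oO Ox C2.
have cont k l : {for x, continuous (partial k (partial l g))}.
  have /CkSE[_ /(_ l) [_ /CkSE[_ /(_ k) [_ C0]]]] := C2; exact: Ck_continuous Ox C0.
have dg k l w : O w -> derivable g w 'e_k /\ derivable (partial k g) w 'e_l.
  move=> Ow; have /CkSE[_ /(_ k) [d1 /CkSE [_ /(_ l) [d2 _]]]] := C2.
  by split; [exact: d1|exact: d2].
apply/eqP; rewrite -subr_eq0 -normr_le0; apply/ler_addgt0Pr => e e0; rewrite add0r.
have e20 : 0 < e / 2 by rewrite divr_gt0.
have : \forall w \near x,
  [/\ O w, `|partial i (partial j g) x - partial i (partial j g) w| <= e / 2 &
    `|partial j (partial i g) x - partial j (partial i g) w| <= e / 2].
  have /cvgrPdist_le /(_ _ e20) H1 := cont i j.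
  have /cvgrPdist_le /(_ _ e20) H2 := cont j i.
  by apply: filterS3 (open_nbhs_nbhs (conj oO Ox)) H1 H2 => w; exact: And3.
move=> /nbhs_ballP [d /= d0 dP].
have {}dP w : `|w| < d ->
  [/\ O (w + x), `|partial i (partial j g) x - partial i (partial j g) (w + x)| <= e / 2 &
    `|partial j (partial i g) x - partial j (partial i g) (w + x)| <= e / 2].
  by move=> wd; apply: dP; rewrite mx_norm_ball /ball_ /= opprD addrCA subrr addr0 normrN.
(* Any h with 2 h < d keeps all the points in the ball. *)
pose h := d / 3%:R.
have h0 : 0 < h by rewrite divr_gt0.
have hd : `|h| + `|h| < d by rewrite gtr0_norm // /h; lra.
have [w wd E1] := second_difference hd (fun w wd => dg i j _ (let: And3 a _ _ := dP w wd in a)).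
have [w' wd' E2] := second_difference hd (fun w wd => dg j i _ (let: And3 a _ _ := dP w wd in a)).
rewrite (addrCA (h *: 'e_i)) in E2.
have [_ _ B1] := dP _ wd; have [_ B2 _] := dP _ wd'.
apply: (dist_half B2 B1); exact: esym (quotient_eq h0 E1 E2).
Qed.

Lemma Ck_cst k O (c : R) : Ck k O (fun=> c).
Proof.
elim: k c => [|k IH] c; first by split => // x _; exact: cst_continuous.
apply/CkSE; split => [x _|i]; first exact: cst_continuous.
split => [x _|]; first exact: derivable_cst.
suff -> : partial i (fun=> c) = fun=> 0 by exact: IH.
by apply/funext => x; rewrite /partial derive_cst.
Qed.

Lemma Ck_coord k O (j : 'I_3) : Ck k O (fun x => x 0 j).
Proof.
case: k => [|k]; first by split => // x _; exact: coord_continuous.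
apply/CkSE; split => [x _|i]; first exact: coord_continuous.
split => [x _|]; first by apply: diff_derivable; exact: differentiable_coord.
suff -> : partial i (fun x : E => x 0 j) = fun=> ('e_i : E) 0 j by exact: Ck_cst.
by apply/funext => x; rewrite /partial deriveE ?diff_coordE //; exact: differentiable_coord.
Qed.

Lemma Ck_add k O g h : open O -> Ck k O g -> Ck k O h -> Ck k O (fun x => g x + h x).
Proof.
move=> oO; elim: k g h => [|k IH] g h [cg dg] [ch dh].
  by split => // x Ox; apply: continuousD; [exact: cg|exact: ch].
split; first by move=> x Ox; apply: continuousD; [exact: cg|exact: ch].
move=> i; have [dgi Cg] := dg i; have [dhi Ch] := dh i; split.
  by move=> x Ox; apply: derivableD; [exact: dgi|exact: dhi].
apply: Ck_ext (IH _ _ Cg Ch) => // x Ox.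
by rewrite /partial deriveD //; [exact: dgi|exact: dhi].
Qed.

Lemma Ck_mul k O g h : open O -> Ck k O g -> Ck k O h -> Ck k O (fun x => g x * h x).
Proof.
move=> oO; elim: k g h => [|k IH] g h Cg0 Ch0; have [cg dg] := Cg0; have [ch dh] := Ch0.
  by split => // x Ox; apply: continuousM; [exact: cg|exact: ch].
split; first by move=> x Ox; apply: continuousM; [exact: cg|exact: ch].
move=> i; have [dgi Cg] := dg i; have [dhi Ch] := dh i; split.
  by move=> x Ox; apply: derivableM; [exact: dgi|exact: dhi].
apply: Ck_ext (Ck_add oO (IH _ _ (CkS Cg0) Ch) (IH _ _ (CkS Ch0) Cg)) => // x Ox.
by rewrite /partial deriveM //; [exact: dgi|exact: dhi].
Qed.

Lemma Ck_opp k O g : open O -> Ck k O g -> Ck k O (fun x => - g x).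
Proof.
move=> oO Cg; apply: Ck_ext (Ck_mul oO (Ck_cst k O (-1)) Cg) => // x _.
by rewrite mulN1r.
Qed.

Lemma Ck_sum k O (n : nat) (g : 'I_n -> E -> R) : open O -> (forall i, Ck k O (g i)) ->
  Ck k O (fun x => \sum_i g i x).
Proof.
move=> oO Cg; elim: n g Cg => [|n IH] g Cg.
  by apply: Ck_ext (Ck_cst k O 0) => // x _; rewrite big_ord0.
have := Ck_add oO (Cg ord0) (IH _ (fun i => Cg (lift ord0 i))).
by apply: Ck_ext => // x _; rewrite big_ord_recl.
Qed.

Lemma continuous_row (phi : E -> E) x :
  (forall j, {for x, continuous (fun y => phi y 0 j : R)}) -> {for x, continuous phi}.
Proof.
move=> cphi; have -> : phi = fun y =>
  phi y 0 0 *: 'e_0 + (phi y 0 1 *: 'e_1 + phi y 0 2%:R *: 'e_(2%:R)).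
  by apply/funext => y; rewrite -vec3E.
have cZ i : {for x, continuous (fun y => phi y 0 i *: ('e_i : E))}.
  exact: (continuous_comp (cphi i) (@scalel_continuous _ _ _ _)).
exact: (continuousD (cZ _) (continuousD (cZ _) (cZ _))).
Qed.

(** By the chain rule a partial derivative of g \o phi is a sum of products of
    partials of [g] composed with phi and partials of phi: induction on [k]. *)
Lemma Ck_comp k O O' g (phi : E -> E) : open O -> open O' -> (forall x, O x -> O' (phi x)) ->
  (forall j, Ck k O (fun x => phi x 0 j)) -> Ck k O' g -> Ck k O (g \o phi).
Proof.
move=> oO oO' OO'; have cont l h : Ck l O' h -> (forall j, Ck l O (fun x => phi x 0 j)) ->
    forall x, O x -> {for x, continuous (h \o phi)}.
  move=> Ch Cphi x Ox; apply: continuous_comp.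
    by apply: continuous_row => j; exact: Ck_continuous (Cphi j).
  by apply: Ck_continuous Ch; exact: OO'.
elim: k g => [|k IH] g Cphi Cg; first by split => //; exact: cont Cg Cphi.
split; first exact: cont Cg Cphi.
have dg x : O x -> differentiable g (phi x).
  by move=> /OO' Ox; exact: Ck_differentiable Ox Cg.
have dphi x j : O x -> differentiable (fun y => phi y 0 j : R) x.
  by move=> Ox; exact: Ck_differentiable Ox (Cphi j).
move=> i; split.
  move=> x Ox; apply: diff_derivable; apply: differentiable_comp; last exact: dg.
  by apply: differentiable_row => j; exact: dphi.
have /CkSE[_ Cg'] := Cg.
have := Ck_sum oO (fun j =>
  Ck_mul oO (IH _ (fun j => CkS (Cphi j)) (proj2 (Cg' j))) (proj2 (proj2 (Cphi j) i))).
apply: Ck_ext => // x Ox; rewrite /partial chain_rule //; first exact: dg.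
by move=> j; exact: dphi.
Qed.

(** If s = g^(-1/2), each partial derivative of s is -1/2 s^3 times that of [g],
    an expression in s itself: this closes the induction on [k]. *)
Lemma Ck_rsqrt k O g : open O -> (forall x, O x -> 0 < g x) -> Ck k O g ->
  Ck k O (fun x => (Num.sqrt (g x))^-1).
Proof.
move=> oO g0.
have cont x : O x -> {for x, continuous g} -> {for x, continuous (fun x => (Num.sqrt (g x))^-1)}.
  move=> Ox cg; apply: continuousV; first by rewrite gt_eqF // sqrtr_gt0 g0.
  apply: continuous_comp => //; exact: sqrt_continuous.
elim: k => [|k IH] Cg; first by split => // x Ox; apply: cont => //; exact: Ck_continuous Cg.
have der i x : O x -> is_derive x 'e_i (fun x => (Num.sqrt (g x))^-1)
   (- 2^-1 * ((Num.sqrt (g x))^-1 * ((Num.sqrt (g x))^-1 * ((Num.sqrt (g x))^-1 * partial i g x)))).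
  move=> Ox; have dg : differentiable g x by exact: Ck_differentiable Ox Cg.
  have s0 : Num.sqrt (g x) != 0 by rewrite gt_eqF // sqrtr_gt0 g0.
  have [ds dsE] := is_derive1_sqrt (g0 _ Ox).
  have dh : derivable (fun r : R => (Num.sqrt r)^-1) (g x) 1 by exact: derivableV.
  have dhd := (iffLR (derivable1_diffP _ _)) dh.
  apply: DeriveDef; first by apply: diff_derivable; exact: differentiable_comp dg dhd.
  rewrite deriveE; last exact: differentiable_comp dg dhd.
  rewrite (diff_comp dg dhd) /= -[X in 'd _ _ X]mulr1 [LHS]linearZ /= -deriveE // -deriveE //.
  have alg (s q : R) : s != 0 -> q *: ((- s ^- 2) *: (2 * s)^-1) = - 2^-1 *
    (s^-1 * (s^-1 * (s^-1 * q))).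
    by move=> s1; rewrite -[_ *: (_ *: _)]/(q * (_ * _)); field.
  rewrite -/(partial i g x) (deriveV s0 ds) dsE; exact: alg.
split; first by move=> x Ox; apply: cont => //; exact: Ck_continuous Cg.
move=> i; split; first by move=> x Ox; by case: (der i x Ox) => d _; exact: d.
have C := IH (CkS Cg); have C1 := proj2 (proj2 Cg i).
have := Ck_mul oO (Ck_cst k O (- 2^-1)) (Ck_mul oO C (Ck_mul oO C (Ck_mul oO C C1))).
by apply: Ck_ext => // x Ox; rewrite /partial; by case: (der i x Ox) => _ ->.
Qed.

(** * The Poincare lemma on a ball *)

Local Notation mu := (@lebesgue_measure R).

(** Dominated convergence with a constant bound on the unit interval. *)
Lemma leibniz_integral (f f' : R -> R -> R) (d K : R) : 0 < d ->
  (forall s t, s \in `]-d, d[ -> t \in `[0, 1] -> is_derive s 1 (f ^~ t) (f' s t)) ->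
  (forall s t, s \in `]-d, d[ -> t \in `[0, 1] -> `|f' s t| <= K) ->
  (forall s, s \in `]-d, d[ -> {within `[0, 1], continuous (f s)}) ->
  is_derive (0 : R) 1 (fun s => \int[mu]_(t in `[0, 1]) f s t) (\int[mu]_(t in `[0, 1]) f' 0 t).
Proof.
move=> d0 df f'K cf.
have I0 : (0 : R) \in `]-d, d[ by rewrite in_itv /= oppr_lt0 d0.
have d1E s t : s \in `]-d, d[ -> t \in `[0, 1] -> partial1of2 f s t = f' s t.
  by move=> sI tI; rewrite partial1of2E; case: (df s t sI tI) => _ ->.
have K0 : 0 <= K.
  by apply: le_trans (f'K 0 0 I0 _); rewrite ?in_itv /= ?lexx ?ler01.
have := @cvg_differentiation_under_integral R _ _ mu f `[0, 1] _ 0 (-d) d _ _ _ (fun=> K) _ _ _.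
move=> H.
have {}H : h^-1 *: ((\int[mu]_(t in `[0, 1]) f (h *: (1 : R) + 0) t) - (\int[mu]_(t in `[0,
  1]) f 0 t)) @[h --> 0^'] --> \int[mu]_(t in `[0, 1]) f' 0 t.
  rewrite [X in _ --> X](_ : _ = \int[mu]_(y in `[0, 1]) (partial1of2 f 0 y)); last first.
    by apply: eq_Rintegral => t; rewrite inE /= => tI; rewrite d1E.
  under eq_fun do rewrite scaler1.
  apply: H => //=.
  - move=> s sI; apply: continuous_compact_integrable; first exact: segment_compact.
    exact: cf.
  - by move=> s t sI tI; case: (df s t sI tI).
  - apply: continuous_compact_integrable => //; first exact: segment_compact.
    by apply: continuous_subspaceT; exact: cst_continuous.
  - by move=> s t sI tI; rewrite d1E //; exact: f'K.
apply: DeriveDef; last exact: cvg_lim H.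
by apply/cvg_ex; eexists; exact: H.
Qed.

Lemma FTC_unit (G G' : R -> R) : (forall t : R, t \in `[0, 1] -> is_derive t 1 G (G' t)) ->
  {within `[0, 1], continuous G'} -> \int[mu]_(t in `[0, 1]) G' t = G 1 - G 0.
Proof.
move=> dG cG'.
have cG (t : R) : t \in `[0, 1] -> {for t, continuous G}.
  move=> /dG [H _]; apply/differentiable_continuous/derivable1_diffP; exact: H.
rewrite /Rintegral (@continuous_FTC2 _ _ G) //.
- split => [t tI||].
  + by have [] := dG t (subset_itv_oo_cc tI).
  + by apply: cvg_at_right_filter; apply: cG; rewrite in_itv /= lexx ler01.
  + by apply: cvg_at_left_filter; apply: cG; rewrite in_itv /= lexx ler01.
- by move=> t tI; rewrite derive1E; have [] := dG t (subset_itv_oo_cc tI).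
Qed.

(** Mean value theorem on the segment from the centre to the point. *)
Lemma constant_on_ball g x0 (r : R) : 0 < r -> Ck 1 (ball x0 r) g ->
  (forall x i, ball x0 r x -> partial i g x = 0) -> forall x, ball x0 r x -> g x = g x0.
Proof.
move=> r0 Cg g0 x xB.
have inB (t : R) : `|t| <= `|1 : R| -> ball x0 r (t *: (x - x0) + x0).
  move: xB; rewrite mx_norm_ball /ball_ /= => xB tr.
  rewrite opprD addrCA subrr addr0 normrN; apply: le_lt_trans xB.
  by rewrite normrZ -[leRHS]mul1r [`|x - x0|]distrC ler_wpM2r // (le_trans tr) ?normr1.
have dg y : ball x0 r y -> differentiable g y.
  by move=> yB; apply: Ck_differentiable yB Cg; exact: ball_open.
have [|t t1] := @mvt_line g x0 (x - x0) 1.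
  by move=> t t1; apply/diff_derivable/dg/inB.
rewrite scale1r subrK mul1r derive_sumE ?big1 => [|i _|]; last exact/dg/inB.
  by move=> /eqP; rewrite subr_eq0 => /eqP.
by rewrite g0 ?mulr0 //; exact: inB.
Qed.

Lemma is_derive_from_line g x v D : is_derive (0 : R) 1 (fun s : R => g (s *: v + x)) D ->
  is_derive x v g D.
Proof.
have eqf : (fun h : R => h^-1 *: (g ((h *: (1 : R) + 0) *: v + x) - g (0 *: v + x)))
  = (fun h : R => h^-1 *: (g (h *: v + x) - g x)).
  by apply/funext => h; rewrite [h *: 1]mulr1 addr0 scale0r add0r.
by move=> [d <-]; apply: DeriveDef; [move: d; rewrite /derivable eqf|rewrite /derive eqf].
Qed.

Lemma continuous_sum (T : topologicalType) (n : nat) (h : 'I_n -> T -> R) (t : T) :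
  (forall i, {for t, continuous (h i)}) -> {for t, continuous (fun t => \sum_i h i t)}.
Proof.
elim: n h => [|n IH] h ch.
  have -> : (fun t => \sum_i h i t) = fun=> 0 by apply/funext => s; rewrite big_ord0.
  exact: cst_continuous.
have -> : (fun t => \sum_i h i t) = fun t => h ord0 t + \sum_i h (lift ord0 i) t.
  by apply/funext => s; rewrite big_ord_recl.
by apply: continuousD; [exact: ch|apply: IH => i; exact: ch].
Qed.

Lemma ler_term_sum (n : nat) (a : 'I_n -> R) i : (forall i, 0 <= a i) -> a i <= \sum_i a i.
Proof. by move=> a0; rewrite (bigD1 i) //= lerDl sumr_ge0. Qed.

(** The primitive is F x = int_0^1 sum_i b_i (x0 + t w) w_i dt with w = x - x0.
    Differentiating under the integral and replacing d_j b_i by d_i b_j turns the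
    integrand into d/dt (t b_j (x0 + t w)), whose integral is b_j x.  The ball is
    taken so small that [b] and its partials are bounded on it. *)
Lemma poincare_ball (b : 'I_3 -> E -> R) O x0 : open O -> O x0 ->
  (forall i, Ck 1 O (b i)) ->
  (forall x i j, O x -> partial i (b j) x = partial j (b i) x) ->
  exists2 r : R, 0 < r & ball x0 r `<=` O /\
   exists F : E -> R, forall x i, ball x0 r x -> is_derive x 'e_i F (b i x).
Proof.
move=> oO Ox0 Cb closed.
(* K exceeds all |b_i| and all |d_i b_j| at x0, hence near x0 by continuity. *)
pose a i := \sum_j `|partial i (b j) x0| + `|b i x0|.
have a0 i : 0 <= a i by rewrite addr_ge0 // sumr_ge0.
pose K : R := \sum_i a i + 1.
have aK i : a i < K by rewrite ltr_pwDr // ler_term_sum.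
have Kle1 i j : `|partial i (b j) x0| < K.
  apply: le_lt_trans (aK i); rewrite ler_wpDr //.
  exact: (@ler_term_sum _ (fun j => `|partial i (b j) x0|)).
have Kle2 i : `|b i x0| < K.
  by apply: le_lt_trans (aK i); rewrite ler_wpDl // sumr_ge0.
have : \forall x \near x0, [/\ O x, forall i j, `|partial i (b j) x| <= K & forall i,
  `|b i x| <= K].
  have H1 : \forall x \near x0, forall i j, `|partial i (b j) x| <= K.
    apply: (@filter_forall _ _ _ (nbhs x0)) => i; apply: (@filter_forall _ _ _ (nbhs x0)) => j.
    have /CkSE[_ /(_ i) [_ Cij]] := Cb j.
    by have /cvgr_norm_le := Ck_continuous Ox0 Cij; apply.
  have H2 : \forall x \near x0, forall i, `|b i x| <= K.
    apply: (@filter_forall _ _ _ (nbhs x0)) => i.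
    by have /cvgr_norm_le := Ck_continuous Ox0 (Cb i); apply.
  by apply: filterS3 (open_nbhs_nbhs (conj oO Ox0)) H1 H2 => x; exact: And3.
move=> /nbhs_ballP [r /= r0 rP]; exists r => //; split; first by move=> x /rP [].
pose w x := x - x0.
have tB x (t : R) : `|w x| < r -> t \in `[0, 1] -> ball x0 r (t *: w x + x0).
  move=> xr; rewrite in_itv /= => /andP[t0 t1]; rewrite mx_norm_ball /ball_ /=.
  rewrite opprD addrCA subrr addr0 normrN normrZ ger0_norm //; apply: le_lt_trans xr.
  by rewrite ler_piMl.
exists (fun x => \int[mu]_(t in `[0, 1]) \sum_i b i (t *: w x + x0) * w x 0 i) => x j.
rewrite mx_norm_ball /ball_ /= distrC -/(w x) => xr.
have db y i : ball x0 r y -> differentiable (b i) y.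
  by move=> /rP[Oy _ _]; exact: Ck_differentiable (Cb i).
pose d := r - `|w x|.
have d0 : 0 < d by rewrite subr_gt0.
have wE s : w (s *: 'e_j + x) = s *: 'e_j + w x by rewrite /w addrA.
have sB s : s \in `]-d, d[ -> `|w (s *: 'e_j + x)| < r.
  rewrite in_itv /= -ltr_norml wE => sd; apply: le_lt_trans (ler_normD _ _) _.
  rewrite -ltrBrDr; apply: le_lt_trans sd; rewrite normrZ -[leRHS]mulr1.
  by rewrite ler_wpM2l // norm_basis.
(* f s is the integrand at x + s e_j, and f' its derivative in s. *)
pose f s t := \sum_i b i (t *: w (s *: 'e_j + x) + x0) * w (s *: 'e_j + x) 0 i.
pose f' s t := \sum_i (t * partial j (b i) (t *: w (s *: 'e_j + x) + x0) * w (s *: 'e_j + x) 0 i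
   + b i (t *: w (s *: 'e_j + x) + x0) * ('e_j : E) 0 i).
have dline i (v u : E) (s : R) : ball x0 r (s *: v + u) ->
    is_derive s 1 (fun s : R => b i (s *: v + u)) (\sum_k v 0 k * partial k (b i) (s *: v + u)).
  move=> sB'; rewrite -derive_sumE; last exact: db.
  by apply: is_derive_line; apply: diff_derivable; exact: db.
have df s t : s \in `]-d, d[ -> t \in `[0, 1] -> is_derive s 1 (f ^~ t) (f' s t).
  move=> sI tI.
  have -> : f ^~ t = \sum_i (fun s => b i (t *: w (s *: 'e_j + x) + x0) * w (s *: 'e_j + x) 0 i).
    by apply/funext => u; rewrite fct_sumE.
  apply: is_derive_sum => i.
  have lineE u : t *: w (u *: 'e_j + x) + x0 = u *: (t *: 'e_j) + (t *: w x + x0).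
    by rewrite wE scalerDr !scalerA mulrC addrA.
  have A : is_derive s 1 (fun s => b i (t *: w (s *: 'e_j + x) + x0))
     (t * partial j (b i) (t *: w (s *: 'e_j + x) + x0)).
    have -> : (fun s => b i (t *: w (s *: 'e_j + x) + x0)) = fun s =>
      b i (s *: (t *: 'e_j) + (t *: w x + x0)).
      by apply/funext => u; rewrite lineE.
    rewrite lineE; apply: (@is_derive_eq _ _ _ _ _ _ _ _ (dline i _ _ s _)).
      by rewrite -lineE; apply: tB => //; exact: sB.
    rewrite (bigD1 j) //= big1 ?addr0 => [|k kj]; first by rewrite !mxE !eqxx mulr1.
    by rewrite !mxE eqxx (negbTE kj) mulr0 mul0r.
  have B : is_derive s 1 (fun s => w (s *: 'e_j + x) 0 i) (('e_j : E) 0 i).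
    have -> : (fun s => w (s *: 'e_j + x) 0 i) = fun s => s * ('e_j : E) 0 i + w x 0 i.
      by apply/funext => u; rewrite wE !mxE.
    apply: is_derive_eq; rewrite addr0 scaler0 add0r; exact: mulr1.
  apply: (@is_derive_eq _ _ _ _ _ _ _ _ (is_deriveM A B)).
  rewrite addrC; congr (_ + _).
  by rewrite -[LHS]/(_ * _) mulrC.
have cl (h : E -> R) y (t : R) : (forall z, ball x0 r z -> {for z, continuous h}) ->
    `|w y| < r -> t \in `[0, 1] -> {for t, continuous (fun t : R => h (t *: w y + x0))}.
  move=> ch yr tI; apply: continuous_comp; last by apply: ch; exact: tB.
  by apply: cvgD; [exact: scalel_continuous|exact: cst_continuous].
have cb i z : ball x0 r z -> {for z, continuous (b i)}.
  by move=> zB; apply: differentiable_continuous; exact: db.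
have cpb i k z : ball x0 r z -> {for z, continuous (partial k (b i))}.
  move=> /rP[Oz _ _]; have /CkSE[_ /(_ k) [_ Cij]] := Cb i; exact: Ck_continuous Oz Cij.
have cf s : s \in `]-d, d[ -> {within `[0, 1], continuous (f s)}.
  move=> sI; apply: continuous_in_subspaceT => t; rewrite inE /= => tI.
  apply: continuous_sum => i; apply: continuousM; last exact: cst_continuous.
  by apply: cl (sB _ sI) tI; exact: cb.
have K0 : 0 <= K by apply: le_trans (ltW (Kle2 0)).
have f'K s t : s \in `]-d, d[ -> t \in `[0, 1] -> `|f' s t| <= \sum_(i < 3) (K * r + K).
  move=> sI tI; have [_ pK bK] := rP _ (tB _ _ (sB _ sI) tI).
  apply: le_trans (ler_norm_sum _ _ _) _; apply: ler_sum => i _.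
  apply: le_trans (ler_normD _ _) _; apply: lerD.
    rewrite normrM; apply: ler_pM => //; last first.
      by apply: le_trans (norm_coord _ _) (ltW _); exact: sB.
    rewrite normrM -[leRHS]mul1r; apply: ler_pM => //.
    by move: tI; rewrite in_itv /= => /andP[t0 t1]; rewrite ger0_norm.
  rewrite normrM -[leRHS]mulr1; apply: ler_pM => //.
  exact: le_trans (norm_coord _ _) (norm_basis _).
have I0 : (0 : R) \in `]-d, d[ by rewrite in_itv /= oppr_lt0 d0.
have x00 : 0 *: 'e_j + x = x by rewrite scale0r add0r.
have cf' : {within `[0, 1], continuous (f' 0)}.
  apply: continuous_in_subspaceT => t; rewrite inE /= => tI.
  rewrite /f' x00; apply: continuous_sum => i; apply: continuousD.
    apply: continuousM; last exact: cst_continuous.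
    apply: continuousM; first exact: cvg_id.
    by apply: cl tI => //; exact: cpb.
  apply: continuousM; last exact: cst_continuous.
  by apply: cl tI => //; exact: cb.
(* This is where the symmetry of the partials of b is used. *)
have dG (t : R) : t \in `[0, 1] -> is_derive t 1 (fun t => t * b j (t *: w x + x0)) (f' 0 t).
  move=> tI; have H := dline j (w x) x0 t (tB _ _ xr tI).
  apply: (@is_derive_eq _ _ _ _ _ _ _ _ (is_deriveM (is_derive_id t 1) H)).
  rewrite /f' x00 big_split /= -[X in X + _]/(t * _) mulr_sumr; congr (_ + _).
    apply: eq_bigr => k _; rewrite [partial j _ _]closed.
      by move: (partial _ _ _) => p; ring.
    by have [] := rP _ (tB _ _ xr tI).
  rewrite (bigD1 j) //= big1 ?addr0 => [|k kj]; first by rewrite mxE !eqxx [RHS]mulr1 [LHS]mulr1.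
  by rewrite mxE eqxx (negbTE kj) mulr0.
have -> : b j x = \int[mu]_(t in `[0, 1]) f' 0 t.
  by rewrite (FTC_unit dG cf') scale1r mul1r mul0r subr0 /w subrK.
apply: is_derive_from_line; exact: leibniz_integral d0 df f'K cf.
Qed.

(** Regularity of a primitive: its partials are known functions, and continuous
    partials make it continuous. *)
Lemma Ck_of_partials k O F (b : 'I_3 -> E -> R) : open O ->
  (forall x i, O x -> is_derive x 'e_i F (b i x)) -> (forall i, Ck k O (b i)) -> Ck k.+1 O F.
Proof.
move=> oO dF Cb; have pE i x : O x -> partial i F x = b i x by move=> Ox; case: (dF x i Ox).
apply/CkSE; split => [x Ox|i]; last first.
  split=> [x Ox|]; first by case: (dF x i Ox).
  apply: Ck_ext (Cb i) => // x Ox; by rewrite pE.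
apply: differentiable_continuous; apply: differentiable_of_partials.
  by apply: near_open oO Ox _ => y Oy i; case: (dF y i Oy).
move=> i; apply: near_continuous (Ck_continuous Ox (Cb i)).
by apply: near_open oO Ox _ => y Oy; rewrite pE.
Qed.

Lemma ball_connected x0 (r : R) : 0 < r -> connected (ball x0 r).
Proof.
move=> r0.
have -> : ball x0 r = \bigcup_(v in ball (0 : E) r) ((fun t : R => t *: v + x0) @` `[0, 1]).
  rewrite mx_norm_ball /ball_; apply/seteqP; split => [x xB|x [v vB [t tI <-]]].
    exists (x - x0); first by rewrite /= sub0r normrN distrC.
    by exists 1; rewrite /= ?in_itv /= ?ler01 ?lexx // scale1r subrK.
  rewrite /= opprD addrCA subrr addr0 normrN normrZ; move: vB; rewrite /= sub0r normrN.
  apply: le_lt_trans; move: tI; rewrite /= in_itv /= => /andP[t0 t1].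
  by rewrite ger0_norm // ler_piMl.
apply: bigcup_connected.
  by exists x0 => v _; exists 0; rewrite ?scale0r ?add0r //= in_itv /= lexx ler01.
move=> v _; apply: connected_continuous_connected; first exact: segment_connected.
apply: continuous_subspaceT => t.
by apply: cvgD; [exact: scalel_continuous|exact: cst_continuous].
Qed.

End Euclid.

(** * Complex numbers, covectors and 2-forms at a point *)

Local Open Scope complex_scope.
Local Notation coord := Defs.coord.
Local Notation delta := Defs.delta.
Local Notation wedge := Defs.wedge.

Section ComplexParts.
Variable R : realType.
Local Notation C := R[i].
Implicit Types x y : C.

Lemma ReD x y : complex.Re (x + y) = complex.Re x + complex.Re y.
Proof. by case: x y => [a b] [c d]. Qed.
Lemma ImD x y : complex.Im (x + y) = complex.Im x + complex.Im y.
Proof. by case: x y => [a b] [c d]. Qed.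
Lemma ReM x y : complex.Re (x * y) = complex.Re x * complex.Re y - complex.Im x * complex.Im y.
Proof. by case: x y => [a b] [c d]. Qed.
Lemma ImM x y : complex.Im (x * y) = complex.Re x * complex.Im y + complex.Im x * complex.Re y.
Proof. by case: x y => [a b] [c d]. Qed.
Lemma ReJ x : complex.Re x^* = complex.Re x.
Proof. by case: x. Qed.
Lemma ImJ x : complex.Im x^* = - complex.Im x.
Proof. by case: x. Qed.
Lemma complex_eq x y : complex.Re x = complex.Re y -> complex.Im x = complex.Im y -> x = y.
Proof. by case: x y => [a b] [c d] /= -> ->. Qed.

End ComplexParts.

Section TwoForms.
Variable R : realType.
Local Notation C := R[i].
Implicit Types (B : 'M[C]_3) (u v w : 'cV[C]_3) (al be : 'rV[C]_3).

Lemma ev_sum (eta : 'rV[C]_3) (v : 'cV[C]_3) : ev eta v = \sum_j eta 0 j * v j 0.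
Proof. by rewrite /ev mxE. Qed.

Lemma evDr (eta : 'rV[C]_3) u v : ev eta (u + v) = ev eta u + ev eta v.
Proof. by rewrite /ev mulmxDr mxE. Qed.
Lemma evZr (eta : 'rV[C]_3) a v : ev eta (a *: v) = a * ev eta v.
Proof. by rewrite /ev -scalemxAr mxE. Qed.
Lemma evNr (eta : 'rV[C]_3) v : ev eta (- v) = - ev eta v.
Proof. by rewrite -scaleN1r evZr mulN1r. Qed.
Lemma evDl (eta xi : 'rV[C]_3) v : ev (eta + xi) v = ev eta v + ev xi v.
Proof. by rewrite /ev mulmxDl mxE. Qed.
Lemma evZl (eta : 'rV[C]_3) a v : ev (a *: eta) v = a * ev eta v.
Proof. by rewrite /ev -scalemxAl mxE. Qed.
Lemma evNl (eta : 'rV[C]_3) v : ev (- eta) v = - ev eta v.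
Proof. by rewrite -scaleN1r evZl mulN1r. Qed.
Lemma ev_sumr (eta : 'rV[C]_3) n (v : 'I_n -> 'cV[C]_3) : ev eta (\sum_i v i) = \sum_i ev eta (v i).
Proof. by rewrite /ev mulmx_sumr summxE. Qed.
Lemma evJ (eta : 'rV[C]_3) v : ev (conjm eta) (conjm v) = (ev eta v)^*.
Proof. by rewrite !ev_sum rmorph_sum; apply: eq_bigr => i _; rewrite !mxE -rmorphM. Qed.
Lemma ev_delta (eta : 'rV[C]_3) j : ev eta (delta_mx j 0) = eta 0 j.
Proof.
rewrite ev_sum (bigD1 j) //= mxE !eqxx mulr1 big1 ?addr0 // => k kj.
by rewrite mxE (negbTE kj) mulr0.
Qed.
Lemma conjmK m n (A : 'M[C]_(m, n)) : conjm (conjm A) = A.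
Proof. by apply/matrixP => i j; rewrite !mxE conjcK. Qed.

Lemma sum_delta2 (D : 'I_3 -> 'I_3 -> C) a b :
  \sum_i \sum_j D i j * (delta_mx a 0 : 'cV[C]_3) i 0 * (delta_mx b 0 : 'cV[C]_3) j 0 = D a b.
Proof.
rewrite (bigD1 a) //= [X in _ + X]big1 ?addr0 => [|k ka]; last first.
  by rewrite big1 // => l _; rewrite mxE (negbTE ka) mulr0 mul0r.
rewrite (bigD1 b) //= big1 ?addr0 => [|k kb]; last by rewrite !mxE (negbTE kb) mulr0.
by rewrite !mxE !eqxx !mulr1.
Qed.

Lemma ev2_sum (B : 'M[C]_3) u v : ev2 B u v = \sum_i \sum_j B i j * u i 0 * v j 0.
Proof.
rewrite /ev2 mxE exchange_big; apply: eq_bigr => j _ /=; rewrite mxE mulr_suml.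
by apply: eq_bigr => i _; rewrite mxE [u i 0 * _]mulrC.
Qed.

Lemma ev2_0l (u v : 'cV[C]_3) : ev2 0 u v = 0.
Proof. by rewrite /ev2 mulmx0 mul0mx mxE. Qed.

Lemma ev2Dl B u u' v : ev2 B (u + u') v = ev2 B u v + ev2 B u' v.
Proof. by rewrite /ev2 linearD /= !mulmxDl mxE. Qed.
Lemma ev2Dr B u v v' : ev2 B u (v + v') = ev2 B u v + ev2 B u v'.
Proof. by rewrite /ev2 mulmxDr mxE. Qed.
Lemma ev2Zl B a u v : ev2 B (a *: u) v = a * ev2 B u v.
Proof. by rewrite /ev2 linearZ /= -!scalemxAl mxE. Qed.
Lemma ev2Zr B a u v : ev2 B u (a *: v) = a * ev2 B u v.
Proof. by rewrite /ev2 -!scalemxAr mxE. Qed.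
Lemma ev2D B B' u v : ev2 (B + B') u v = ev2 B u v + ev2 B' u v.
Proof. by rewrite /ev2 mulmxDr mulmxDl mxE. Qed.
Lemma ev2Z B a u v : ev2 (a *: B) u v = a * ev2 B u v.
Proof. by rewrite /ev2 -scalemxAr -scalemxAl mxE. Qed.
Lemma ev2N B u v : ev2 (- B) u v = - ev2 B u v.
Proof. by rewrite -scaleN1r ev2Z mulN1r. Qed.
Lemma conjmD m n (A B : 'M[C]_(m, n)) : conjm (A + B) = conjm A + conjm B.
Proof. exact: map_mxD. Qed.
Lemma conjmZ m n a (A : 'M[C]_(m, n)) : conjm (a *: A) = a^*%C *: conjm A.
Proof. exact: map_mxZ. Qed.
Lemma ev2J B u v : ev2 (conjm B) (conjm u) (conjm v) = (ev2 B u v)^*%C.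
Proof.
rewrite !ev2_sum rmorph_sum; apply: eq_bigr => i _; rewrite rmorph_sum.
by apply: eq_bigr => j _; rewrite !mxE -!rmorphM.
Qed.
Lemma ev2_wedge al be u v : ev2 (wedge al be) u v = ev al u * ev be v - ev be u * ev al v.
Proof.
have trE (ga : 'rV[C]_3) : u^T *m ga^T = (ev ga u)%:M.
  by rewrite -trmx_mul; apply/matrixP => i j; rewrite !ord1 /ev !mxE mulr1n.
rewrite /ev2 /wedge mulmxBr mulmxBl !mulmxA !trE !mul_scalar_mx.
by rewrite -!scalemxAl [LHS]mxE [X in _ + X]mxE [X in X - _]mxE [X in _ - X]mxE.
Qed.
Lemma ev2_inj B B' : (forall u v, ev2 B u v = ev2 B' u v) -> B = B'.
Proof.
move=> H; apply/matrixP => i j; have := H (delta_mx i 0) (delta_mx j 0).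
by rewrite !ev2_sum (sum_delta2 (fun i j => B i j)) (sum_delta2 (fun i j => B' i j)).
Qed.
Lemma ev_inj al be : (forall v, ev al v = ev be v) -> al = be.
Proof. by move=> H; apply/matrixP => i j; rewrite ord1 -!ev_delta H. Qed.
Lemma ev2_anti B u v : B^T = - B -> ev2 B v u = - ev2 B u v.
Proof.
move=> BT; rewrite !ev2_sum exchange_big -sumrN; apply: eq_bigr => i _.
rewrite -sumrN; apply: eq_bigr => j _ /=.
have /matrixP/(_ i j) := BT; rewrite [LHS]mxE [RHS]mxE => ->.
by rewrite -mulrA [v _ _ * _]mulrC mulrA !mulNr.
Qed.
Lemma ev2_diag B u : B^T = - B -> ev2 B u u = 0.
Proof.
by move=> BT; apply/eqP; have /eqP := ev2_anti u u BT; rewrite -subr_eq0 opprK -mulr2n mulrn_eq0.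
Qed.
End TwoForms.

(** * Smooth functions, fields and forms on a 3-manifold *)

Section Calculus.
Variables (R : realType) (M : manifold3 R).
Local Notation C := R[i].
Local Notation E := 'rV[R]_3.
Implicit Types (p q : M) (W U : set M) (X Y : M -> 'cV[C]_3) (f g : M -> C).
Implicit Types (c : chart R M) (O : set E).

(** The part of [W] seen by [c], read in its coordinates. *)
Definition chart_image c W : set E := cmap c @` (W `&` cdom c).

Lemma chart_image_open c W : open W -> open (chart_image c W).
Proof.
move=> oW; rewrite openE => x [p [Wp cp] <-] /=.
have Ix : (cmap c @` cdom c) (cmap c p) by exists p.
have n1 : \forall y \near cmap c p, (cmap c @` cdom c) y.
  by apply: open_nbhs_nbhs; split => //; exact: cimg_open.
have n2 : \forall y \near cmap c p, W (cinv c y).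
  have := cinv_cont Ix; apply; rewrite /= cmapK //.
  exact: open_nbhs_nbhs.
by apply: filterS2 n1 n2 => y [q cq <-]; rewrite cmapK // => Wq; exists q.
Qed.

Arguments chart_image_open c [W] _.

Lemma chart_image_cmap c W p : W p -> cdom c p -> chart_image c W (cmap c p).
Proof. by move=> Wp cp; exists p. Qed.

Lemma chart_image_cinv c W x : chart_image c W x ->
  [/\ W (cinv c x), cdom c (cinv c x) & cmap c (cinv c x) = x].
Proof. by move=> [p [Wp cp] <-]; rewrite cmapK. Qed.

(** [Ck] is a pointwise condition, as partial derivatives do not depend on the set. *)
Lemma Ck_local k O (g : E -> R) :
  (forall x, O x -> exists2 U, U x & Ck k U g) -> Ck k O g.
Proof.
elim: k g => [|k IH] g H.
  by split => // x /H [U Ux [cg _]]; exact: cg.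
apply/CkSE; split => [x /H [U Ux /CkSE [cg _]]|i]; first exact: cg.
split => [x /H [U Ux /CkSE [_ /(_ i) [dg _]]]|]; first exact: dg.
by apply: IH => x /H [U Ux /CkSE [_ /(_ i) [_ Cg]]]; exists U.
Qed.

Local Notation rp c f := (fun x => complex.Re (f (cinv c x))).
Local Notation ip c f := (fun x => complex.Im (f (cinv c x))).

Lemma smooth_sub W W' f : W' `<=` W -> smooth W f -> smooth W' f.
Proof.
move=> WW sf c /sf [s1 s2]; split => k.
  by apply: Ck_sub (s1 k) => x [p [Wp cp] <-]; exists p => //; split => //; exact: WW.
by apply: Ck_sub (s2 k) => x [p [Wp cp] <-]; exists p => //; split => //; exact: WW.
Qed.

Lemma smooth_local W f : (forall p, W p -> exists2 W', W' p & smooth W' f) -> smooth W f.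
Proof.
move=> H c Ac; split => k; apply: Ck_local => x [p [Wp cp] <-];
  by have [W' W'p /(_ c Ac) [s1 s2]] := H p Wp; exists (chart_image c W') => //; exists p.
Qed.

Lemma smooth_ext W f g : open W -> (forall p, W p -> f p = g p) -> smooth W f -> smooth W g.
Proof.
move=> oW fg sf c /sf [s1 s2]; split => k.
  by apply: Ck_ext (s1 k); [exact: chart_image_open|move=> x /chart_image_cinv[/fg -> _ _]].
by apply: Ck_ext (s2 k); [exact: chart_image_open|move=> x /chart_image_cinv[/fg -> _ _]].
Qed.

Lemma smooth_cst W (z : C) : smooth W (fun=> z).
Proof. by move=> c _; split => k; exact: Ck_cst. Qed.

Lemma smoothD W f g : open W -> smooth W f -> smooth W g -> smooth W (fun p => f p + g p).
Proof.
move=> oW sf sg c Ac; have [f1 f2] := sf c Ac; have [g1 g2] := sg c Ac.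
split => k.
  apply: Ck_ext (Ck_add (chart_image_open c oW) (f1 k) (g1 k)) => [|x _];
    first exact: chart_image_open.
  by rewrite ReD.
apply: Ck_ext (Ck_add (chart_image_open c oW) (f2 k) (g2 k)) => [|x _];
  first exact: chart_image_open.
by rewrite ImD.
Qed.

Lemma smoothM W f g : open W -> smooth W f -> smooth W g -> smooth W (fun p => f p * g p).
Proof.
move=> oW sf sg c Ac; have [f1 f2] := sf c Ac; have [g1 g2] := sg c Ac.
have oI := chart_image_open c oW; split => k.
  apply: Ck_ext (Ck_add oI (Ck_mul oI (f1 k) (g1 k)) (Ck_opp oI (Ck_mul oI (f2 k) (g2 k)))) =>
    // x _.
  by rewrite ReM.
apply: Ck_ext (Ck_add oI (Ck_mul oI (f1 k) (g2 k)) (Ck_mul oI (f2 k) (g1 k))) => // x _.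
by rewrite ImM.
Qed.

Lemma smoothN W f : open W -> smooth W f -> smooth W (fun p => - f p).
Proof.
move=> oW sf; apply: smooth_ext (smoothM oW (smooth_cst W (-1)) sf) => // p _.
by rewrite mulN1r.
Qed.

Lemma smoothB W f g : open W -> smooth W f -> smooth W g -> smooth W (fun p => f p - g p).
Proof. by move=> oW sf sg; exact: smoothD oW sf (smoothN oW sg). Qed.

Lemma smoothJ W f : open W -> smooth W f -> smooth W (fun p => (f p)^*).
Proof.
move=> oW sf c Ac; have [f1 f2] := sf c Ac; have oI := chart_image_open c oW; split => k.
  by apply: Ck_ext (f1 k) => // x _; rewrite ReJ.
by apply: Ck_ext (Ck_opp oI (f2 k)) => // x _; rewrite ImJ.
Qed.

Lemma smooth_sum W n (f : 'I_n -> M -> C) : open W -> (forall i, smooth W (f i)) ->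
  smooth W (fun p => \sum_i f i p).
Proof.
move=> oW; elim: n f => [|n IH] f sf.
  by apply: smooth_ext (smooth_cst W 0) => // p _; rewrite big_ord0.
apply: smooth_ext (smoothD oW (sf ord0) (IH _ (fun i => sf (lift ord0 i)))) => // p _.
by rewrite big_ord_recl.
Qed.

Lemma smooth_rsqrt W f : open W -> (forall p, W p -> 0 < f p) -> smooth W f ->
  smooth W (fun p => ((Num.sqrt (complex.Re (f p)))^-1)%:C).
Proof.
move=> oW f0 sf c Ac; have [f1 f2] := sf c Ac; have oI := chart_image_open c oW.
split => k; last exact: Ck_cst.
apply: (@Ck_rsqrt _ k _ (rp c f)) => // x /chart_image_cinv [/f0].
by rewrite ltcE /= => /andP[].
Qed.

(** Smoothness in a single chart suffices: any other chart is reached through a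
    smooth transition map, and [Ck_comp] applies. *)
Lemma smooth_chart c0 W f : atlas c0 -> open W -> W `<=` cdom c0 ->
  Cinfty (cmap c0 @` W) (rp c0 f) -> Cinfty (cmap c0 @` W) (ip c0 f) -> smooth W f.
Proof.
move=> A0 oW W0 s1 s2 c Ac.
have oI := chart_image_open c oW.
have eqI : cmap c0 @` W = chart_image c0 W.
  by rewrite /chart_image; congr (_ @` _); apply/seteqP; split => [p Wp|p []//]; split => //;
    exact: W0.
have oI0 : open (cmap c0 @` W) by rewrite eqI; exact: chart_image_open.
pose phi x := cmap c0 (cinv c x).
have phiI x : chart_image c W x -> (cmap c0 @` W) (phi x) by move=> /chart_image_cinv[Wx _ _];
  exists (cinv c x).
have Cphi k j : Ck k (chart_image c W) (fun x => phi x 0 j).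
  apply: Ck_sub (atlas_smooth Ac A0 j k) => x [p [Wp cp] <-]; exists p => //.
  by split => //; exact: W0.
split => k.
  apply: Ck_ext (Ck_comp oI oI0 phiI (Cphi k) (s1 k)) => // x /chart_image_cinv[Wx _ _].
  by rewrite /= cmapK //; exact: W0.
apply: Ck_ext (Ck_comp oI oI0 phiI (Cphi k) (s2 k)) => // x /chart_image_cinv[Wx _ _].
by rewrite /= cmapK //; exact: W0.
Qed.

Lemma smooth_coord c j : atlas c -> smooth (cdom c) (coord c j).
Proof.
move=> Ac; apply: (smooth_chart Ac) => //; first exact: cdom_open.
  move=> k; have oI := chart_image_open c (@cdom_open _ _ c).
  have -> : cmap c @` cdom c = chart_image c (cdom c) by rewrite /chart_image setIid.
  by apply: Ck_ext (Ck_coord k _ j) => // x /chart_image_cinv[_ _ e]; rewrite /coord /= e.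
by move=> k; exact: Ck_cst.
Qed.

(** The j-th partial derivative of [f] in the coordinates of a fixed chart.  The
    components of [differential f p] refer to [chart_at p], a chart that varies
    with [p] in no controlled way; derivatives of derivatives only make sense
    after passing to one chart around the point. *)
Definition chart_deriv c (j : 'I_3) f p : C :=
  partial j (rp c f) (cmap c p) +i* partial j (ip c f) (cmap c p).

Lemma differentialE f p : differential f p = \row_j chart_deriv (chart_at p) j f p.
Proof. by []. Qed.

Lemma vderivE X f p : vderiv X f p = \sum_j chart_deriv (chart_at p) j f p * X p j 0.
Proof. by rewrite /vderiv /ev mxE; apply: eq_bigr => j _; rewrite mxE. Qed.

Lemma chart_atP p : atlas (chart_at p) /\ cdom (chart_at p) p.
Proof. by rewrite /chart_at; case: cid. Qed.

Lemma near_chart_image c W p (P : E -> Prop) : open W -> W p -> cdom c p ->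
  (forall x, chart_image c W x -> P x) -> \forall x \near cmap c p, P x.
Proof. by move=> oW Wp cp; apply: near_open; [exact: chart_image_open|exact: chart_image_cmap]. Qed.

Lemma chart_deriv_ext c j W f g p : open W -> W p -> cdom c p -> (forall q, W q -> f q = g q) ->
  chart_deriv c j f p = chart_deriv c j g p.
Proof.
move=> oW Wp cp fg; rewrite /chart_deriv /partial; congr (_ +i* _); apply: near_eq_derive;
  by apply: near_chart_image oW Wp cp _ => x /chart_image_cinv [/fg ->].
Qed.

Lemma smooth_diff c W f p : atlas c -> open W -> W p -> cdom c p -> smooth W f ->
  differentiable (rp c f) (cmap c p) /\ differentiable (ip c f) (cmap c p).
Proof.
move=> Ac oW Wp cp /(_ c Ac)[s1 s2]; split.
  by apply: Ck_differentiable (s1 1%N); [exact: chart_image_open|exact: chart_image_cmap].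
by apply: Ck_differentiable (s2 1%N); [exact: chart_image_open|exact: chart_image_cmap].
Qed.

Lemma chart_derivD c j W f g p : atlas c -> open W -> W p -> cdom c p -> smooth W f -> smooth W g ->
  chart_deriv c j (fun q => f q + g q) p = chart_deriv c j f p + chart_deriv c j g p.
Proof.
move=> Ac oW Wp cp sf sg; have [f1 f2] := smooth_diff Ac oW Wp cp sf.
have [g1 g2] := smooth_diff Ac oW Wp cp sg; rewrite /chart_deriv /partial.
rewrite (_ : rp c (fun q => f q + g q) = rp c f + rp c g); last by apply/funext => x; rewrite ReD.
rewrite (_ : ip c (fun q => f q + g q) = ip c f + ip c g); last by apply/funext => x; rewrite ImD.
by rewrite !deriveD //; exact: diff_derivable.
Qed.

Lemma chart_derivM c j W f g p : atlas c -> open W -> W p -> cdom c p -> smooth W f -> smooth W g ->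
  chart_deriv c j (fun q => f q * g q) p = chart_deriv c j f p * g p + f p * chart_deriv c j g p.
Proof.
move=> Ac oW Wp cp sf sg; have [f1 f2] := smooth_diff Ac oW Wp cp sf.
have [g1 g2] := smooth_diff Ac oW Wp cp sg; rewrite /chart_deriv /partial.
move: (@diff_derivable _ _ _ _ _ 'e_j f1) (@diff_derivable _ _ _ _ _ 'e_j f2) => d1 d2.
move: (@diff_derivable _ _ _ _ _ 'e_j g1) (@diff_derivable _ _ _ _ _ 'e_j g2) => d3 d4.
rewrite (_ : rp c (fun q => f q * g q) = rp c f * rp c g - ip c f * ip c g); last first.
  by apply/funext => x; rewrite ReM.
rewrite (_ : ip c (fun q => f q * g q) = rp c f * ip c g + ip c f * rp c g); last first.
  by apply/funext => x; rewrite ImM.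
rewrite (deriveB (derivableM d1 d3) (derivableM d2 d4)) (deriveM d1 d3) (deriveM d2 d4).
rewrite (deriveD (derivableM d1 d4) (derivableM d2 d3)) (deriveM d1 d4) (deriveM d2 d3).
rewrite cmapK //.
case: (f p) (g p) => [a b] [a' b'].
move: ('D_ _ _ _) ('D_ _ _ _) ('D_ _ _ _) ('D_ _ _ _) => u v w z.
apply: complex_eq; rewrite /= /GRing.scale /=; ring.
Qed.

Lemma chart_deriv_cst c j (z : C) p : chart_deriv c j (fun=> z) p = 0.
Proof. by rewrite /chart_deriv /partial !derive_cst. Qed.

Lemma chart_derivJ c j W f p : atlas c -> open W -> W p -> cdom c p -> smooth W f ->
  chart_deriv c j (fun q => (f q)^*) p = (chart_deriv c j f p)^*.
Proof.
move=> Ac oW Wp cp sf; have [f1 f2] := smooth_diff Ac oW Wp cp sf; rewrite /chart_deriv /partial.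
rewrite (_ : rp c (fun q => (f q)^*) = rp c f); last by apply/funext => x; rewrite ReJ.
rewrite (_ : ip c (fun q => (f q)^*) = - ip c f); last by apply/funext => x; rewrite ImJ.
by rewrite deriveN //; exact: diff_derivable.
Qed.

(** The chain rule for the transition map from [c'] to [c]. *)
Lemma chart_deriv_chain c c' i W f p : atlas c -> atlas c' -> open W -> W p -> cdom c p ->
  cdom c' p ->
  smooth W f -> chart_deriv c' i f p = \sum_j chart_deriv c j f p * chart_deriv c' i (coord c j) p.
Proof.
move=> Ac Ac' oW Wp cp cp' sf.
have [f1 f2] := smooth_diff Ac oW Wp cp sf.
pose phi x := cmap c (cinv c' x).
have phip : phi (cmap c' p) = cmap c p by rewrite /phi cmapK.
have dphi j : differentiable (fun y => phi y 0 j : R) (cmap c' p).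
  exact: (proj1 (smooth_diff Ac' (@cdom_open _ _ c) cp cp' (smooth_coord j Ac))).
have near1 : \forall x \near cmap c' p, cinv c (phi x) = cinv c' x.
  by apply: near_chart_image (@cdom_open _ _ c) cp cp' _ => x /chart_image_cinv [cx _ _];
    rewrite /phi cmapK.
have DR : partial i (rp c' f) (cmap c' p) = \sum_j partial j (rp c f) (cmap c p) *
  partial i (fun y => phi y 0 j : R) (cmap c' p).
  rewrite -phip -chain_rule ?phip //; apply: near_eq_derive.
  by apply: filterS near1 => x /= ->.
have DI : partial i (ip c' f) (cmap c' p) = \sum_j partial j (ip c f) (cmap c p) *
  partial i (fun y => phi y 0 j : R) (cmap c' p).
  rewrite -phip -chain_rule ?phip //; apply: near_eq_derive.
  by apply: filterS near1 => x /= ->.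
have DE j : chart_deriv c' i (coord c j) p = (partial i (fun y => phi y 0 j : R) (cmap c' p))%:C.
  by rewrite /chart_deriv /coord /= /partial derive_cst.
rewrite [LHS]/chart_deriv DR DI !big_ord_recr !big_ord0 /= !DE /chart_deriv.
do !move: (partial _ _ _) => ?.
by apply: complex_eq; rewrite /=; ring.
Qed.

Lemma smooth_chart_deriv c W j f : atlas c -> open W -> W `<=` cdom c -> smooth W f ->
  smooth W (chart_deriv c j f).
Proof.
move=> Ac oW Wc sf; have [s1 s2] := sf c Ac.
have eqI : cmap c @` W = chart_image c W.
  by rewrite /chart_image; congr (_ @` _); apply/seteqP; split => [p Wp|p []//]; split => //;
    exact: Wc.
have oI := chart_image_open c oW.
apply: (smooth_chart Ac) => //; rewrite eqI => k.
  have /CkSE[_ /(_ j) [_ C1]] := s1 k.+1.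
  by apply: Ck_ext C1 => // x /chart_image_cinv[_ _ e]; rewrite /chart_deriv /= e.
have /CkSE[_ /(_ j) [_ C1]] := s2 k.+1.
by apply: Ck_ext C1 => // x /chart_image_cinv[_ _ e]; rewrite /chart_deriv /= e.
Qed.

(** X f is computed in any chart, whereas [vderiv] refers to [chart_at p]. *)
Lemma vderiv_chain c X W f p : atlas c -> open W -> W p -> cdom c p -> smooth W f ->
  vderiv X f p = \sum_j chart_deriv c j f p * vderiv X (coord c j) p.
Proof.
move=> Ac oW Wp cp sf; have [Ac' cp'] := chart_atP p.
rewrite vderivE; under eq_bigr do rewrite (chart_deriv_chain _ Ac Ac' oW Wp cp cp' sf) mulr_suml.
rewrite exchange_big; apply: eq_bigr => j _ /=.
by rewrite vderivE mulr_sumr; apply: eq_bigr => i _; rewrite mulrA.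
Qed.

Lemma vderiv_ext X W f g p : open W -> W p -> (forall q, W q -> f q = g q) ->
  vderiv X f p = vderiv X g p.
Proof.
move=> oW Wp fg; rewrite !vderivE; apply: eq_bigr => j _.
by rewrite (chart_deriv_ext j oW Wp _ fg) //; have [] := chart_atP p.
Qed.

Lemma vderivD X W f g p : open W -> W p -> smooth W f -> smooth W g ->
  vderiv X (fun q => f q + g q) p = vderiv X f p + vderiv X g p.
Proof.
move=> oW Wp sf sg; have [Ac cp] := chart_atP p.
rewrite !vderivE -big_split; apply: eq_bigr => j _ /=.
by rewrite (chart_derivD j Ac oW Wp cp sf sg) mulrDl.
Qed.

Lemma vderivM X W f g p : open W -> W p -> smooth W f -> smooth W g ->
  vderiv X (fun q => f q * g q) p = vderiv X f p * g p + f p * vderiv X g p.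
Proof.
move=> oW Wp sf sg; have [Ac cp] := chart_atP p.
rewrite !vderivE mulr_suml mulr_sumr -big_split; apply: eq_bigr => j _ /=.
by rewrite (chart_derivM j Ac oW Wp cp sf sg) mulrDl mulrAC mulrA.
Qed.

Lemma vderiv_cst X (z : C) p : vderiv X (fun=> z) p = 0.
Proof. by rewrite vderivE big1 // => j _; rewrite chart_deriv_cst mul0r. Qed.

Lemma vderivZ X W (z : C) g p : open W -> W p -> smooth W g ->
  vderiv X (fun q => z * g q) p = z * vderiv X g p.
Proof.
by move=> oW Wp sg; rewrite (vderivM X oW Wp (smooth_cst W z) sg) vderiv_cst mul0r add0r.
Qed.

Lemma vderivN X W g p : open W -> W p -> smooth W g ->
  vderiv X (fun q => - g q) p = - vderiv X g p.
Proof.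
move=> oW Wp sg; rewrite -mulN1r -(vderivZ X (-1) oW Wp sg); apply: (vderiv_ext X oW Wp) => q _.
by rewrite mulN1r.
Qed.

Lemma vderivB X W f g p : open W -> W p -> smooth W f -> smooth W g ->
  vderiv X (fun q => f q - g q) p = vderiv X f p - vderiv X g p.
Proof.
by move=> oW Wp sf sg; rewrite (vderivD X oW Wp sf (smoothN oW sg)) (vderivN X oW Wp sg).
Qed.

Lemma vderiv_sum X W n (f : 'I_n -> M -> C) p : open W -> W p -> (forall i, smooth W (f i)) ->
  vderiv X (fun q => \sum_i f i q) p = \sum_i vderiv X (f i) p.
Proof.
move=> oW Wp; elim: n f => [|n IH] f sf.
  rewrite big_ord0; transitivity (vderiv X (fun=> 0) p); last exact: vderiv_cst.
  by apply: (vderiv_ext X oW Wp) => q _; rewrite big_ord0.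
rewrite big_ord_recl -IH; last by move=> i; exact: sf.
rewrite -(vderivD X oW Wp (sf _) (smooth_sum oW (fun i => sf (lift ord0 i)))).
by apply: (vderiv_ext X oW Wp) => q _; rewrite big_ord_recl.
Qed.

Lemma vderivJ X W f p : open W -> W p -> smooth W f ->
  vderiv (fun q => conjm (X q)) (fun q => (f q)^*) p = (vderiv X f p)^*.
Proof.
move=> oW Wp sf; have [Ac cp] := chart_atP p.
rewrite !vderivE rmorph_sum; apply: eq_bigr => j _ /=.
by rewrite (chart_derivJ j Ac oW Wp cp sf) mxE -rmorphM.
Qed.

Lemma smooth_field_sub W W' X : W' `<=` W -> smooth_field W X -> smooth_field W' X.
Proof.
by move=> WW sX c Ac i; apply: smooth_sub (sX c Ac i) => p [/WW].
Qed.

Lemma smooth_vderiv W X f : open W -> smooth_field W X -> smooth W f -> smooth W (vderiv X f).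
Proof.
move=> oW sX sf; apply: smooth_local => p Wp; have [Ac cp] := chart_atP p.
set c := chart_at p in Ac cp; exists (W `&` cdom c) => //.
have oW' : open (W `&` cdom c) by apply: openI => //; exact: cdom_open.
have sf' : smooth (W `&` cdom c) f by apply: smooth_sub sf => q [].
apply: smooth_ext (smooth_sum oW' (fun j =>
  smoothM oW' (smooth_chart_deriv j Ac oW' _ sf') (sX c Ac j))) => //.
  by move=> q Wq; rewrite (vderiv_chain X Ac oW' Wq _ sf') //; case: Wq.
Qed.

Lemma smooth_fieldJ W X : open W -> smooth_field W X -> smooth_field W (fun q => conjm (X q)).
Proof.
move=> oW sX c Ac i.
have oW' : open (W `&` cdom c) by apply: openI => //; exact: cdom_open.
apply: smooth_ext (smoothJ oW' (sX c Ac i)) => // p Wp.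
rewrite -(vderivJ X oW' Wp (smooth_sub _ (smooth_coord i Ac))); last by move=> q [].
by apply: vderiv_ext oW' Wp _ => q _; rewrite /coord conjc_real.
Qed.

Lemma chart_deriv_schwarz c i j W f p : atlas c -> open W -> W p -> cdom c p -> smooth W f ->
  chart_deriv c i (chart_deriv c j f) p = chart_deriv c j (chart_deriv c i f) p.
Proof.
move=> Ac oW Wp cp sf; have [s1 s2] := sf c Ac.
have oI := chart_image_open c oW; have Ip := chart_image_cmap Wp cp.
have E k l : chart_deriv c k (chart_deriv c l f) p = partial k (partial l (rp c f)) (cmap c p)
   +i* partial k (partial l (ip c f)) (cmap c p).
  have e1 : partial k (rp c (chart_deriv c l f)) (cmap c p) =
    partial k (partial l (rp c f)) (cmap c p).
    by apply: near_eq_derive; apply: near_chart_image oW Wp cp _ => x /chart_image_cinv[_ _ e];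
      rewrite /chart_deriv /= e.
  have e2 : partial k (ip c (chart_deriv c l f)) (cmap c p) =
    partial k (partial l (ip c f)) (cmap c p).
    by apply: near_eq_derive; apply: near_chart_image oW Wp cp _ => x /chart_image_cinv[_ _ e];
      rewrite /chart_deriv /= e.
  by rewrite [LHS]/chart_deriv e1 e2.
by rewrite !E (schwarz i j oI Ip (s1 2%N)) (schwarz i j oI Ip (s2 2%N)).
Qed.

(** The bracket is defined by its action on coordinates.  On a general [f], the
    two sides differ by the second derivatives of [f] contracted with [X] and [Y],
    which cancel by symmetry. *)
Lemma bracketE W X Y f p : open W -> smooth_field W X -> smooth_field W Y -> smooth W f -> W p ->
  vderiv (bracket X Y) f p = vderiv X (vderiv Y f) p - vderiv Y (vderiv X f) p.
Proof.
move=> oW sX sY sf Wp; have [Ac cp] := chart_atP p.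
set c := chart_at p in Ac cp.
have oW' : open (W `&` cdom c) by apply: openI => //; exact: cdom_open.
have Wp' : (W `&` cdom c) p by [].
have Wc : W `&` cdom c `<=` cdom c by move=> q [].
have sf' : smooth (W `&` cdom c) f by apply: smooth_sub sf => q [].
have sD j := smooth_chart_deriv j Ac oW' Wc sf'.
(* A (B f): the second derivatives of f, then those of the components of B. *)
have VV A B : smooth_field W B -> vderiv A (vderiv B f) p =
   \sum_j (\sum_i chart_deriv c i (chart_deriv c j f) p * vderiv A (coord c i) p *
     vderiv B (coord c j) p) +
   \sum_j chart_deriv c j f p * vderiv A (vderiv B (coord c j)) p.
  move=> sB; rewrite -big_split /=.
  transitivity (vderiv A (fun q => \sum_j chart_deriv c j f q * vderiv B (coord c j) q) p).
    apply: (vderiv_ext A oW' Wp') => q Wq.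
    by rewrite (vderiv_chain B Ac oW' Wq _ sf') //; case: Wq.
  rewrite (vderiv_sum A oW' Wp') => [|j]; last by apply: smoothM => //; exact: sB.
  apply: eq_bigr => j _; rewrite (vderivM A oW' Wp' (sD j) (sB c Ac j)); congr (_ + _).
  by rewrite (vderiv_chain A Ac oW' Wp' cp (sD j)) mulr_suml.
rewrite !VV // vderivE -/c.
have -> : \sum_j \sum_i chart_deriv c i (chart_deriv c j f) p * vderiv Y (coord c i) p *
  vderiv X (coord c j) p =
  \sum_j \sum_i chart_deriv c i (chart_deriv c j f) p * vderiv X (coord c i) p *
    vderiv Y (coord c j) p.
  rewrite exchange_big; apply: eq_bigr => j _; apply: eq_bigr => i _ /=.
  by rewrite (chart_deriv_schwarz i j Ac oW Wp cp sf) mulrAC.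
rewrite opprD addrACA subrr add0r -sumrB; apply: eq_bigr => j _.
by rewrite mxE -mulrBr.
Qed.

Lemma smooth_bracket W X Y : open W -> smooth_field W X -> smooth_field W Y ->
  smooth_field W (bracket X Y).
Proof.
move=> oW sX sY c Ac i.
have oW' : open (W `&` cdom c) by apply: openI => //; exact: cdom_open.
have sX' := smooth_field_sub (@subIsetl _ W (cdom c)) sX.
have sY' := smooth_field_sub (@subIsetl _ W (cdom c)) sY.
have sc : smooth (W `&` cdom c) (coord c i).
  by apply: smooth_sub (smooth_coord i Ac) => q [].
apply: smooth_ext (smoothB oW' (smooth_vderiv oW' sX' (smooth_vderiv oW' sY' sc))
  (smooth_vderiv oW' sY' (smooth_vderiv oW' sX' sc))) => // p Wp.
by rewrite -(bracketE oW' sX' sY' sc).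
Qed.

Lemma coord_fieldE c j f W p : atlas c -> open W -> W p -> cdom c p -> smooth W f ->
  vderiv (coord_field c j) f p = chart_deriv c j f p.
Proof.
move=> Ac oW Wp cp sf; have [Ac' cp'] := chart_atP p.
rewrite vderivE (chart_deriv_chain j Ac' Ac oW Wp cp' cp sf); apply: eq_bigr => i _.
by rewrite mxE /chart_deriv /coord /= [in RHS]/partial derive_cst.
Qed.

Lemma chart_deriv_coord c i j p : atlas c -> cdom c p ->
  chart_deriv c i (coord c j) p = (i == j)%:R.
Proof.
move=> Ac cp; rewrite /chart_deriv /coord /= /partial derive_cst.
have -> : 'D_'e_i (fun x => cmap c (cinv c x) 0 j) (cmap c p) = 'D_'e_i (fun x : E =>
  x 0 j) (cmap c p).
  by apply: near_eq_derive; apply: (near_chart_image (@cdom_open _ _ c) cp cp) =>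
    x /chart_image_cinv[_ _ ->].
rewrite deriveE ?diff_coordE; last exact: differentiable_coord.
by rewrite mxE eqxx eq_sym /=; case: (_ == _).
Qed.

Lemma smooth_coord_field c j : atlas c -> smooth_field (cdom c) (coord_field c j).
Proof.
move=> Ac c' Ac' i; have oW : open (cdom c `&` cdom c') by apply: openI; exact: cdom_open.
have sc : smooth (cdom c `&` cdom c') (coord c' i).
  by apply: smooth_sub (smooth_coord i Ac') => q [].
have W1 : cdom c `&` cdom c' `<=` cdom c by move=> q [].
apply: smooth_ext (smooth_chart_deriv j Ac oW W1 sc) => // q Wq.
by rewrite (coord_fieldE j Ac oW Wq (W1 _ Wq) sc).
Qed.

(** Both sides have the same derivatives of coordinates, by the chain rule. *)
Lemma field_coordE c X p : atlas c -> cdom c p ->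
  X p = \sum_j vderiv X (coord c j) p *: coord_field c j p.
Proof.
move=> Ac cp; have [Ac' cp'] := chart_atP p; apply/matrixP => i k; rewrite ord1 summxE {k}.
have := vderiv_chain X Ac (@cdom_open _ _ (chart_at p)) cp' cp (smooth_coord i Ac').
rewrite vderivE (bigD1 i) //= (chart_deriv_coord _ _ Ac' cp') eqxx mul1r big1 => [|k ki];
  last first.
  by rewrite (chart_deriv_coord _ _ Ac' cp') (negbTE ki) mul0r.
rewrite addr0 => ->; apply: eq_bigr => j _; rewrite mxE mulrC; congr (_ * _).
by rewrite -(coord_fieldE j Ac (@cdom_open _ _ (chart_at p)) cp' cp (smooth_coord i Ac'))
  vderivE (bigD1 i) //= (chart_deriv_coord _ _ Ac' cp') eqxx mul1r big1 => [|k ki];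
  rewrite ?addr0 // (chart_deriv_coord _ _ Ac' cp') (negbTE ki) mul0r.
Qed.

Lemma coord_field_basis p j : coord_field (chart_at p) j p = delta_mx j 0.
Proof.
have [Ac cp] := chart_atP p; apply/matrixP => i k; rewrite !mxE ord1 eqxx andbT {k}.
have := chart_deriv_coord j i Ac cp; rewrite /chart_deriv => /(congr1 (@complex.Re R)) /= ->.
by rewrite eq_sym; case: (_ == _).
Qed.

Lemma smooth_form_sub U W eta : W `<=` U -> smooth_form U eta -> smooth_form W eta.
Proof. by move=> WU sE W' X oW' W'W sX; apply: sE => // q /W'W /WU. Qed.

(** Tensoriality of d eta (X, Y): expanding [X] and [Y] in a coordinate frame, the
    derivatives of their components cancel against the bracket term, and only
    their values at [p] remain. *)
Lemma d_evalE U eta X Y p : open U -> U p -> smooth_form U eta ->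
  smooth_field U X -> smooth_field U Y ->
  let c := chart_at p in
  let e i := fun q => ev (eta q) (coord_field c i q) in
  d_eval eta X Y p = \sum_i \sum_j (chart_deriv c i (e j) p - chart_deriv c j (e i) p) * X p i 0 *
    Y p j 0.
Proof.
move=> oU Up sE sX sY c e; have [Ac cp] := chart_atP p; rewrite -/c in Ac cp.
have oW : open (U `&` cdom c) by apply: openI => //; exact: cdom_open.
have Wp : (U `&` cdom c) p by [].
have se j : smooth (U `&` cdom c) (e j).
  by apply: sE => //; exact: smooth_field_sub (@subIsetr _ _ _) (smooth_coord_field j Ac).
(* A (eta (B)): first the derivatives of the components of B, then those of eta. *)
have half A B : smooth_field U B -> vderiv A (fun q => ev (eta q) (B q)) p =
   \sum_j vderiv A (vderiv B (coord c j)) p * eta p 0 j +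
   \sum_i \sum_j chart_deriv c i (e j) p * A p i 0 * B p j 0.
  move=> sB; rewrite (@vderiv_ext A (U `&` cdom c) _ (fun q =>
    \sum_j vderiv B (coord c j) q * e j q)) //; last first.
    move=> q [Uq cq]; rewrite [in LHS](field_coordE B Ac cq) ev_sumr.
    by apply: eq_bigr => j _; rewrite evZr.
  rewrite (vderiv_sum A oW Wp) => [|j]; last by apply: smoothM => //; exact: sB.
  rewrite exchange_big -big_split; apply: eq_bigr => j _ /=.
  rewrite (vderivM A oW Wp (sB c Ac j) (se j)); congr (_ * _ + _).
    by rewrite /e coord_field_basis ev_delta.
  have -> : vderiv B (coord c j) p = B p j 0.
    rewrite vderivE (bigD1 j) //= (chart_deriv_coord _ _ Ac cp) eqxx mul1r big1 ?addr0 // => k kj.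
    by rewrite (chart_deriv_coord _ _ Ac cp) (negbTE kj) mul0r.
  rewrite vderivE mulr_sumr; apply: eq_bigr => i _; ring.
rewrite /d_eval (half X Y sY) (half Y X sX) ev_sum -/c.
under [X in _ - X]eq_bigr => i _ do rewrite mxE mulrBr.
rewrite sumrB.
under [X in X + _ - _ - (_ - _)]eq_bigr => i _ do rewrite mulrC.
under [X in _ - (X + _) - (_ - _)]eq_bigr => i _ do rewrite mulrC.
rewrite [X in _ - (_ + X) - _ = _](_ : _ = \sum_i \sum_j chart_deriv c j (e i) p * X p i 0 *
  Y p j 0); last first.
  by rewrite exchange_big; apply: eq_bigr => i _; apply: eq_bigr => j _; rewrite mulrAC.
under [RHS]eq_bigr => i _ do (under eq_bigr => j _ do rewrite !mulrBl; rewrite sumrB).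
rewrite sumrB.
have alg (k l m n : C) : k + l - (m + n) - (k - m) = l - n by ring.
exact: alg.
Qed.

Lemma dformE U eta p i j : open U -> U p -> smooth_form U eta ->
  dform eta p i j = chart_deriv (chart_at p) i (fun q =>
    ev (eta q) (coord_field (chart_at p) j q)) p -
    chart_deriv (chart_at p) j (fun q => ev (eta q) (coord_field (chart_at p) i q)) p.
Proof.
move=> oU Up sE; have [Ac cp] := chart_atP p; set c := chart_at p in Ac cp *.
have oW : open (U `&` cdom c) by apply: openI => //; exact: cdom_open.
have Wp : (U `&` cdom c) p by [].
have sW k := smooth_field_sub (@subIsetr _ U _) (smooth_coord_field k Ac).
rewrite mxE (d_evalE oW Wp (smooth_form_sub (@subIsetl _ _ _) sE) (sW i) (sW j)) -/c.
rewrite ![coord_field _ _ p]coord_field_basis.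
exact: (sum_delta2 (fun k l => chart_deriv c k (fun q => ev (eta q) (coord_field c l q)) p -
  chart_deriv c l (fun q => ev (eta q) (coord_field c k q)) p)).
Qed.

(** The matrix [dform] collects d eta on coordinate fields only; by [d_evalE] it
    gives d eta on all fields, in particular on pseudohermitian frames. *)
Lemma ev2_dform U eta X Y p : open U -> U p -> smooth_form U eta ->
  smooth_field U X -> smooth_field U Y -> ev2 (dform eta p) (X p) (Y p) = d_eval eta X Y p.
Proof.
move=> oU Up sE sX sY; rewrite (d_evalE oU Up sE sX sY) ev2_sum.
by apply: eq_bigr => i _; apply: eq_bigr => j _; rewrite (dformE _ _ oU Up sE).
Qed.

Lemma dform_anti U eta p : open U -> U p -> smooth_form U eta -> (dform eta p)^T = - dform eta p.
Proof.
by move=> oU Up sE; apply/matrixP => i j; rewrite [LHS]mxE [RHS]mxE !(dformE _ _ oU Up sE) opprB.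
Qed.

Lemma smooth_ev2_dform U eta W X Y : open U -> smooth_form U eta -> open W -> W `<=` U ->
  smooth_field W X -> smooth_field W Y -> smooth W (fun p => ev2 (dform eta p) (X p) (Y p)).
Proof.
move=> oU sE oW WU sX sY; have sE' := smooth_form_sub WU sE.
have sev X' : smooth_field W X' -> smooth W (fun q => ev (eta q) (X' q)).
  by move=> sX'; apply: sE'.
apply: smooth_ext (smoothB oW (smoothB oW (smooth_vderiv oW sX (sev _ sY))
  (smooth_vderiv oW sY (sev _ sX))) (sev _ (smooth_bracket oW sX sY))) => // p Wp.
by rewrite (ev2_dform oW Wp sE' sX sY).
Qed.

Lemma bracket_coord_field c i j p : atlas c -> cdom c p ->
  bracket (coord_field c i) (coord_field c j) p = 0.
Proof.
move=> Ac cp; have [Ac' cp'] := chart_atP p; set c' := chart_at p in Ac' cp'.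
apply/matrixP => k l; rewrite [LHS]mxE [RHS]mxE -/c' {l}.
have oW : open (cdom c `&` cdom c') by apply: openI; exact: cdom_open.
have Wp : (cdom c `&` cdom c') p by [].
have sk : smooth (cdom c `&` cdom c') (coord c' k) by apply: smooth_sub (smooth_coord k Ac') =>
  q [].
have W1 : cdom c `&` cdom c' `<=` cdom c by move=> q [].
have E a b : vderiv (coord_field c a) (vderiv (coord_field c b) (coord c' k)) p =
  chart_deriv c a (chart_deriv c b (coord c' k)) p.
  rewrite -(coord_fieldE a Ac oW Wp cp (smooth_chart_deriv b Ac oW W1 sk)).
  apply: (vderiv_ext _ oW Wp) => q Wq; exact: coord_fieldE Ac oW Wq (W1 _ Wq) sk.
by rewrite !E (chart_deriv_schwarz i j Ac oW Wp cp sk) subrr.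
Qed.

(** The components of d eta in the coordinates of any chart around [p]: the
    coordinate fields commute.  Closed forms on [M] become closed systems of
    coefficients in a chart in this way. *)
Lemma dform_chart U eta c i j p : open U -> U p -> smooth_form U eta -> atlas c -> cdom c p ->
  ev2 (dform eta p) (coord_field c i p) (coord_field c j p) =
  chart_deriv c i (fun q => ev (eta q) (coord_field c j q)) p -
  chart_deriv c j (fun q => ev (eta q) (coord_field c i q)) p.
Proof.
move=> oU Up sE Ac cp.
have oW : open (U `&` cdom c) by apply: openI => //; exact: cdom_open.
have Wp : (U `&` cdom c) p by [].
have sW k := smooth_field_sub (@subIsetr _ U _) (smooth_coord_field k Ac).
have sE' := smooth_form_sub (@subIsetl _ _ (cdom c)) sE.
have se k : smooth (U `&` cdom c) (fun q => ev (eta q) (coord_field c k q)) by apply: sE'.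
rewrite (ev2_dform oW Wp sE' (sW i) (sW j)) /d_eval bracket_coord_field //.
by rewrite (coord_fieldE i Ac oW Wp cp (se j)) (coord_fieldE j Ac oW Wp cp (se i))
  /ev mulmx0 mxE subr0.
Qed.

Lemma conj_coord_field c j p : conjm (coord_field c j p) = coord_field c j p.
Proof. by apply/matrixP => i k; rewrite !mxE conjc_real. Qed.

(** Neighbourhoods that a chart maps onto a ball: they are connected, closed forms
    have primitives on them, and they form a basis of the topology. *)
Definition chart_ball V := exists c (x0 : E) (r : R),
  [/\ atlas c, 0 < r, ball x0 r `<=` cmap c @` cdom c &
      V = [set q | cdom c q /\ ball x0 r (cmap c q)]].

Lemma chart_ball_open V : chart_ball V -> open V.
Proof.
move=> [c [x0 [r [Ac r0 Bc ->]]]]; rewrite openE => q [cq Bq] /=.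
have n1 : \forall y \near q, cdom c y by apply: open_nbhs_nbhs; split => //; exact: cdom_open.
have n2 : \forall y \near q, ball x0 r (cmap c y).
  by apply: (cmap_cont cq); apply: open_nbhs_nbhs; split => //; exact: ball_open.
exact: filterI n1 n2.
Qed.

Lemma chart_ball_connected V : chart_ball V -> connected V.
Proof.
move=> [c [x0 [r [Ac r0 Bc ->]]]].
have -> : [set q | cdom c q /\ ball x0 r (cmap c q)] = cinv c @` ball x0 r.
  apply/seteqP; split => [q [cq Bq]|q [x xB <-]]; first by exists (cmap c q) => //; rewrite cmapK.
  by have [q' cq' e] := Bc _ xB; rewrite -e cmapK //= e.
apply: connected_continuous_connected; first exact: ball_connected.
by apply: continuous_in_subspaceT => x; rewrite inE => /Bc; exact: cinv_cont.
Qed.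

(** Read in the chart, [g] has vanishing partials on a ball. *)
Lemma chart_ball_const V (g : M -> R) : chart_ball V -> smooth V (fun q => (g q)%:C) ->
  (forall q, V q -> differential (fun q => (g q)%:C) q = 0) ->
  forall p q, V p -> V q -> g p = g q.
Proof.
move=> nV; have oV := chart_ball_open nV; case: nV => [c [x0 [r [Ac r0 Bc VE]]]] sg dg.
have imgE : chart_image c V = ball x0 r.
  apply/seteqP; split => [x [q [Vq cq] <-]|x xB]; first by move: Vq; rewrite VE => -[].
  by have [q cq e] := Bc _ xB; exists q => //; split => //; rewrite VE /= e.
have C1 : Ck 1 (ball x0 r) (fun x => g (cinv c x)) by rewrite -imgE; exact: (proj1 (sg c Ac)).
have H q : V q -> g q = g (cinv c x0).
  move=> Vq; have [cq Bq] : cdom c q /\ ball x0 r (cmap c q) by move: Vq; rewrite VE.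
  rewrite -(constant_on_ball r0 C1 _ Bq) ?cmapK // => x i.
  rewrite -imgE => /chart_image_cinv [Vx cx e].
  have : chart_deriv c i (fun q => (g q)%:C) (cinv c x) = 0.
    have [Ac' cp'] := chart_atP (cinv c x).
    rewrite (chart_deriv_chain i Ac' Ac oV Vx cp' cx sg) big1 // => j _.
    have /matrixP/(_ 0 j) := dg _ Vx; rewrite differentialE [LHS]mxE [RHS]mxE => ->.
    by rewrite mul0r.
  by rewrite /chart_deriv /= e => -[].
by move=> p q /H -> /H ->.
Qed.

(** In a chart, a real closed form has real coefficients with symmetric first
    derivatives, so [poincare_ball] provides a primitive on a small ball, which is
    smooth because its partial derivatives are. *)
Lemma poincare U beta p : open U -> U p -> smooth_form U beta ->
  (forall q, U q -> conjm (beta q) = beta q) -> (forall q, U q -> dform beta q = 0) ->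
  exists V, [/\ chart_ball V, V p, V `<=` U & exists f : M -> R,
    smooth V (fun q => (f q)%:C) /\
    forall q, V q -> differential (fun q => (f q)%:C) q = beta q].
Proof.
move=> oU Up sb rb db; have [Ac cp] := chart_atP p; set c := chart_at p in Ac cp.
pose e j q := ev (beta q) (coord_field c j q).
have oW : open (U `&` cdom c) by apply: openI => //; exact: cdom_open.
have se j : smooth (U `&` cdom c) (e j).
  by apply: sb; [|exact: subIsetl|exact: smooth_field_sub (@subIsetr _ U _)
    (smooth_coord_field j Ac)].
have eqI : chart_image c (U `&` cdom c) = chart_image c U by rewrite /chart_image -setIA setIid.
have er j q : U q -> (e j q)^* = e j q.
  by move=> Uq; rewrite -evJ rb // conj_coord_field.
have er' j q : U q -> e j q = (complex.Re (e j q))%:C.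
  by move=> Uq; apply: complex_eq => //=; have /(congr1 (@complex.Im R)) := er j q Uq;
    rewrite ImJ; lra.
have oI := chart_image_open c oU; have Ip : chart_image c U (cmap c p) by exact: chart_image_cmap.
pose b j x := complex.Re (e j (cinv c x)).
have Cb k j : Ck k (chart_image c U) (b j) by rewrite -eqI; exact: (proj1 (se j c Ac) k).
have closed x i j : chart_image c U x -> partial i (b j) x = partial j (b i) x.
  move=> /chart_image_cinv[Ux cx ex].
  have H : chart_deriv c i (e j) (cinv c x) = chart_deriv c j (e i) (cinv c x).
    by apply/subr0_eq; rewrite -(dform_chart i j oU Ux sb Ac cx) (db _ Ux) ev2_0l.
  by move: H => /(congr1 (@complex.Re R)); rewrite /chart_deriv /= ex.
have [r r0 [Br [F dF]]] := poincare_ball oI Ip (Cb 1%N) closed.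
have CF k : Ck k (ball (cmap c p) r) F.
  have oB : open (ball (cmap c p) r) by exact: ball_open.
  have Cb' i : Ck k (ball (cmap c p) r) (b i) by apply: Ck_sub Br (Cb k i).
  have C := Ck_of_partials oB dF Cb'.
  exact: CkS C.
exists [set q | cdom c q /\ ball (cmap c p) r (cmap c q)].
have BcE x : ball (cmap c p) r x -> (cmap c @` cdom c) x by move=> /Br [q [Uq cq] <-]; exists q.
have VU q : cdom c q -> ball (cmap c p) r (cmap c q) -> U q.
  by move=> cq /Br /chart_image_cinv[]; rewrite cmapK.
have nV : chart_ball [set q | cdom c q /\ ball (cmap c p) r (cmap c q)] by exists c, (cmap c p), r.
have oV := chart_ball_open nV.
set V := (X in chart_ball X) in nV oV *.
split => //.
- by split => //; exact: ballxx.
- by move=> q [cq] /(VU _ cq).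
exists (fun q => F (cmap c q)).
have imgE : cmap c @` V = ball (cmap c p) r.
  apply/seteqP; split => [x [q [_ ?] <-]//|x xB]; have [q cq ex] := BcE _ xB.
  by exists q => //; split => //; rewrite ex.
have sf : smooth V (fun q => (F (cmap c q))%:C).
  apply: (smooth_chart Ac) => //; first by move=> q [].
    move=> k; rewrite imgE; apply: Ck_ext (CF k); first exact: ball_open.
    by move=> x /BcE [q cq <-]; rewrite cmapK.
  by move=> k; exact: Ck_cst.
split=> // q Vq; have [cq Bq] := Vq; have Uq := VU _ cq Bq.
have De j : chart_deriv c j (fun q => (F (cmap c q))%:C) q = e j q.
  rewrite er' //; apply: complex_eq; last by rewrite /chart_deriv /= /partial derive_cst.
  rewrite /chart_deriv /=; have [_] := dF _ j Bq; rewrite /b cmapK // => <-; apply: near_eq_derive.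
  apply: (near_chart_image oV Vq cq) => x /chart_image_cinv [_ _ ex]; by rewrite ex.
apply/matrixP => i j; rewrite ord1 {i}.
have -> : differential (fun q => (F (cmap c q))%:C) q 0 j = vderiv (fun=> delta_mx j 0) (fun q =>
  (F (cmap c q))%:C) q.
  by rewrite /vderiv ev_delta.
rewrite (vderiv_chain _ Ac oV Vq cq sf) -ev_delta -[delta_mx j 0]/((fun=> delta_mx j 0) q).
rewrite [in RHS](field_coordE (fun=> delta_mx j 0) Ac cq) ev_sumr; apply: eq_bigr => k _.
by rewrite De evZr mulrC.
Qed.

End Calculus.
(** * The exterior derivative as an operator on forms *)

Section DformAlgebra.
Variables (R : realType) (M : manifold3 R).
Local Notation C := R[i].
Implicit Types (p q : M) (W U : set M) (eta xi : M -> 'rV[C]_3).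

Lemma dform_ext W eta xi p : open W -> W p -> (forall q, W q -> eta q = xi q) ->
  smooth_form W eta -> smooth_form W xi -> dform eta p = dform xi p.
Proof.
move=> oW Wp ex sE sx; have [Ac cp] := chart_atP p.
apply/matrixP => i j; rewrite (dformE _ _ oW Wp sE) (dformE _ _ oW Wp sx).
have H k l : chart_deriv (chart_at p) k (fun q => ev (eta q) (coord_field (chart_at p) l q)) p =
  chart_deriv (chart_at p) k (fun q => ev (xi q) (coord_field (chart_at p) l q)) p.
  by apply: (chart_deriv_ext _ oW Wp cp) => q /ex ->.
by rewrite !H.
Qed.

Lemma smooth_form_ext U eta xi : (forall q, U q -> eta q = xi q) -> smooth_form U eta ->
  smooth_form U xi.
Proof.
move=> ex sE W X oW WU sX; apply: smooth_ext (sE W X oW WU sX) => // q Wq.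
by rewrite ex //; exact: WU.
Qed.

Lemma smooth_formD U eta xi : smooth_form U eta -> smooth_form U xi ->
  smooth_form U (fun q => eta q + xi q).
Proof.
move=> sE sx W X oW WU sX; apply: smooth_ext (smoothD oW (sE W X oW WU sX) (sx W X oW WU sX)) =>
  // q _.
by rewrite evDl.
Qed.

Lemma smooth_formZ U (f : M -> C) eta : open U -> smooth U f -> smooth_form U eta ->
  smooth_form U (fun q => f q *: eta q).
Proof.
move=> oU sf sE W X oW WU sX.
apply: smooth_ext (smoothM oW (smooth_sub WU sf) (sE W X oW WU sX)) => // q _.
by rewrite evZl.
Qed.

Lemma smooth_formJ U eta : smooth_form U eta -> smooth_form U (fun q => conjm (eta q)).
Proof.
move=> sE W X oW WU sX; have := smoothJ oW (sE W _ oW WU (smooth_fieldJ oW sX)).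
by apply: smooth_ext => // q _; rewrite -evJ conjmK.
Qed.

Lemma smooth_ev_coord_field U eta c j : open U -> smooth_form U eta -> atlas c ->
  smooth (U `&` cdom c) (fun q => ev (eta q) (coord_field c j q)).
Proof.
move=> oU sE Ac; apply: sE => //; first by apply: openI => //; exact: cdom_open.
exact: smooth_field_sub (@subIsetr _ U _) (smooth_coord_field j Ac).
Qed.

Lemma dformD U eta xi p : open U -> U p -> smooth_form U eta -> smooth_form U xi ->
  dform (fun q => eta q + xi q) p = dform eta p + dform xi p.
Proof.
move=> oU Up sE sx; have [Ac cp] := chart_atP p; set c := chart_at p in Ac cp.
have oW : open (U `&` cdom c) by apply: openI => //; exact: cdom_open.
have Wp : (U `&` cdom c) p by [].
have H k l : chart_deriv c k (fun q => ev (eta q + xi q) (coord_field c l q)) p =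
   chart_deriv c k (fun q => ev (eta q) (coord_field c l q)) p + chart_deriv c k (fun q =>
     ev (xi q) (coord_field c l q)) p.
  rewrite -(chart_derivD k Ac oW Wp cp (smooth_ev_coord_field l oU sE Ac)
    (smooth_ev_coord_field l oU sx Ac)).
  by apply: (chart_deriv_ext _ oW Wp cp) => q _; rewrite evDl.
apply/matrixP => i j; rewrite [RHS]mxE (dformE _ _ oU Up (smooth_formD sE sx)).
rewrite (dformE _ _ oU Up sE) (dformE _ _ oU Up sx) -/c !H.
by rewrite opprD addrACA.
Qed.

Lemma dformJ U eta p : open U -> U p -> smooth_form U eta ->
  dform (fun q => conjm (eta q)) p = conjm (dform eta p).
Proof.
move=> oU Up sE; have [Ac cp] := chart_atP p; set c := chart_at p in Ac cp.
have oW : open (U `&` cdom c) by apply: openI => //; exact: cdom_open.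
have Wp : (U `&` cdom c) p by [].
have H k l : chart_deriv c k (fun q => ev (conjm (eta q)) (coord_field c l q)) p =
   (chart_deriv c k (fun q => ev (eta q) (coord_field c l q)) p)^*%C.
  rewrite -(chart_derivJ k Ac oW Wp cp (smooth_ev_coord_field l oU sE Ac)).
  by apply: (chart_deriv_ext _ oW Wp cp) => q _; rewrite -evJ conj_coord_field.
apply/matrixP => i j; rewrite [RHS]mxE (dformE _ _ oU Up (smooth_formJ sE)).
by rewrite (dformE _ _ oU Up sE) -/c !H rmorphB.
Qed.

Lemma smooth_differential U (f : M -> C) : open U -> smooth U f -> smooth_form U (differential f).
Proof. by move=> oU sf W X oW WU sX; exact: smooth_vderiv oW sX (smooth_sub WU sf). Qed.

(** Symmetry of second derivatives. *)
Lemma dform_differential U (f : M -> C) p : open U -> U p -> smooth U f ->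
  dform (differential f) p = 0.
Proof.
move=> oU Up sf; have [Ac cp] := chart_atP p; set c := chart_at p in Ac cp.
have oW : open (U `&` cdom c) by apply: openI => //; exact: cdom_open.
have Wp : (U `&` cdom c) p by [].
have sf' : smooth (U `&` cdom c) f by apply: smooth_sub sf => q [].
have W1 : U `&` cdom c `<=` cdom c by move=> q [].
have H k l : chart_deriv c k (fun q => ev (differential f q) (coord_field c l q)) p =
  chart_deriv c k (chart_deriv c l f) p.
  by apply: (chart_deriv_ext _ oW Wp cp) => q Wq; exact: coord_fieldE Ac oW Wq (W1 _ Wq) sf'.
apply/matrixP => i j; rewrite [RHS]mxE (dformE _ _ oU Up (smooth_differential oU sf)) -/c !H.
by rewrite (chart_deriv_schwarz i j Ac oW Wp cp sf') subrr.
Qed.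

Lemma smooth_fieldZ W (f : M -> C) X : open W -> smooth W f -> smooth_field W X ->
  smooth_field W (fun q => f q *: X q).
Proof.
move=> oW sf sX c Ac i; have oW' : open (W `&` cdom c) by apply: openI => //; exact: cdom_open.
apply: smooth_ext (smoothM oW' (smooth_sub (@subIsetl _ _ _) sf) (sX c Ac i)) => // q _.
by rewrite [RHS]/vderiv evZr.
Qed.

Lemma bracketJ W X Y p : open W -> W p -> smooth_field W X -> smooth_field W Y ->
  conjm (bracket X Y p) = bracket (fun q => conjm (X q)) (fun q => conjm (Y q)) p.
Proof.
move=> oW Wp sX sY; have [Ac cp] := chart_atP p; set c := chart_at p in Ac cp.
have oW' : open (W `&` cdom c) by apply: openI => //; exact: cdom_open.
have Wp' : (W `&` cdom c) p by [].
have sc i : smooth (W `&` cdom c) (coord c i) by apply: smooth_sub (smooth_coord i Ac) => q [].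
have E A B i : smooth_field W A -> smooth_field W B ->
  (vderiv A (vderiv B (coord c i)) p)^*%C = vderiv (fun q => conjm (A q)) (vderiv (fun q =>
    conjm (B q)) (coord c i)) p.
  move=> sA sB; rewrite -(vderivJ A oW' Wp' (sB c Ac i)).
  apply: (vderiv_ext _ oW' Wp') => q Wq; rewrite -(vderivJ B oW' Wq (sc i)).
  by apply: (vderiv_ext _ oW' Wq) => r _; rewrite /coord conjc_real.
apply/matrixP => i j; rewrite [LHS]mxE [RHS]mxE [X in X^*%C]mxE -/c.
by rewrite -!E // rmorphB.
Qed.

Lemma bracket_anti X Y p : bracket X Y p = - bracket Y X p.
Proof. by apply/matrixP => i j; rewrite [LHS]mxE [RHS]mxE [in RHS]mxE opprB. Qed.

End DformAlgebra.

(** * Pseudohermitian frames *)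

Section PseudohermitianFrames.
Variables (R : realType) (M : manifold3 R) (H : cr_structure M).
Variable (S : pseudohermitian H).
Hypothesis hS : levi_positive S.
Local Notation C := R[i].
Local Notation theta := (theta S).
Local Notation T := (reeb S).
Local Notation B p := (ev2 (dform theta p)).
Implicit Types (p q : M) (W U : set M) (z v w : 'cV[C]_3).

Lemma smooth_theta U : smooth_form U theta.
Proof. by apply: smooth_form_sub (theta_smooth S). Qed.

Lemma dtheta_anti p : (dform theta p)^T = - dform theta p.
Proof. exact: dform_anti openT I (theta_smooth S). Qed.

Lemma B_anti p u v : B p v u = - B p u v.
Proof. exact: ev2_anti (dtheta_anti p). Qed.

Lemma B_diag p u : B p u u = 0.
Proof. exact: ev2_diag (dtheta_anti p). Qed.

Lemma thetaJ p : conjm (theta p) = theta p. Proof. exact: theta_real. Qed.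

(** [theta] is real, hence so is its exterior derivative. *)
Lemma BJ p u v : B p (conjm u) (conjm v) = (B p u v)^*%C.
Proof.
rewrite -ev2J -(dformJ openT I (theta_smooth S)).
rewrite (dform_ext (xi := theta) openT I) //;
  [|exact: smooth_formJ (theta_smooth S)|exact: theta_smooth].
by move=> q _; exact: thetaJ.
Qed.

Lemma ev_thetaJ p v : ev (theta p) (conjm v) = (ev (theta p) v)^*%C.
Proof. by rewrite -evJ thetaJ. Qed.

Lemma T10_span p : exists2 z, z != 0 & T10 H p = [set c *: z | c in setT].
Proof.
have [W [Z [oW Wp sZ HZ]]] := T10_line H p; have [Z0 TZ] := HZ p Wp.
by exists (Z p).
Qed.

Lemma T10Z p c z : T10 H p z -> T10 H p (c *: z).
Proof. by have [z0 _ ->] := T10_span p; move=> [a _ <-]; exists (c * a); rewrite ?scalerA. Qed.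

Lemma T10_0 p : T10 H p 0.
Proof. by have [z0 _ ->] := T10_span p; exists 0; rewrite ?scale0r. Qed.

Lemma theta_T10 p z : T10 H p z -> ev (theta p) z = 0.
Proof.
move=> Tz; apply/(theta_ker S p z); exists z, 0; split => //; first exact: T10_0.
by rewrite /conjm map_mx0 addr0.
Qed.

Lemma leviE p z w : levi S p z w = 'i%C * B p z (conjm w). Proof. by []. Qed.

Lemma mulii : 'i%C * 'i%C = -1 :> C.
Proof. by rewrite -expr2 sqr_i. Qed.

Lemma conj_ni (x : C) : (- 'i%C * x)^*%C = 'i%C * x^*%C.
Proof. by case: x => a b; apply: complex_eq => /=; ring. Qed.

Lemma conj_dbar (x a y : C) : (- (x - 'i%C * a * y))^*%C = - (x^*%C + 'i%C * a^*%C * y^*%C).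
Proof. by case: x a y => [x1 x2] [a1 a2] [y1 y2]; apply: complex_eq => /=; ring. Qed.

Lemma unit_B p z : levi S p z z = 1 -> B p z (conjm z) = - 'i%C.
Proof.
by move=> h; rewrite -[LHS]mul1r -[1]opprK -mulii mulNr -mulrA -leviE h mulr1.
Qed.

(** The covector v |-> i dtheta (v, conj z).  When [z] is a unit vector it is the
    first covector of the frame ([frame_dual]) and the only one possible
    ([frame_zetaE]); being an expression in dtheta and [z], it is smooth along a
    smooth field. *)
Definition dual_covector p z : 'rV[C]_3 := 'i%C *: (dform theta p *m conjm z)^T.

Lemma ev_dual p z v : ev (dual_covector p z) v = 'i%C * B p v (conjm z).
Proof.
rewrite /dual_covector evZl; congr (_ * _); rewrite /ev /ev2 -mulmxA.
by rewrite !mxE; apply: eq_bigr => i _; rewrite !mxE mulrC.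
Qed.

Lemma T10_mul p z w : T10 H p z -> z != 0 -> T10 H p w -> exists c, w = c *: z.
Proof.
have [z0 _ ->] := T10_span p; move=> [a _ <-] az [b _ <-].
have a0 : a != 0 by apply: contraNneq az => ->; rewrite scale0r.
by exists (b / a); rewrite scalerA divfK.
Qed.

Lemma unit_neq0 p z : levi S p z z = 1 -> z != 0.
Proof.
move=> h; apply/eqP => z0; move: h; rewrite z0 leviE /ev2 trmx0 !mul0mx mxE mulr0.
by move/eqP; rewrite eq_sym oner_eq0.
Qed.

Lemma ker_theta p z v : T10 H p z -> levi S p z z = 1 -> ev (theta p) v = 0 ->
  exists a b, v = a *: z + b *: conjm z.
Proof.
move=> Tz lz /(theta_ker S p v) [x [y [Tx Ty ->]]]; have z0 := unit_neq0 lz.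
have [a ->] := T10_mul Tz z0 Tx; have [b ->] := T10_mul Tz z0 Ty.
by exists a, b^*%C; rewrite conjmZ.
Qed.

(** The Levi form is sesquilinear, and 0 < a in the complex numbers forces [a] to
    be real. *)
Lemma unit_normalize p z : 0 < levi S p z z ->
  let s := ((Num.sqrt (complex.Re (levi S p z z)))^-1)%:C in levi S p (s *: z) (s *: z) = 1.
Proof.
move=> L0 s; rewrite leviE conjmZ ev2Zl ev2Zr mulrCA [_ * (s^*%C * _)]mulrCA -leviE.
move: L0; rewrite /s; move: (levi S p z z) => [a b]; rewrite ltcE /= => /andP[/eqP -> a0].
have sa : Num.sqrt a * Num.sqrt a = a by rewrite -expr2 sqr_sqrtr // ltW.
have sa0 : Num.sqrt a != 0 by rewrite gt_eqF // sqrtr_gt0.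
have e : (Num.sqrt a)^-1 * ((Num.sqrt a)^-1 * a) = 1 by rewrite -{3}sa mulKf // mulVf.
by apply: complex_eq => /=; [rewrite -[RHS]e|]; ring.
Qed.

Lemma unit_vector_ex p : exists2 z, T10 H p z & levi S p z z = 1.
Proof.
have [z0 z00 TE] := T10_span p.
have Tz0 : T10 H p z0 by rewrite TE; exists 1; rewrite ?scale1r.
exists (((Num.sqrt (complex.Re (levi S p z0 z0)))^-1)%:C *: z0); first exact: T10Z.
by apply: unit_normalize; exact: hS.
Qed.

(** Start from a vector on which [theta] takes the value 1.  As dtheta (z, conj z)
    is nonzero, a combination of [z] and [conjm z], which [theta] annihilates,
    corrects it so that its contractions with dtheta vanish on these two vectors;
    the contraction with the vector itself vanishes by alternation. *)
Lemma reebP p : ev (theta p) (T p) = 1 /\ forall v, B p (T p) v = 0.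
Proof.
have [z Tz lz] := unit_vector_ex p.
apply: (@xgetPex _ 0 [set t | ev (theta p) t = 1 /\ forall v, B p t v = 0]).
have [v0 tv0] : exists v0, ev (theta p) v0 = 1.
  have [j tj] : exists j, theta p 0 j != 0.
    apply/existsP; apply: contraTT (theta_neq0 S p); rewrite negb_exists negbK => /forallP H0.
    by apply/eqP/matrixP => i j; rewrite ord1 mxE; apply/eqP; rewrite -[_ == _]negbK; exact: H0.
  by exists ((theta p 0 j)^-1 *: delta_mx j 0); rewrite evZr ev_delta mulVf.
have tz := theta_T10 Tz.
have tzb : ev (theta p) (conjm z) = 0 by rewrite ev_thetaJ tz conjc0.
have Bz := unit_B lz.
have Bzb : B p (conjm z) z = 'i%C by rewrite B_anti Bz opprK.
(* These coefficients solve B t (conj z) = 0 and B t z = 0, as B z (conj z) = - i. *)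
pose al := 'i%C * B p v0 (conjm z); pose be := - 'i%C * B p v0 z.
pose t := v0 + (- al) *: z + (- be) *: conjm z.
have tt : ev (theta p) t = 1 by rewrite /t !evDr !evZr tz tzb !mulr0 !addr0.
have alg1 (x a : C) : x + - a * 0 + - (- 'i%C * x) * 'i%C = x + x * ('i%C * 'i%C) by ring.
have alg2 (x a : C) : x + - ('i%C * x) * - 'i%C + - a * 0 = x + x * ('i%C * 'i%C) by ring.
exists t; split => // v.
have Btz : B p t z = 0.
  by rewrite /t !ev2Dl !ev2Zl B_diag Bzb /be alg1 mulii mulrN1 subrr.
have Btzb : B p t (conjm z) = 0.
  by rewrite /t !ev2Dl !ev2Zl B_diag Bz /al alg2 mulii mulrN1 subrr.
have [|a [b vE]] := @ker_theta p z (v - ev (theta p) v *: t) Tz lz.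
  by rewrite evDr evNr evZr tt mulr1 subrr.
have -> : v = ev (theta p) v *: t + (a *: z + b *: conjm z) by rewrite -vE addrC subrK.
by rewrite !ev2Dr !ev2Zr B_diag Btz Btzb !mulr0 !addr0.
Qed.

(** [conjm (T p) - T p] lies in the kernel of [theta] and contracts to zero with
    dtheta, which is nondegenerate on that kernel. *)
Lemma reebJ p : conjm (T p) = T p.
Proof.
have [tT BT] := reebP p; have [z Tz lz] := unit_vector_ex p.
have [|a [b dE]] := @ker_theta p z (conjm (T p) - T p) Tz lz.
  by rewrite evDr evNr ev_thetaJ tT conjc1 subrr.
have BJT v : B p (conjm (T p)) v = 0 by rewrite -[v]conjmK BJ BT conjc0.
have Bd v : B p (a *: z + b *: conjm z) v = 0.
  by rewrite -dE ev2Dl -scaleN1r ev2Zl BJT BT mulr0 addr0.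
have i0 : 'i%C != 0 :> C by apply/eqP => /(congr1 (@complex.Im R)) /= /eqP; rewrite oner_eq0.
have a0 : a = 0.
  have /eqP := Bd (conjm z); rewrite ev2Dl !ev2Zl B_diag (unit_B lz) mulr0 addr0 mulrN oppr_eq0.
  by rewrite mulf_eq0 (negbTE i0) orbF => /eqP.
have b0 : b = 0.
  have /eqP := Bd z; rewrite ev2Dl !ev2Zl B_diag B_anti (unit_B lz) mulr0 add0r opprK.
  by rewrite mulf_eq0 (negbTE i0) orbF => /eqP.
by apply/eqP; rewrite -subr_eq0 dE a0 b0 !scale0r addr0.
Qed.

Lemma frame_dual p z : T10 H p z -> levi S p z z = 1 -> frame_at S p z (dual_covector p z).
Proof.
move=> Tz lz; split => //; rewrite ev_dual.
- by [].
- by rewrite B_diag mulr0.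
- by rewrite (proj2 (reebP p)) mulr0.
Qed.

Section Frame.
Variables (p : M) (z : 'cV[C]_3) (zeta : 'rV[C]_3).
Hypothesis F : frame_at S p z zeta.

Lemma frame_theta : [/\ ev (theta p) z = 0, ev (theta p) (conjm z) = 0 & ev (theta p) (T p) = 1].
Proof.
have [Tz _ _ _ _] := F; split; [exact: theta_T10| |exact: (proj1 (reebP p))].
by rewrite ev_thetaJ theta_T10 // conjc0.
Qed.

Lemma frame_conj : [/\ ev (conjm zeta) z = 0,
  ev (conjm zeta) (conjm z) = 1 & ev (conjm zeta) (T p) = 0].
Proof.
have [_ _ z1 z2 z3] := F; split; last by rewrite -reebJ evJ z3 conjc0.
  by rewrite -[z]conjmK evJ z2 conjc0.
by rewrite evJ z1 conjc1.
Qed.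

Lemma frame_dec v : v = ev zeta v *: z + ev (conjm zeta) v *: conjm z + ev (theta p) v *: T p.
Proof.
have [Tz lz z1 z2 z3] := F; have [c1 c2 c3] := frame_conj; have [t1 t2 t3] := frame_theta.
have [|a [b vE]] := @ker_theta p z (v - ev (theta p) v *: T p) Tz lz.
  by rewrite evDr evNr evZr t3 mulr1 subrr.
have v1 : v = a *: z + b *: conjm z + ev (theta p) v *: T p by rewrite -vE subrK.
have e1 : ev zeta v = a by rewrite v1 !evDr !evZr z1 z2 z3 !mulr0 !addr0 mulr1.
have e2 : ev (conjm zeta) v = b by rewrite v1 !evDr !evZr c1 c2 c3 !mulr0 addr0 add0r mulr1.
by rewrite e1 e2.
Qed.

(** (z, conj z, T) is a basis of the tangent space. *)
Lemma frame_ext (al be : 'rV[C]_3) : ev al z = ev be z -> ev al (conjm z) = ev be (conjm z) ->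
  ev al (T p) = ev be (T p) -> al = be.
Proof.
move=> e1 e2 e3; apply: ev_inj => v.
by rewrite (frame_dec v) !evDr !evZr e1 e2 e3.
Qed.

Lemma frame_zetaE v : ev zeta v = 'i%C * B p v (conjm z).
Proof.
have [Tz lz z1 z2 z3] := F.
rewrite -ev_dual; congr ev; have [_ _ d1 d2 d3] := frame_dual Tz lz.
by apply: frame_ext; rewrite ?z1 ?z2 ?z3 ?d1 ?d2 ?d3.
Qed.

(** T^{1,0} is a line on which the Levi form is definite: two unit vectors of it
    differ by a factor of modulus 1, and the dual covectors by its inverse. *)
Lemma frame_rot z' zeta' : frame_at S p z' zeta' ->
  exists u : C, [/\ u * u^*%C = 1, z' = u *: z & zeta = u *: zeta'].
Proof.
move=> [Tz' lz' z1' z2' z3']; have [Tz lz z1 z2 z3] := F.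
have [u uE] := T10_mul Tz (unit_neq0 lz) Tz'.
have uu : u * u^*%C = 1.
  by move: lz'; rewrite uE leviE conjmZ ev2Zl ev2Zr mulrCA [_ * (u^*%C * _)]mulrCA -leviE lz mulr1.
exists u; split => //.
have u0 : u != 0 by apply: contra_eq_neq uu => ->; rewrite mul0r eq_sym oner_eq0.
have u1 : u^*%C != 0 by rewrite conjc_eq0.
apply: frame_ext; rewrite evZl ?z1 ?z2 ?z3 ?z3' ?mulr0 //.
  by rewrite -[in RHS]evZr -uE z1'.
apply/esym/eqP; rewrite mulf_eq0 (negbTE u0) /=; apply/eqP.
by apply: (mulfI u1); rewrite mulr0 -evZr -conjmZ -uE z2'.
Qed.

End Frame.

Section LocalFrame.
Variables (W : set M) (Z : M -> 'cV[C]_3) (zeta : M -> 'rV[C]_3).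
Hypothesis F : local_frame S W Z zeta.

Let oW : open W. Proof. by case: F. Qed.
Let sZ : smooth_field W Z. Proof. by case: F. Qed.
Let Fp q : W q -> frame_at S q (Z q) (zeta q). Proof. by case: F => _ _; apply. Qed.
Let Zb q := conjm (Z q).
Let sZb : smooth_field W Zb. Proof. exact: smooth_fieldJ. Qed.
Let Br := bracket Z Zb.

Lemma local_frame_sub W' : open W' -> W' `<=` W -> local_frame S W' Z zeta.
Proof. by move=> oW' WW; split => // [|q /WW]; [exact: smooth_field_sub sZ|exact: Fp]. Qed.

(** The theta component is -dtheta (Z, conj Z) = i because theta vanishes on Z and
    conj Z.  The zeta component is -i a by definition of a, and the conj zeta
    component follows because the bracket of Z and conj Z is purely imaginary. *)
Lemma bracket_frame q : W q ->
  Br q = (- 'i%C * frame_a Z zeta q) *: Z q + (- 'i%C * (frame_a Z zeta q)^*%C) *: Zb q +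
    'i%C *: T q.
Proof.
move=> Wq; have [t1 t2 t3] := frame_theta (Fp Wq).
have tB : ev (theta q) (Br q) = 'i%C.
  have := ev2_dform oW Wq (@smooth_theta W) sZ sZb.
  have [Tz lz _ _ _] := Fp Wq.
  rewrite (unit_B lz) /d_eval (vderiv_ext _ oW Wq (g := fun=> 0)); last first.
    by move=> r Wr; have [] := frame_theta (Fp Wr).
  rewrite vderiv_cst (vderiv_ext _ oW Wq (g := fun=> 0)); last first.
    by move=> r Wr; have [] := frame_theta (Fp Wr).
  by rewrite vderiv_cst subrr sub0r => /oppr_inj <-.
have Bc : conjm (Br q) = - Br q.
  rewrite /Br (bracketJ oW Wq sZ sZb) bracket_anti; congr (- _).
  rewrite /Zb; congr (bracket _ _ q); apply/funext => r; exact: conjmK.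
have cB : ev (conjm (zeta q)) (Br q) = - (ev (zeta q) (Br q))^*%C.
  by rewrite -[X in ev _ X]opprK -Bc evNr evJ.
have aE : ev (zeta q) (Br q) = - 'i%C * frame_a Z zeta q.
  by rewrite /frame_a mulrA mulNr mulii opprK mul1r.
rewrite {1}(frame_dec (Fp Wq) (Br q)) tB cB aE.
by rewrite conj_ni !mulNr.
Qed.

(** [zeta] is v |-> i dtheta (v, conj Z). *)
Lemma smooth_zeta : smooth_form W zeta.
Proof.
move=> W' X oW' W'W sX.
have sZb' := smooth_field_sub W'W sZb.
have s1 := smooth_ev2_dform openT (theta_smooth S) oW' (@subsetT _ _) sX sZb'.
apply: smooth_ext (smoothM oW' (smooth_cst W' 'i%C) s1) => // q /W'W Wq.
by rewrite (frame_zetaE (Fp Wq)).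
Qed.

Lemma d_zeta (g : M -> C) q : W q -> smooth W g ->
  ev2 (dform (fun r => g r *: zeta r) q) (Z q) (Zb q) =
   - (vderiv Zb g q - 'i%C * frame_a Z zeta q * g q).
Proof.
move=> Wq sg; rewrite (ev2_dform oW Wq (smooth_formZ oW sg smooth_zeta) sZ sZb) /d_eval.
rewrite (vderiv_ext _ oW Wq (g := fun=> 0)); last first.
  by move=> r Wr; have [_ _ _ z2 _] := Fp Wr; rewrite evZl z2 mulr0.
rewrite vderiv_cst (vderiv_ext _ oW Wq (g := g)); last first.
  by move=> r Wr; have [_ _ z1 _ _] := Fp Wr; rewrite evZl z1 mulr1.
rewrite evZl.
have -> : ev (zeta q) (Br q) = - 'i%C * frame_a Z zeta q.
  by rewrite /frame_a mulrA mulNr mulii opprK mul1r.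
by ring.
Qed.

End LocalFrame.

(** A local section of T^{1,0}, divided by the square root of its Levi norm. *)
Lemma local_frame_ex p : exists (W : set M) (Z : M -> 'cV[C]_3) (zeta : M -> 'rV[C]_3),
  W p /\ local_frame S W Z zeta.
Proof.
have [W [Z [oW Wp sZ HZ]]] := T10_line H p.
have sZb := smooth_fieldJ oW sZ.
have sl : smooth W (fun q => levi S q (Z q) (Z q)).
  apply: smoothM => //; first exact: smooth_cst.
  exact: smooth_ev2_dform openT (theta_smooth S) oW (@subsetT _ _) sZ sZb.
have TZ q : W q -> T10 H q (Z q).
  by move=> Wq; have [_ ->] := HZ q Wq; exists 1; rewrite ?scale1r.
have lpos q : W q -> 0 < levi S q (Z q) (Z q).
  by move=> Wq; apply: hS; [exact: TZ|case: (HZ q Wq)].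
pose s q : C := ((Num.sqrt (complex.Re (levi S q (Z q) (Z q))))^-1)%:C.
exists W, (fun q => s q *: Z q), (fun q => dual_covector q (s q *: Z q)); split => //.
split => // [|q Wq]; first exact: smooth_fieldZ oW (smooth_rsqrt oW lpos sl) sZ.
apply: frame_dual; first exact/T10Z/TZ.
exact: unit_normalize (lpos q Wq).
Qed.

(** * The operator delta *)

(** The coefficient b attached to g zeta, namely its exterior derivative on
    (Z, conj Z) ([d_zeta]). *)
Definition dbar_coef (Z : M -> 'cV[C]_3) (zeta : M -> 'rV[C]_3) (g : M -> C) q : C :=
  - (vderiv (fun r => conjm (Z r)) g q - 'i%C * frame_a Z zeta q * g q).

Lemma dbar_coefJ W Z zeta g q : local_frame S W Z zeta -> W q -> smooth W g ->
  (dbar_coef Z zeta g q)^*%C = - (vderiv Z (fun r => (g r)^*%C) q + 'i%C *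
    (frame_a Z zeta q)^*%C * (g q)^*%C).
Proof.
move=> F Wq sg; have [oW sZ _] := F.
rewrite /dbar_coef conj_dbar -(vderivJ _ oW Wq sg); congr (- (_ + _)).
by rewrite /vderiv conjmK.
Qed.

(** By [d_zeta] both sides are values of d(g zeta) on (Z, conj Z) and on
    (u Z, conj (u Z)), and u conj u = 1. *)
Lemma dbar_coef_frame W W' Z Z' zeta zeta' g g' q :
  local_frame S W Z zeta -> local_frame S W' Z' zeta' -> W q -> W' q ->
  smooth W g -> smooth W' g' ->
  (forall r, W r -> W' r -> g r *: zeta r = g' r *: zeta' r) ->
  dbar_coef Z zeta g q = dbar_coef Z' zeta' g' q.
Proof.
move=> F F' Wq W'q sg sg' E.
have [oW _ Fp] := F; have [oW' _ Fp'] := F'.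
have oI : open (W `&` W') by exact: openI.
have Iq : (W `&` W') q by [].
have FI := local_frame_sub F oI (@subIsetl _ _ _).
have FI' := local_frame_sub F' oI (@subIsetr _ _ _).
have sI : smooth (W `&` W') g by apply: smooth_sub sg; exact: subIsetl.
have sI' : smooth (W `&` W') g' by apply: smooth_sub sg'; exact: subIsetr.
rewrite /dbar_coef -(d_zeta FI Iq sI) -(d_zeta FI' Iq sI').
rewrite (dform_ext oI Iq (xi := fun r => g' r *: zeta' r)); first last.
- exact: smooth_formZ oI sI' (smooth_zeta FI').
- exact: smooth_formZ oI sI (smooth_zeta FI).
- by move=> r [Wr W'r]; exact: E.
have [u [uu -> _]] := frame_rot (Fp q Wq) (Fp' q W'q).
by rewrite conjmZ ev2Zl ev2Zr mulrA uu mul1r.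
Qed.

Lemma eqE1_ev p al be v : eqE1 S p al be -> ev (theta p) v = 0 -> ev al v = ev be v.
Proof. by move=> [t ->] tv; rewrite evDl evZl tv mulr0 addr0. Qed.

(** Passing from [z] to a unit multiple multiplies the coefficients and [zeta] by
    inverse factors; this is what makes [delta] well defined. *)
Lemma coef_rot p z z' (zeta zeta' al : 'rV[C]_3) (g h g' h' : C) :
  frame_at S p z zeta -> frame_at S p z' zeta' ->
  eqE1 S p al (g *: zeta + h *: conjm zeta) -> eqE1 S p al (g' *: zeta' + h' *: conjm zeta') ->
  g *: zeta = g' *: zeta' /\ h^*%C *: zeta = h'^*%C *: zeta'.
Proof.
move=> F F' E E'; have [t1 t2 _] := frame_theta F; have [c1 c2 _] := frame_conj F.
have [_ _ z1 z2 _] := F; have [u [uu _ zE]] := frame_rot F F'.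
have u0 : u != 0 by apply: contra_eq_neq uu => ->; rewrite mul0r eq_sym oner_eq0.
have y1 : u * ev zeta' z = 1 by rewrite -evZl -zE.
have y2 : ev zeta' (conjm z) = 0.
  by apply: (mulfI u0); rewrite mulr0 -evZl -zE.
have y3 : ev (conjm zeta') z = 0 by rewrite -[z]conjmK evJ y2 conjc0.
have e1 : g = g' * ev zeta' z.
  have := eqE1_ev E t1; rewrite (eqE1_ev E' t1) !evDl !evZl z1 c1 y3 !mulr0 !addr0 mulr1.
  by move=> ->.
have e2 : h = h' * (ev zeta' z)^*%C.
  have := eqE1_ev E t2; rewrite (eqE1_ev E' t2) !evDl !evZl z2 c2 y2 evJ !mulr0 !add0r mulr1.
  by move=> ->.
split; first by rewrite e1 zE scalerA -mulrA [_ * u]mulrC y1 mulr1.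
rewrite e2 zE scalerA; congr (_ *: _).
have -> : (h' * (ev zeta' z)^*%C)^*%C = h'^*%C * ev zeta' z.
  by case: (h') (ev zeta' z) => [a b] [c d]; apply: complex_eq => /=; ring.
by rewrite -mulrA [_ * u]mulrC y1 mulr1.
Qed.

(** [delta] is specified by all frames around the point at once.  Written in terms
    of [dbar_coef] its value is the same in all of them, so the specification is
    satisfiable and any frame computes it. *)
Lemma deltaE W Z zeta (g h : M -> C) eta p : local_frame S W Z zeta -> W p ->
  smooth W g -> smooth W h ->
  (forall q, W q -> eqE1 S q (eta q) (g q *: zeta q + h q *: conjm (zeta q))) ->
  delta S eta p = dbar_coef Z zeta g p + (dbar_coef Z zeta (fun q => (h q)^*%C) p)^*%C.
Proof.
move=> F Wp sg sh E; have [oW sZ Fp] := F.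
have shJ := smoothJ oW sh.
have form W1 Z1 zeta1 (g1 h1 : M -> C) : local_frame S W1 Z1 zeta1 -> W1 p -> smooth W1 g1 ->
  smooth W1 h1 ->
  - (vderiv (fun q => conjm (Z1 q)) g1 p - 'i%C * frame_a Z1 zeta1 p * g1 p)
        - (vderiv Z1 h1 p + 'i%C * (frame_a Z1 zeta1 p)^*%C * h1 p) =
  dbar_coef Z1 zeta1 g1 p + (dbar_coef Z1 zeta1 (fun q => (h1 q)^*%C) p)^*%C.
  move=> F1 W1p sg1 sh1; have [oW1 _ _] := F1.
  rewrite (dbar_coefJ F1 W1p (smoothJ oW1 sh1)) conjcK; congr (_ - (_ + _)).
  by apply: (vderiv_ext _ oW1 W1p) => q _; rewrite conjcK.
pose P := [set y | forall W Z zeta (g h : M -> C), W p -> local_frame S W Z zeta ->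
    smooth W g -> smooth W h ->
    (forall q, W q -> eqE1 S q (eta q) (g q *: zeta q + h q *: conjm (zeta q))) ->
    y = - (vderiv (fun q => conjm (Z q)) g p - 'i%C * frame_a Z zeta p * g p)
        - (vderiv Z h p + 'i%C * (frame_a Z zeta p)^*%C * h p)].
have PP : P (delta S eta p).
  apply: (@xgetPex _ 0 P).
  exists (dbar_coef Z zeta g p + (dbar_coef Z zeta (fun q => (h q)^*%C) p)^*%C).
  move=> W1 Z1 zeta1 g1 h1 W1p F1 sg1 sh1 E1.
  have [oW1 sZ1 Fp1] := F1.
  rewrite (form W1 Z1 zeta1 g1 h1 F1 W1p sg1 sh1).
  rewrite (dbar_coef_frame F F1 Wp W1p sg sg1); last first.
    move=> r Wr W1r; exact: (proj1 (coef_rot (Fp r Wr) (Fp1 r W1r) (E r Wr) (E1 r W1r))).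
  rewrite (dbar_coef_frame F F1 Wp W1p shJ (smoothJ oW1 sh1)) // => r Wr W1r.
  exact: (proj2 (coef_rot (Fp r Wr) (Fp1 r W1r) (E r Wr) (E1 r W1r))).
by rewrite (PP W Z zeta g h Wp F sg sh E) (form W Z zeta g h F Wp sg sh).
Qed.

(** * The operator D *)

(** The 3-form b /\ theta on (z, conj z, T) is b (z, conj z). *)
Lemma F2_vanish p z (zeta : 'rV[C]_3) (b : 'M[C]_3) : frame_at S p z zeta -> F2 S p b ->
  ev2 b z (conjm z) = 0.
Proof.
move=> F [bT bw]; have [t1 t2 t3] := frame_theta F.
by have := bw z (conjm z) (T p); rewrite t1 t2 t3 !mulr0 !addr0 mulr1.
Qed.

(** An alternating form is determined by its values on the pairs of vectors of the
    frame. *)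
Lemma F2_form p z (zeta : 'rV[C]_3) (b : 'M[C]_3) : frame_at S p z zeta -> b^T = - b ->
  ev2 b z (conjm z) = 0 ->
  b = ev2 b z (T p) *: wedge zeta (theta p) + ev2 b (conjm z) (T p) *: wedge (conjm zeta) (theta p).
Proof.
move=> F bT bz; apply: ev2_inj => u v.
have E1 : ev2 b (conjm z) z = 0 by rewrite (ev2_anti _ _ bT) bz oppr0.
have E2 : ev2 b (T p) z = - ev2 b z (T p) by rewrite (ev2_anti _ _ bT).
have E3 : ev2 b (T p) (conjm z) = - ev2 b (conjm z) (T p) by rewrite (ev2_anti _ _ bT).
rewrite ev2D !ev2Z !ev2_wedge {1}(frame_dec F u) {1}(frame_dec F v).
rewrite !ev2Dl !ev2Dr !ev2Zl !ev2Zr !(ev2_diag _ bT) bz E1 E2 E3.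
ring.
Qed.

Lemma F2P p z (zeta : 'rV[C]_3) (b : 'M[C]_3) : frame_at S p z zeta -> b^T = - b ->
  ev2 b z (conjm z) = 0 -> F2 S p b.
Proof.
move=> F bT bz; split => // u v w; rewrite (F2_form F bT bz).
rewrite !ev2D !ev2Z !ev2_wedge.
move: (ev2 b _ _) (ev2 b _ _) => x y.
move: (ev zeta u) (ev zeta v) (ev zeta w) (ev (conjm zeta) u) (ev (conjm zeta) v)
  (ev (conjm zeta) w).
move: (ev (theta p) u) (ev (theta p) v) (ev (theta p) w) => *; ring.
Qed.

Lemma wedge_frame p z (zeta : 'rV[C]_3) : frame_at S p z zeta ->
  [/\ ev2 (wedge (conjm zeta) (theta p)) (conjm z) (T p) = 1 &
    ev2 (wedge zeta (theta p)) (conjm z) (T p) = 0].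
Proof.
move=> F; have [t1 t2 t3] := frame_theta F; have [c1 c2 c3] := frame_conj F.
have [_ _ z1 z2 z3] := F.
by split; rewrite ev2_wedge ?c2 ?c3 ?z2 ?z3 t2 t3 ?mul0r ?mulr0 ?subr0 ?mulr1.
Qed.

(** [component11] asks for some splitting of [b] along some frames.  Frames at a
    point are proportional, so the splitting of [F2_form] is the only one. *)
Lemma component11E p z (zeta : 'rV[C]_3) (b : 'M[C]_3) : frame_at S p z zeta -> F2 S p b ->
  component11 S p b = ev2 b (conjm z) (T p) *: wedge (conjm zeta) (theta p).
Proof.
move=> F Fb; have bz := F2_vanish F Fb; have [bT _] := Fb.
have bE := F2_form F bT bz; have [w1 w2] := wedge_frame F.
pose P := [set b' | F11 S p b' /\ F20 S p (b - b')].
have PP : P (component11 S p b).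
  apply: (@xgetPex _ 0 P); exists (ev2 b (conjm z) (T p) *: wedge (conjm zeta) (theta p)); split.
    by exists z, zeta, (ev2 b (conjm z) (T p)).
  by exists z, zeta, (ev2 b z (T p)); split => //; rewrite {1}bE addrK.
case: PP => [[z1 [zeta1 [c1 [F1 e1]]]] [z2 [zeta2 [c2 [F2 e2]]]]].
have [u1 [uu1 zz1 ze1]] := frame_rot F1 F.
have [u2 [uu2 zz2 ze2]] := frame_rot F2 F.
have wZ a (al be : 'rV[C]_3) : wedge (a *: al) be = a *: wedge al be.
  by apply: ev2_inj => x y; rewrite ev2Z !ev2_wedge !evZl; ring.
move: e1; rewrite ze1 conjmZ wZ scalerA => e1.
move: e2; rewrite ze2 wZ scalerA => e2.
have : ev2 (b - component11 S p b) (conjm z) (T p) = 0 by rewrite e2 ev2Z w2 mulr0.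
by rewrite ev2D ev2N e1 ev2Z w1 mulr1 => /eqP; rewrite subr_eq0 => /eqP ->.
Qed.

Lemma bracket_theta W Z zeta q : local_frame S W Z zeta -> W q ->
  ev (theta q) (bracket Z (fun r => conjm (Z r)) q) = 'i%C.
Proof.
move=> F Wq; have [_ _ Fp] := F; have [t1 t2 t3] := frame_theta (Fp q Wq).
by rewrite (bracket_frame F Wq) !evDr !evZr t1 t2 t3 !mulr0 !add0r mulr1.
Qed.

(** On (Z, conj Z) adding h theta contributes h dtheta (Z, conj Z) = - i h, as theta
    vanishes on both vectors. *)
Lemma d_add_theta W Z zeta eta (h : M -> C) q : local_frame S W Z zeta -> W q ->
  smooth_form W eta -> smooth W h ->
  ev2 (dform (add_theta S eta h) q) (Z q) (conjm (Z q)) =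
  ev2 (dform eta q) (Z q) (conjm (Z q)) - 'i%C * h q.
Proof.
move=> F Wq sE sh; have [oW sZ Fp] := F; have sZb := smooth_fieldJ oW sZ.
have sA : smooth_form W (add_theta S eta h).
  exact: smooth_formD sE (smooth_formZ oW sh (@smooth_theta W)).
rewrite (ev2_dform (Y := fun r => conjm (Z r)) oW Wq sA sZ sZb).
rewrite (ev2_dform (Y := fun r => conjm (Z r)) oW Wq sE sZ sZb) /d_eval.
rewrite (vderiv_ext _ oW Wq (g := fun r => ev (eta r) (conjm (Z r)))); last first.
  by move=> r Wr; have [_ t2 _] := frame_theta (Fp r Wr);
    rewrite /add_theta evDl evZl t2 mulr0 addr0.
rewrite (vderiv_ext (fun r => conjm (Z r)) oW Wq (g := fun r => ev (eta r) (Z r))); last first.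
  by move=> r Wr; have [t1 _ _] := frame_theta (Fp r Wr);
    rewrite /add_theta evDl evZl t1 mulr0 addr0.
have -> v : ev (add_theta S eta h q) v = ev (eta q) v + h q * ev (theta q) v.
  by rewrite evDl evZl.
rewrite (bracket_theta F Wq).
by rewrite opprD addrA [h q * _]mulrC.
Qed.

Lemma smooth_add_theta U eta (h : M -> C) : open U -> smooth_form U eta -> smooth U h ->
  smooth_form U (add_theta S eta h).
Proof. by move=> oU sE sh; exact: smooth_formD sE (smooth_formZ oU sh (@smooth_theta U)). Qed.

Lemma local_frame_in U p : open U -> U p ->
  exists (W : set M) (Z : M -> 'cV[C]_3) (zeta : M -> 'rV[C]_3),
  [/\ W p, W `<=` U & local_frame S W Z zeta].
Proof.
move=> oU Up; have [W [Z [zeta [Wp F]]]] := local_frame_ex p; have [oW _ _] := F.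
exists (W `&` U), Z, zeta; split; [by []|exact: subIsetr|].
by apply: (local_frame_sub F); [exact: openI|exact: subIsetl].
Qed.

(** By [d_add_theta] the condition on h reads i h = d eta (z, conj z), which
    defines a function independent of the choice of unit vectors, hence smooth
    although they are chosen at each point separately. *)
Lemma rumin_hP U eta : open U -> smooth_form U eta ->
  smooth U (rumin_h S U eta) /\ forall p, U p ->
    F2 S p (dform (add_theta S eta (rumin_h S U eta)) p).
Proof.
move=> oU sE.
pose P := [set h : M -> C | smooth U h /\ forall p, U p -> F2 S p (dform (add_theta S eta h) p)].
suff [h Ph] : exists h, P h by exact: (@xgetPex _ (fun=> 0) P (ex_intro _ h Ph)).
pose z p := s2val (cid2 (unit_vector_ex p)).
have zP p : T10 H p (z p) /\ levi S p (z p) (z p) = 1.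
  by rewrite /z; case: cid2.
(* The only solution of d eta (z, conj z) - i h = 0. *)
pose h p := - 'i%C * ev2 (dform eta p) (z p) (conjm (z p)).
have hE W Z zeta q : local_frame S W Z zeta -> W q ->
    h q = - 'i%C * ev2 (dform eta q) (Z q) (conjm (Z q)).
  move=> F Wq; have [_ _ /(_ q Wq) Fq] := F; have [Tz lz] := zP q.
  have [u [uu zE _]] := frame_rot Fq (frame_dual Tz lz).
  by rewrite /h zE conjmZ ev2Zl ev2Zr [u * _]mulrA uu mul1r.
have sh : smooth U h.
  apply: smooth_local => p Up; have [W [Z [zeta [Wp WU F]]]] := local_frame_in oU Up.
  exists W => //; have [oW sZ Fp] := F.
  have s1 := smooth_ev2_dform oU sE oW WU sZ (smooth_fieldJ oW sZ).
  apply: smooth_ext (smoothM oW (smooth_cst W (- 'i%C)) s1) => // q Wq.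
  by rewrite (hE _ _ _ _ F Wq).
exists h; split => // p Up; have [W [Z [zeta [Wp WU F]]]] := local_frame_in oU Up.
have [oW sZ Fp] := F.
apply: (F2P (Fp p Wp)); first exact: dform_anti oU Up (smooth_add_theta oU sE sh).
rewrite (d_add_theta F Wp (smooth_form_sub WU sE) (smooth_sub WU sh)) (hE _ _ _ _ F Wp).
by rewrite mulrA mulrN mulii opprK mul1r subrr.
Qed.

Lemma rumin_hE U eta p z (zeta : 'rV[C]_3) : open U -> U p -> smooth_form U eta ->
  frame_at S p z zeta ->
  rumin_h S U eta p = - 'i%C * ev2 (dform eta p) z (conjm z).
Proof.
move=> oU Up sE Fz; have [sh hF] := rumin_hP oU sE.
have [W [Z [zeta1 [Wp WU F]]]] := local_frame_in oU Up; have [_ _ Fp] := F.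
have [u [uu -> _]] := frame_rot (Fp p Wp) Fz.
rewrite conjmZ ev2Zl ev2Zr [u * _]mulrA uu mul1r.
have := F2_vanish (Fp p Wp) (hF p Up).
rewrite (d_add_theta F Wp (smooth_form_sub WU sE) (smooth_sub WU sh)) => /eqP.
rewrite subr_eq0 => /eqP ->.
by rewrite mulrA mulNr mulii opprK mul1r.
Qed.

(** The real 1-form gamma.  Besides the class of [eta] it contains the derivative of
    [eta] through its value on the Reeb field ([rumin_lift_frame]). *)
Definition rumin_lift U eta p : 'rV[C]_3 :=
  add_theta S eta (rumin_h S U eta) p + conjm (add_theta S eta (rumin_h S U eta) p).

Lemma smooth_rumin_lift U eta : open U -> smooth_form U eta -> smooth_form U (rumin_lift U eta).
Proof.
move=> oU sE; have sA := smooth_add_theta oU sE (proj1 (rumin_hP oU sE)).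
exact: smooth_formD sA (smooth_formJ sA).
Qed.

Lemma rumin_lift_real U eta p : conjm (rumin_lift U eta p) = rumin_lift U eta p.
Proof. by rewrite /rumin_lift conjmD conjmK addrC. Qed.

(** [theta] is real, so the function h attached to conj eta is the conjugate of the
    one attached to eta. *)
Lemma rumin_D_conj U eta p : open U -> U p -> smooth_form U eta ->
  rumin_D S U (conjf eta) p = conjm (rumin_D S U eta p).
Proof.
move=> oU Up sE; have sJ := smooth_formJ sE.
have [sh _] := rumin_hP oU sE; have [sh' _] := rumin_hP oU sJ.
have sA := smooth_add_theta oU sE sh.
rewrite /rumin_D -(dformJ oU Up sA).
apply: (dform_ext oU Up); [|exact: smooth_add_theta oU sJ sh'|exact: smooth_formJ sA].
move=> q Uq; have [z Tz lz] := unit_vector_ex q; have Fz := frame_dual Tz lz.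
rewrite /add_theta conjmD conjmZ thetaJ; congr (_ + _ *: _).
rewrite (rumin_hE oU Uq sJ Fz) (rumin_hE oU Uq sE Fz) (dformJ oU Uq sE).
rewrite conj_ni -[z in LHS]conjmK ev2J conjmK (ev2_anti _ _ (dform_anti oU Uq sE)).
by case: (ev2 _ _ _) => a b; apply: complex_eq => /=; ring.
Qed.

(** d gamma = D eta + D (conj eta) is real and has no zeta /\ conj zeta component.
    The equation says that its conj zeta /\ theta component vanishes; the remaining
    component is the conjugate of that one. *)
Lemma closed_iff U eta p : open U -> U p -> smooth_form U eta ->
  Dsecond_10 S U eta p = - Dprime_01 S U (conjf eta) p <-> dform (rumin_lift U eta) p = 0.
Proof.
move=> oU Up sE; have [sh hF] := rumin_hP oU sE; have [sh' hF'] := rumin_hP oU (smooth_formJ sE).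
have sA := smooth_add_theta oU sE sh.
have [z Tz lz] := unit_vector_ex p; have Fz := frame_dual Tz lz.
have bF : F2 S p (rumin_D S U eta p) := hF p Up.
have bF' : F2 S p (rumin_D S U (conjf eta) p) := hF' p Up.
have -> : Dsecond_10 S U eta p = _ := component11E Fz bF.
have -> : Dprime_01 S U (conjf eta) p = _ := component11E Fz bF'.
rewrite (rumin_D_conj oU Up sE).
have -> : dform (rumin_lift U eta) p = rumin_D S U eta p + conjm (rumin_D S U eta p).
  by rewrite (dformD oU Up sA (smooth_formJ sA)) (dformJ oU Up sA).
have bz := F2_vanish Fz bF; have [bT _] := bF.
move: (rumin_D S U eta p) bT bz => b bT bz.
have [w1 w2] := wedge_frame Fz.
have bJT : (b + conjm b)^T = - (b + conjm b).
  rewrite linearD /= bT opprD; congr (_ + _).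
  by apply/matrixP => i j; have /matrixP/(_ i j) := bT; rewrite !mxE => ->; rewrite rmorphN.
have bJz : ev2 (b + conjm b) z (conjm z) = 0.
  by rewrite ev2D bz add0r -[z in LHS]conjmK ev2J conjmK (ev2_anti _ _ bT) bz oppr0 conjc0.
split=> [e|e].
  have {}e : ev2 b (conjm z) (T p) + ev2 (conjm b) (conjm z) (T p) = 0.
    have /(congr1 (fun x => ev2 x (conjm z) (T p))) := e.
    by rewrite ev2N !ev2Z w1 !mulr1 => ->; rewrite addNr.
  rewrite (F2_form Fz bJT bJz) !ev2D e scale0r addr0.
  suff -> : ev2 b z (T p) + ev2 (conjm b) z (T p) = 0 by rewrite scale0r.
  have evT (b' : 'M[C]_3) v : ev2 b' v (T p) = (ev2 (conjm b') (conjm v) (T p))^*%C.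
    by rewrite -ev2J !conjmK reebJ.
  rewrite (evT b z) (evT (conjm b) z) conjmK; move: e => /eqP; rewrite addr_eq0 => /eqP ->.
  by case: (ev2 _ _ _) => x y; apply: complex_eq => /=; ring.
have /(congr1 (fun x => ev2 x (conjm z) (T p))) := e; rewrite ev2D ev2_0l => /eqP.
by rewrite addr_eq0 => /eqP ->; rewrite scaleNr.
Qed.

(** The coefficient of [eta] in a frame is its value on Z, as theta and conj zeta
    vanish there. *)
Lemma section_coef U eta W Z zeta : section10 S U eta -> local_frame S W Z zeta -> W `<=` U ->
  smooth W (fun q => ev (eta q) (Z q)) /\
  forall q, W q -> eqE1 S q (eta q) (ev (eta q) (Z q) *: zeta q).
Proof.
move=> [sE cE] F WU; have [oW sZ Fp] := F; split; first exact: sE.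
move=> q Wq; have [g [t gE]] := cE q _ _ (WU _ Wq) (Fp q Wq).
have [t1 _ _] := frame_theta (Fp q Wq); have [_ _ z1 _ _] := Fp q Wq.
by exists t; rewrite {2}gE evDl !evZl z1 t1 mulr0 addr0 mulr1.
Qed.

Lemma eqE1J p (al be : 'rV[C]_3) : eqE1 S p al be -> eqE1 S p (conjm al) (conjm be).
Proof. by move=> [t ->]; exists t^*%C; rewrite conjmD conjmZ thetaJ. Qed.

Lemma dbar_coef0 Z zeta q : dbar_coef Z zeta (fun=> 0) q = 0.
Proof. by rewrite /dbar_coef vderiv_cst mulr0 subrr oppr0. Qed.

Lemma dbar_coefN W Z zeta g q : open W -> W q -> smooth W g ->
  dbar_coef Z zeta (fun r => - g r) q = - dbar_coef Z zeta g q.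
Proof.
by move=> oW Wq sg; rewrite /dbar_coef (vderivN _ oW Wq sg) mulrN -opprD.
Qed.

Section SectionDelta.
Variables (U W : set M) (Z : M -> 'cV[C]_3) (zeta eta : M -> 'rV[C]_3) (p : M).
Hypotheses (sec : section10 S U eta) (F : local_frame S W Z zeta) (WU : W `<=` U) (Wp : W p).
Let phi q := ev (eta q) (Z q).
Let b := dbar_coef Z zeta phi p.

Lemma delta_conj_section : delta S (conjf eta) p = b^*%C.
Proof.
have [oW sZ Fp] := F; have [sphi E] := section_coef sec F WU.
have phiK : (fun q => ((phi q)^*%C)^*%C) = phi by apply/funext => q; rewrite conjcK.
rewrite (deltaE (g := fun=> 0) (h := fun q => (phi q)^*%C) F Wp); first last.
- move=> q Wq; rewrite scale0r add0r -conjmZ; exact: eqE1J (E q Wq).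
- exact: smoothJ.
- exact: smooth_cst.
by rewrite dbar_coef0 add0r phiK.
Qed.

Lemma delta_diff_section : delta S (fun q => eta q - conjf eta q) p = b - b^*%C.
Proof.
have [oW sZ Fp] := F; have [sphi E] := section_coef sec F WU.
have phiK : (fun q => (- (phi q)^*%C)^*%C) = fun q => - phi q.
  by apply/funext => q; case: (phi q) => x y; apply: complex_eq => /=; ring.
rewrite (deltaE (g := phi) (h := fun q => - (phi q)^*%C) F Wp); first last.
- move=> q Wq; have [t tE] := E q Wq; exists (t - t^*%C).
  rewrite /conjf {1 2}tE conjmD !conjmZ thetaJ scalerBl scaleNr opprD addrACA.
  by rewrite /phi.
- by apply: smoothN => //; exact: smoothJ.
- exact: sphi.
rewrite phiK (dbar_coefN _ _ oW Wp sphi) -/b; congr (_ + _).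
by rewrite rmorphN.
Qed.

(** The values on Z and conj Z are read off modulo theta.  On T one finds
    eta(T) + h plus its conjugate, and h = - i d eta (Z, conj Z); the T component
    of the bracket of Z and conj Z produces - eta(T), which cancels. *)
Lemma rumin_lift_frame : open U ->
  [/\ ev (rumin_lift U eta p) (Z p) = phi p,
      ev (rumin_lift U eta p) (conjm (Z p)) = (phi p)^*%C &
      ev (rumin_lift U eta p) (T p) = - 'i%C * (b - b^*%C)].
Proof.
move=> oU; have [oW sZ Fp] := F; have [sphi E] := section_coef sec F WU; have [sE _] := sec.
have Up := WU Wp; have Fz := Fp p Wp; have sZb := smooth_fieldJ oW sZ.
have [t1 t2 t3] := frame_theta Fz; have [_ _ z1 z2 z3] := Fz.
have etab q : W q -> ev (eta q) (conjm (Z q)) = 0.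
  move=> Wq; have [_ _ _ y2 _] := Fp q Wq; have [_ s2 _] := frame_theta (Fp q Wq).
  by rewrite (eqE1_ev (E q Wq) s2) evZl y2 mulr0.
have hE : rumin_h S U eta p = - 'i%C * b - ev (eta p) (T p).
  rewrite (rumin_hE oU Up sE Fz).
  rewrite (ev2_dform (Y := fun r => conjm (Z r)) oW Wp (smooth_form_sub WU sE) sZ sZb) /d_eval.
  rewrite (vderiv_ext _ oW Wp (g := fun=> 0)) // vderiv_cst sub0r.
  rewrite (bracket_frame F Wp) !evDr !evZr (etab p Wp) mulr0 addr0 -/(phi p).
  rewrite /b /dbar_coef -/(vderiv (fun r => conjm (Z r)) phi p).
  have alg (x a y t : C) : - 'i%C * (- x - (- 'i%C * a * y + 'i%C * t)) =
      - 'i%C * - (x - 'i%C * a * y) - t.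
    transitivity (- 'i%C * - (x - 'i%C * a * y) + ('i%C * 'i%C) * t); first by ring.
    by rewrite mulii mulN1r.
  exact: alg.
have cE (v w : 'cV[C]_3) : w = conjm v -> ev (rumin_lift U eta p) v = ev (eta p) v +
  rumin_h S U eta p * ev (theta p) v +
    (ev (eta p) w + rumin_h S U eta p * ev (theta p) w)^*%C.
  by move=> ->; rewrite /rumin_lift evDl -{2}[v]conjmK evJ /add_theta !evDl !evZl.
split.
- by rewrite (cE _ _ erefl) (etab p Wp) t1 t2 !mulr0 !addr0 conjc0 addr0.
- by rewrite (cE _ (Z p)) ?conjmK // (etab p Wp) t1 t2 !mulr0 !addr0 add0r.
- rewrite (cE _ (T p)) ?reebJ // t3 !mulr1 hE.
  have -> x y : x + (y - x) = y :> C by ring.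
  by case: b => x y; apply: complex_eq => /=; ring.
Qed.

End SectionDelta.

(** * The Webster metric of an immersion *)

Lemma normcK (x : C) : `|x| ^+ 2 = x * x^*%C.
Proof. by rewrite -add_Re2_Im2; case: x => a b; apply: complex_eq => /=; ring. Qed.

(** The values at (1, 1), (1, i) and (i, i) suffice. *)
Lemma polarize_hermitian (x y : C) : y^*%C = y ->
  (forall a b : C, a * b * x + a * b^*%C * y + a^*%C * b * y + a^*%C * b^*%C * x^*%C =
     2 * (complex.Re (a * b^*%C))%:C) -> y = 1 /\ x = 0.
Proof.
move=> yJ K; move: yJ (K 1 1) (K 1 'i%C) (K 'i%C 'i%C); clear K.
case: x y => [x1 x2] [y1 y2] [h1] [h2 _] [h3 _] [h4 _].
by split; apply: complex_eq => /=; lra.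
Qed.

Lemma polarize_linear (x y : C) : (forall a : C, a * x + a^*%C * y = 0) -> x = 0.
Proof.
move=> K; move: (K 1) (K 'i%C); clear K.
case: x y => [x1 x2] [y1 y2] [h1 h2] [h3 h4].
by apply: complex_eq => /=; lra.
Qed.

Section Immersion.
Variable n : nat.

Lemma jacobian_ev (f : M -> 'rV[R]_n) p (u : 'cV[R]_3) k :
  ((jacobian_at f p *m u) k 0)%:C = ev (differential (fun q => (f q 0 k)%:C) p) (realm u).
Proof.
rewrite mxE ev_sum rmorph_sum; apply: eq_bigr => i _; rewrite !mxE rmorphM /=; congr (_ * _).
by apply: complex_eq => //=; rewrite /partial derive_cst.
Qed.

Lemma gram_ev (f : M -> 'rV[R]_n) p (u v : 'cV[R]_3) :
  ((u^T *m ((jacobian_at f p)^T *m jacobian_at f p) *m v) 0 0)%:C =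
  \sum_k ev (differential (fun q => (f q 0 k)%:C) p) (realm u) *
          ev (differential (fun q => (f q 0 k)%:C) p) (realm v).
Proof.
rewrite mulmxA -mulmxA -trmx_mul mxE rmorph_sum; apply: eq_bigr => k _.
by rewrite rmorphM /= -!jacobian_ev [X in X%:C * _]mxE.
Qed.

Lemma differential_realJ (g : M -> R) p :
  conjm (differential (fun q => (g q)%:C) p) = differential (fun q => (g q)%:C) p.
Proof.
apply/matrixP => i j; rewrite !mxE; apply: complex_eq => //=.
by rewrite /partial derive_cst oppr0.
Qed.

Section AtPoint.
Variables (p : M) (z : 'cV[C]_3) (zeta : 'rV[C]_3) (f : M -> 'rV[R]_n).
Hypothesis Fz : frame_at S p z zeta.
Let df k := differential (fun q => (f q 0 k)%:C) p.
Let phi k := ev (df k) z.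
Let tau k := ev (df k) (T p).

(** With phi and tau the derivatives of a map along Z and T, the components of the
    induced metric, extended bilinearly, in the frame (Z, conj Z, T), required to be
    those of the Webster metric. *)
Definition metric_relations (phi tau : 'I_n -> C) :=
  [/\ \sum_k phi k * phi k = 0, \sum_k phi k * (phi k)^*%C = 1,
      \sum_k tau k * phi k = 0 & \sum_k tau k * tau k = 1].

Let dfJ k : conjm (df k) = df k. Proof. exact: differential_realJ. Qed.

Let phib k : ev (df k) (conjm z) = (phi k)^*%C.
Proof. by rewrite -evJ dfJ. Qed.

Let gC (u v : 'cV[C]_3) := \sum_k ev (df k) u * ev (df k) v.

Let gCsym u v : gC u v = gC v u.
Proof. by apply: eq_bigr => k _; rewrite mulrC. Qed.
Let gCDl u u' v : gC (u + u') v = gC u v + gC u' v.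
Proof. by rewrite -big_split; apply: eq_bigr => k _; rewrite evDr mulrDl. Qed.
Let gCZl a u v : gC (a *: u) v = a * gC u v.
Proof. by rewrite /gC mulr_sumr; apply: eq_bigr => k _; rewrite evZr mulrA. Qed.
Let gCDr u v v' : gC u (v + v') = gC u v + gC u v'.
Proof. by rewrite gCsym gCDl !(gCsym _ u). Qed.
Let gCZr a u v : gC u (a *: v) = a * gC u v.
Proof. by rewrite gCsym gCZl gCsym. Qed.
Let gCJ u v : gC (conjm u) (conjm v) = (gC u v)^*%C.
Proof.
rewrite rmorph_sum; apply: eq_bigr => k _.
by rewrite rmorphM /= -!evJ dfJ.
Qed.

(** Let gC be the complex bilinear extension of the induced metric.  The vectors
    (w + conj w) / sqrt 2 with w = a Z, together with T, span the real tangent space,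
    and gC on them is a polynomial in a and its conjugate with coefficients gC (Z, Z),
    gC (Z, conj Z) and gC (T, Z); comparing with the Webster metric for all a
    determines these coefficients.  Conversely they determine the metric, by
    expansion in the frame. *)
Lemma webster_metricP :
  is_webster_metric S p ((jacobian_at f p)^T *m jacobian_at f p) <-> metric_relations phi tau.
Proof.
have [Tz lz z1 z2 z3] := Fz; have [t1 t2 t3] := frame_theta Fz; have [c1 c2 c3] := frame_conj Fz.
have gramE (u v : 'cV[R]_3) : ((u^T *m ((jacobian_at f p)^T *m jacobian_at f p) *m v) 0 0)%:C =
  gC (realm u) (realm v).
  exact: gram_ev.
have real_ex (v : 'cV[C]_3) : conjm v = v -> exists u : 'cV[R]_3, realm u = v.
  move=> vJ; exists (map_mx (@complex.Re R) v); apply/matrixP => i j.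
  have /matrixP/(_ i j) := vJ; rewrite !mxE; case: (v i j) => a b [] /= h.
  by apply: complex_eq => //=; lra.
(* The normalising factor of the vectors (w + conj w) / sqrt 2. *)
pose s : C := (Num.sqrt 2)^-1%:C.
have s2 : Num.sqrt 2 * Num.sqrt 2 = 2 :> R by rewrite -expr2 sqr_sqrtr.
have s20 : Num.sqrt 2 != 0 :> R by rewrite gt_eqF // sqrtr_gt0.
have C2 : (2 : C) != 0 by rewrite pnatr_eq0.
have ss : s * s * 2 = 1.
  have -> : (2 : C) = (2 : R)%:C by rewrite (rmorph_nat _ 2).
  by rewrite -!rmorphM /= -{3}s2 mulrA mulfVK // mulVf.
have sJ : s^*%C = s by rewrite conjc_real.
pose half w : 'cV[C]_3 := s *: (w + conjm w).
have halfJ w : conjm (half w) = half w by rewrite /half conjmZ conjmD conjmK sJ addrC.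
have gh a b : gC (half (a *: z)) (half (b *: z)) = s * s * (a * b * gC z z + a * b^*%C *
  gC z (conjm z)
    + a^*%C * b * gC z (conjm z) + a^*%C * b^*%C * (gC z z)^*%C).
  rewrite /half !conjmZ !gCZl !gCZr !gCDl !gCDr !gCZl !gCZr gCJ (gCsym (conjm z) z).
  by move: (gC z z) (gC z (conjm z)) => x y; ring.
have lab a b : levi S p (a *: z) (b *: z) = a * b^*%C.
  by rewrite leviE conjmZ ev2Zl ev2Zr mulrCA [_ * (b^*%C * _)]mulrCA -leviE lz mulr1.
have zzE : gC z z = \sum_k phi k * phi k by [].
have zbE : gC z (conjm z) = \sum_k phi k * (phi k)^*%C by apply: eq_bigr => k _; rewrite phib.
have ztE : gC (T p) z = \sum_k tau k * phi k by [].
have ttE : gC (T p) (T p) = \sum_k tau k * tau k by [].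
rewrite /metric_relations -zzE -zbE -ztE -ttE.
have [tR tRE] := real_ex _ (reebJ p).
have scancel (x y : C) : s * s * x = y -> x = 2 * y.
  by move=> <-; transitivity (s * s * 2 * x); [rewrite ss mul1r|ring].
split=> [[_ _ g1 g2 g3]|[gzz gzb gtz gtt]].
  have G a b : gC (half (a *: z)) (half (b *: z)) = (complex.Re (a * b^*%C))%:C.
    have [u uE] := real_ex _ (halfJ (a *: z)); have [v vE] := real_ex _ (halfJ (b *: z)).
    have := g1 (a *: z) (b *: z) u v (T10Z a Tz) (T10Z b Tz) uE vE.
    by rewrite lab => <-; rewrite -uE -vE gramE.
  have Gt a : gC (half (a *: z)) (T p) = 0.
    have [u uE] := real_ex _ (halfJ (a *: z)).
    by rewrite -uE -tRE -gramE (g2 (a *: z) u tR (T10Z a Tz) uE tRE).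
  have gzbJ : (gC z (conjm z))^*%C = gC z (conjm z) by rewrite -gCJ conjmK gCsym.
  have [gzb gzz] := polarize_hermitian gzbJ (fun a b =>
    scancel _ _ (etrans (esym (gh a b)) (G a b))).
  split => //; last by rewrite -tRE -gramE (g3 tR tRE).
  have s0 : s != 0 by apply: contra_eq_neq ss => ->; rewrite !mul0r eq_sym oner_eq0.
  apply: (@polarize_linear _ (gC (T p) (conjm z))) => a; have := Gt a.
  rewrite /half gCZl !conjmZ gCDl !gCZl !(gCsym _ (T p)) => /(congr1 (fun x => s^-1 * x)).
  by rewrite mulr0 mulKf.
(* The induced metric is 2 zeta conj(zeta) + theta^2. *)
have gC_dec u v : gC u v = ev zeta u * ev (conjm zeta) v + ev (conjm zeta) u * ev zeta v +
  ev (theta p) u * ev (theta p) v.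
  have gbb : gC (conjm z) (conjm z) = 0 by rewrite gCJ gzz conjc0.
  have gbz : gC (conjm z) z = 1 by rewrite gCsym.
  have gzt : gC z (T p) = 0 by rewrite gCsym.
  have gbt : gC (conjm z) (T p) = 0 by rewrite -reebJ gCJ gzt conjc0.
  have gtb : gC (T p) (conjm z) = 0 by rewrite gCsym.
  rewrite {1}(frame_dec Fz u) {1}(frame_dec Fz v) !gCDl !gCDr !gCZl !gCZr.
  rewrite gzz gzb gbz gbb gzt gbt gtz gtb gtt; ring.
have ev_half x : T10 H p x -> exists a, [/\ x = a *: z, ev zeta (half x) = s * a,
    ev (conjm zeta) (half x) = s * a^*%C & ev (theta p) (half x) = 0].
  move=> Tx; have [a xE] := T10_mul Tz (unit_neq0 lz) Tx; exists a; split => //.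
  - by rewrite xE /half conjmZ evZr evDr !evZr z1 z2 mulr1 mulr0 addr0.
  - by rewrite xE /half conjmZ evZr evDr !evZr c1 c2 mulr1 mulr0 add0r.
  - by rewrite xE /half conjmZ evZr evDr !evZr t1 t2 !mulr0 addr0 mulr0.
split.
- by rewrite trmx_mul trmxK.
- move=> u u0.
  have uJ : conjm (realm u) = realm u by apply/matrixP => i j; rewrite !mxE conjc_real.
  have : ((u^T *m ((jacobian_at f p)^T *m jacobian_at f p) *m u) 0 0)%:C =
     2 * (`|ev zeta (realm u)| ^+ 2) + `|ev (theta p) (realm u)| ^+ 2.
    rewrite gramE gC_dec.
    have -> : ev (conjm zeta) (realm u) = (ev zeta (realm u))^*%C by rewrite -evJ uJ.
    have -> : `|ev (theta p) (realm u)| ^+ 2 = ev (theta p) (realm u) * ev (theta p) (realm u).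
      by rewrite normcK -ev_thetaJ uJ.
    rewrite normcK; ring.
  rewrite -ltcR => ->; rewrite lt_neqAle; apply/andP; split; last first.
    by rewrite addr_ge0 ?mulr_ge0 ?exprn_ge0.
  rewrite eq_sym paddr_eq0 ?mulr_ge0 ?exprn_ge0 // mulf_eq0 (negbTE C2) /= !expf_eq0 /= !normr_eq0.
  apply: contraNN u0 => /andP[/eqP e1 /eqP e2].
  have : realm u = 0.
    rewrite (frame_dec Fz (realm u)) e1 e2 -{1}uJ evJ e1 conjc0.
    by rewrite !scale0r !addr0.
  move=> /matrixP h; apply/eqP/matrixP => i j; have := h i j; rewrite !mxE => -[]; exact.
- move=> x y u v Tx Ty ux vy.
  have [a [xE x1 x2 x3]] := ev_half x Tx; have [b [yE y1 y2 y3]] := ev_half y Ty.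
  have := gramE u v; rewrite ux vy -/(half x) -/(half y) gC_dec x1 x2 x3 y1 y2 y3 mul0r addr0.
  have -> : s * a * (s * b^*%C) + s * a^*%C * (s * b) = s * s * (a * b^*%C + a^*%C * b) by ring.
  have -> : a * b^*%C + a^*%C * b = 2 * (complex.Re (a * b^*%C))%:C.
    by case: a b {xE x1 x2 x3 yE y1 y2 y3} => [a1 a2] [b1 b2]; apply: complex_eq => /=; ring.
  by rewrite mulrA ss mul1r xE yE lab => -[].
- move=> x u t Tx ux tE; have [a [xE x1 x2 x3]] := ev_half x Tx.
  by have := gramE u t; rewrite ux tE -/(half x) gC_dec x3 z3 c3 !mulr0 mul0r !addr0 => -[].
- by move=> t tE; have := gramE t t; rewrite tE gtt => -[].
Qed.

End AtPoint.
End Immersion.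

(** * The system as closedness and metric relations *)

Lemma dbar_coef_ext W Z zeta g g' q : open W -> W q -> (forall r, W r -> g r = g' r) ->
  dbar_coef Z zeta g q = dbar_coef Z zeta g' q.
Proof. by move=> oW Wq E; rewrite /dbar_coef (vderiv_ext _ oW Wq E) E. Qed.

Section Families.
Variables (n : nat) (U : set M) (omega : 'I_n -> M -> 'rV[C]_3).
Hypotheses (oU : open U) (sec : forall k, section10 S U (omega k)).

(** Differentiate <phi, phi> = 0 along conj Z; the term of b without derivatives is
    a multiple of <phi, phi>. *)
Lemma sum_dbar_coef W Z zeta p : local_frame S W Z zeta -> W `<=` U -> W p ->
  (forall q, W q -> \sum_k ev (omega k q) (Z q) * ev (omega k q) (Z q) = 0) ->
  \sum_k dbar_coef Z zeta (fun q => ev (omega k q) (Z q)) p * ev (omega k p) (Z p) = 0.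
Proof.
move=> F WU Wp nul; have [oW sZ Fp] := F.
pose phi k q := ev (omega k q) (Z q).
have sphi k : smooth W (phi k) := proj1 (section_coef (sec k) F WU).
have /eqP : \sum_k 2 * (vderiv (fun q => conjm (Z q)) (phi k) p * phi k p) = 0.
  transitivity (vderiv (fun q => conjm (Z q)) (fun q => \sum_k phi k q * phi k q) p).
    rewrite (vderiv_sum _ oW Wp) => [|k]; last exact: smoothM (sphi k) (sphi k).
    by apply: eq_bigr => k _; rewrite (vderivM _ oW Wp (sphi k) (sphi k)) -/(phi k); ring.
  rewrite (vderiv_ext _ oW Wp (g := fun=> 0)); last exact: nul.
  exact: vderiv_cst.
rewrite -mulr_sumr mulf_eq0 pnatr_eq0 /= => /eqP e.
transitivity (- \sum_k (vderiv (fun q => conjm (Z q)) (phi k) p * phi k p) +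
   'i%C * frame_a Z zeta p * \sum_k phi k p * phi k p).
  rewrite mulr_sumr -sumrN -big_split; apply: eq_bigr => k _ /=.
  by rewrite /dbar_coef -/(phi k p); ring.
by rewrite e (nul p Wp) oppr0 add0r mulr0.
Qed.

Lemma tau_sqr (b : C) : `|b - b^*%C| ^+ 2 = (- 'i%C * (b - b^*%C)) * (- 'i%C * (b - b^*%C)).
Proof. by rewrite normcK; case: b => x y; apply: complex_eq => /=; ring. Qed.

(** The equation on D'' and D' is [closed_iff].  The other conditions are read in
    a frame, with b = [dbar_coef] and tau = - i (b - conj b): the norm of
    delta (omega - conj omega) is that of tau, which is real, and
    i <delta (conj omega), phi> = <tau, phi> once <b, phi> = 0.  The conditions on
    the coefficient hold in all frames as soon as they hold in one, since frames
    differ by a factor of modulus 1. *)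
Lemma isometric_systemP : isometric_system S U omega <->
  (forall k p, U p -> dform (rumin_lift U (omega k)) p = 0) /\
  forall (W : set M) (Z : M -> 'cV[C]_3) (zeta : M -> 'rV[C]_3) p,
    local_frame S W Z zeta -> W `<=` U -> W p ->
    metric_relations (fun k => ev (omega k p) (Z p)) (fun k => ev (rumin_lift U (omega k) p) (T p)).
Proof.
have sE k := proj1 (sec k).
have tauE W Z zeta p k : local_frame S W Z zeta -> W `<=` U -> W p ->
    let b := dbar_coef Z zeta (fun q => ev (omega k q) (Z q)) p in
    ev (rumin_lift U (omega k) p) (T p) = - 'i%C * (b - b^*%C).
  by move=> F WU Wp b; have [_ _ ->] := rumin_lift_frame (sec k) F WU Wp oU.
have tau_phi W Z zeta p : local_frame S W Z zeta -> W `<=` U -> W p ->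
    (forall q, W q -> \sum_k ev (omega k q) (Z q) * ev (omega k q) (Z q) = 0) ->
    \sum_k ev (rumin_lift U (omega k) p) (T p) * ev (omega k p) (Z p) =
    'i%C * \sum_k delta S (conjf (omega k)) p * ev (omega k p) (Z p).
  move=> F WU Wp nul.
  transitivity ('i%C * (\sum_k delta S (conjf (omega k)) p * ev (omega k p) (Z p)) + - 'i%C *
      (\sum_k dbar_coef Z zeta (fun q => ev (omega k q) (Z q)) p * ev (omega k p) (Z p)));
        last first.
    by rewrite (sum_dbar_coef F WU Wp nul) mulr0 addr0.
  rewrite !mulr_sumr -big_split; apply: eq_bigr => k _ /=.
  rewrite (tauE _ _ _ _ _ F WU Wp) (delta_conj_section (sec k) F WU Wp).
  by move: (dbar_coef _ _ _ _) (ev _ _) => x y; ring.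
have tau_tau W Z zeta p : local_frame S W Z zeta -> W `<=` U -> W p ->
    \sum_k ev (rumin_lift U (omega k) p) (T p) * ev (rumin_lift U (omega k) p) (T p) =
    \sum_k `|delta S (fun q => omega k q - conjf (omega k) q) p| ^+ 2.
  move=> F WU Wp; apply: eq_bigr => k _.
  by rewrite (delta_diff_section (sec k) F WU Wp) tau_sqr (tauE _ _ _ _ _ F WU Wp).
have coefP W Z zeta p : local_frame S W Z zeta -> W `<=` U -> W p ->
    has_coef S p omega (fun k => ev (omega k p) (Z p)).
  move=> F WU Wp; have [_ _ Fp] := F; exists (Z p), (zeta p); split; first exact: Fp.
  by move=> k; exact: (proj2 (section_coef (sec k) F WU)).
have delta0 W Z zeta p : local_frame S W Z zeta -> W `<=` U -> W p ->
    eqE1 S p (\sum_k delta S (conjf (omega k)) p *: omega k p) 0 <->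
    \sum_k delta S (conjf (omega k)) p * ev (omega k p) (Z p) = 0.
  move=> F WU Wp; have [_ _ Fp] := F; have [t1 _ _] := frame_theta (Fp p Wp).
  have evs v : ev (\sum_k delta S (conjf (omega k)) p *: omega k p) v =
     \sum_k delta S (conjf (omega k)) p * ev (omega k p) v.
    by rewrite /ev mulmx_suml summxE; apply: eq_bigr => k _; rewrite -scalemxAl mxE.
  split=> [e|e]; first by rewrite -evs (eqE1_ev e t1) /ev mul0mx mxE.
  have tex k : exists t, omega k p = ev (omega k p) (Z p) *: zeta p + t *: theta p.
    exact: (proj2 (section_coef (sec k) F WU) p Wp).
  have [t tE] := choice tex.
  exists (\sum_k delta S (conjf (omega k)) p * t k); rewrite add0r.
  under eq_bigr => k _ do rewrite tE scalerDr !scalerA.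
  by rewrite big_split /= -!scaler_suml e scale0r add0r.
split=> [[c1 c2 c3 c4 c5]|[cl rel]].
  split=> [k p Up|W Z zeta p F WU Wp]; first by apply/(closed_iff oU Up (sE k)); exact: c1.
  have nul q : W q -> \sum_k ev (omega k q) (Z q) * ev (omega k q) (Z q) = 0.
    by move=> Wq; apply: (c2 q _ (WU _ Wq)); exact: coefP F WU Wq.
  split.
  - exact: nul.
  - rewrite -(c3 p _ (WU _ Wp) (coefP _ _ _ _ F WU Wp)).
    by apply: eq_bigr => k _; rewrite normcK.
  - rewrite (tau_phi _ _ _ _ F WU Wp nul).
    by rewrite (iffLR (delta0 _ _ _ _ F WU Wp) (c5 p (WU _ Wp))) mulr0.
  - by rewrite (tau_tau _ _ _ _ F WU Wp) c4 //; exact: WU.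
(* The coefficient in any frame is a unit multiple of the one in a local frame. *)
have coef_unit p phi : U p -> has_coef S p omega phi -> exists (v : C) (W : set M) (Z : M ->
  'cV[C]_3) (zeta : M -> 'rV[C]_3),
    [/\ v * v^*%C = 1, W p, W `<=` U, local_frame S W Z zeta & forall k,
      phi k = v * ev (omega k p) (Z p)].
  move=> Up [z [zt [Fz pE]]]; have [W [Z [zeta [Wp WU F]]]] := local_frame_in oU Up.
  have [_ _ Fp] := F; have [u [uu zE _]] := frame_rot (Fp p Wp) Fz.
  exists u, W, Z, zeta; split => // k.
  have [t1 _ _] := frame_theta Fz; have [_ _ z1 _ _] := Fz.
  by rewrite -evZr -zE (eqE1_ev (pE k) t1) evZl z1 mulr1.
split.
- by move=> k p Up; apply/(closed_iff oU Up (sE k)); exact: cl.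
- move=> p phi Up /(coef_unit p phi Up) [v [W [Z [zeta [vv Wp WU F pE]]]]].
  have [r1 _ _ _] := rel W Z zeta p F WU Wp.
  under eq_bigr => k _ do rewrite pE mulrACA.
  by rewrite -mulr_sumr r1 mulr0.
- move=> p phi Up /(coef_unit p phi Up) [v [W [Z [zeta [vv Wp WU F pE]]]]].
  have [_ r2 _ _] := rel W Z zeta p F WU Wp.
  transitivity (v * v^*%C * \sum_k ev (omega k p) (Z p) * (ev (omega k p) (Z p))^*%C); last first.
    by rewrite vv r2 mulr1.
  rewrite mulr_sumr; apply: eq_bigr => k _.
  rewrite normcK pE; move: (ev _ _) => x.
  by case: v x {vv pE} => [a b] [c d]; apply: complex_eq => /=; ring.
- move=> p Up; have [W [Z [zeta [Wp WU F]]]] := local_frame_in oU Up.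
  by have [_ _ _ <-] := rel W Z zeta p F WU Wp; rewrite (tau_tau _ _ _ _ F WU Wp).
- move=> p Up; have [W [Z [zeta [Wp WU F]]]] := local_frame_in oU Up.
  apply/(delta0 _ _ _ _ F WU Wp).
  have nul q : W q -> \sum_k ev (omega k q) (Z q) * ev (omega k q) (Z q) = 0.
    by move=> Wq; have [] := rel W Z zeta q F WU Wq.
  have [_ _ r3 _] := rel W Z zeta p F WU Wp.
  move: r3; rewrite (tau_phi _ _ _ _ F WU Wp nul) => /(congr1 (fun x => - 'i%C * x)).
  by rewrite mulr0 mulrA mulNr mulii opprK mul1r.
Qed.

End Families.

(** * Isometric immersions and solutions of the system *)

(** The expression is unchanged by a rotation of the frame. *)
Lemma dprimeE (f : M -> C) p z (zeta : 'rV[C]_3) : frame_at S p z zeta ->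
  dprime S f p = ev (differential f p) z *: zeta.
Proof.
move=> Fz.
pose P := [set alpha | forall z zeta, frame_at S p z zeta ->
  alpha = ev (differential f p) z *: zeta].
have PP : P (dprime S f p).
  apply: (@xgetPex _ 0 P); exists (ev (differential f p) z *: zeta) => z' zeta' F'.
  by have [u [uu -> ->]] := frame_rot Fz F'; rewrite evZr scalerA mulrC.
exact: PP.
Qed.

Lemma smooth_form_local U eta : (forall p, U p -> exists2 W : set M,
  open W /\ W p & smooth_form W eta) ->
  smooth_form U eta.
Proof.
move=> L W X oW WU sX; apply: smooth_local => p Wp.
have [W' [oW' W'p] sE] := L p (WU _ Wp).
exists (W `&` W') => //; apply: sE; [exact: openI|exact: subIsetr|].
exact: smooth_field_sub (@subIsetl _ _ _) sX.
Qed.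

Lemma section10_dprime U (f : M -> C) : open U -> smooth U f -> section10 S U (dprime S f).
Proof.
move=> oU sf; split.
  apply: smooth_form_local => p Up; have [W [Z [zeta [Wp WU F]]]] := local_frame_in oU Up.
  have [oW sZ Fp] := F; exists W => //.
  apply: smooth_form_ext (smooth_formZ oW (smooth_vderiv oW sZ (smooth_sub WU sf)) (smooth_zeta F)).
  by move=> q Wq; rewrite (dprimeE f (Fp q Wq)).
move=> p z zeta Up Fz; exists (ev (differential f p) z), 0.
by rewrite scale0r addr0 (dprimeE f Fz).
Qed.

(** The bracket relation solved for its T component, for x = Z (conj Z f),
    y = conj Z (Z f), u = Z f, v = conj Z f and t = T f. *)
Lemma reeb_coef (x y u v a t : C) : - 'i%C * a * u + - 'i%C * a^*%C * v + 'i%C * t = x - y ->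
  - 'i%C * (- (y - 'i%C * a * u) - - (x + 'i%C * a^*%C * v)) = t.
Proof.
move=> e; transitivity (- 'i%C * ((x - y) + 'i%C * a * u + 'i%C * a^*%C * v)); first by ring.
rewrite -e; transitivity (- ('i%C * 'i%C) * t); first by ring.
by rewrite mulii opprK mul1r.
Qed.

(** Both forms take the same values on Z and conj Z.  On T, the first is given by
    second derivatives of [f] along Z and conj Z ([rumin_lift_frame]), and the
    bracket relation [bracket_frame] applied to [f] turns them into T f. *)
Lemma rumin_lift_dprime U (f : M -> R) p : open U -> smooth U (fun q => (f q)%:C) -> U p ->
  rumin_lift U (dprime S (fun q => (f q)%:C)) p = differential (fun q => (f q)%:C) p.
Proof.
move=> oU sf Up; set F := fun q => (f q)%:C; have sec := section10_dprime oU sf.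
have [W [Z [zeta [Wp WU LF]]]] := local_frame_in oU Up; have [oW sZ Fp] := LF.
have sF := smooth_sub WU sf.
have phiE q : W q -> ev (dprime S F q) (Z q) = vderiv Z F q.
  by move=> Wq; rewrite (dprimeE F (Fp q Wq)) evZl; have [_ _ -> _ _] := Fp q Wq; rewrite mulr1.
have [l1 l2 l3] := rumin_lift_frame sec LF WU Wp oU.
apply: (frame_ext (Fp p Wp)).
- by rewrite l1 phiE.
- by rewrite l2 phiE // /vderiv -evJ differential_realJ.
rewrite l3 (dbar_coef_ext _ _ oW Wp phiE).
have sZF := smooth_vderiv oW sZ sF.
rewrite (dbar_coefJ LF Wp sZF) /dbar_coef.
have ZbE q : W q -> (vderiv Z F q)^*%C = vderiv (fun r => conjm (Z r)) F q.
  move=> Wq; rewrite -(vderivJ Z oW Wq sF); apply: (vderiv_ext _ oW Wq) => r _.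
  exact: conjc_real.
rewrite (vderiv_ext Z oW Wp ZbE) (ZbE p Wp).
have e := bracketE oW sZ (smooth_fieldJ oW sZ) sF Wp.
have e' : vderiv (bracket Z (fun r => conjm (Z r))) F p = - 'i%C * frame_a Z zeta p * vderiv Z F p +
    - 'i%C * (frame_a Z zeta p)^*%C * vderiv (fun r => conjm (Z r)) F p + 'i%C *
      ev (differential F p) (T p).
  by rewrite [LHS]/vderiv (bracket_frame LF Wp) !evDr !evZr.
by rewrite e' in e; exact: reeb_coef e.
Qed.

Lemma differentialB U (f g : M -> C) p : open U -> U p -> smooth U f -> smooth U g ->
  differential (fun q => f q - g q) p = differential f p - differential g p.
Proof.
move=> oU Up sf sg; apply: ev_inj => v; rewrite evDl evNl.
exact: (vderivB (fun=> v) oU Up sf sg).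
Qed.

(** By [rumin_lift_frame] the form depends on the coefficient of [eta] near the
    point and on nothing else. *)
Lemma rumin_lift_local U V eta xi p : open U -> open V -> V `<=` U -> V p ->
  section10 S U eta -> section10 S V xi -> (forall q, V q -> eqE1 S q (xi q) (eta q)) ->
  rumin_lift V xi p = rumin_lift U eta p.
Proof.
move=> oU oV VU Vp sE sX E; have [W [Z [zeta [Wp WV F]]]] := local_frame_in oV Vp.
have [oW sZ Fp] := F.
have phiE q : W q -> ev (xi q) (Z q) = ev (eta q) (Z q).
  by move=> Wq; have [t1 _ _] := frame_theta (Fp q Wq); exact: eqE1_ev (E q (WV _ Wq)) t1.
have [l1 l2 l3] := rumin_lift_frame sX F WV Wp oV.
have [m1 m2 m3] := rumin_lift_frame sE F (subset_trans WV VU) Wp oU.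
apply: (frame_ext (Fp p Wp)); first by rewrite l1 m1 phiE.
  by rewrite l2 m2 phiE.
by rewrite l3 m3 (dbar_coef_ext _ _ oW Wp phiE).
Qed.

(** A Gram matrix that is positive definite forces the Jacobian to be injective. *)
Lemma webster_rank n (f : M -> 'rV[R]_n) p :
  is_webster_metric S p ((jacobian_at f p)^T *m jacobian_at f p) -> \rank (jacobian_at f p) = 3%N.
Proof.
move=> [_ pos _ _ _]; rewrite -mxrank_tr; apply/eqP; rewrite -[_ == _]/(row_free _).
apply: inj_row_free => v vJ; apply/eqP/negPn/negP => v0.
have /pos : v^T != 0 by apply: contra_neq v0 => e; rewrite -[v]trmxK e trmx0.
by rewrite trmxK mulmxA vJ mul0mx mul0mx mxE ltxx.
Qed.

Lemma isometric_immersion_system n U (f : M -> 'rV[R]_n) : open U -> isometric_immersion S U f ->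
  (forall k, section10 S U (dprime_map S f k)) /\ isometric_system S U (dprime_map S f).
Proof.
move=> oU [sf rf mf].
have sec k : section10 S U (dprime_map S f k) by exact: section10_dprime oU (sf k).
split => //; apply/(isometric_systemP oU sec); split => [k p Up|W Z zeta p F WU Wp].
  rewrite (dform_ext oU Up (xi := differential (fun q => (f q 0 k)%:C))).
  - exact: dform_differential oU Up (sf k).
  - by move=> q Uq; exact: rumin_lift_dprime oU (sf k) Uq.
  - exact: smooth_rumin_lift oU (proj1 (sec k)).
  - exact: smooth_differential oU (sf k).
have [_ _ Fp] := F; have Up := WU _ Wp.
have := iffLR (webster_metricP f (Fp p Wp)) (mf p Up).
have e k : ev (dprime_map S f k p) (Z p) = ev (differential (fun q => (f q 0 k)%:C) p) (Z p).
  by rewrite /dprime_map (dprimeE _ (Fp p Wp)) evZl; have [_ _ -> _ _] := Fp p Wp; rewrite mulr1.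
have e' k : rumin_lift U (dprime_map S f k) p = differential (fun q => (f q 0 k)%:C) p.
  exact: rumin_lift_dprime oU (sf k) Up.
have -> : (fun k => ev (dprime_map S f k p) (Z p)) = fun k =>
  ev (differential (fun q => (f q 0 k)%:C) p) (Z p).
  by apply/funext => k; exact: e.
have -> // : (fun k => ev (rumin_lift U (dprime_map S f k) p) (T p)) = fun k =>
  ev (differential (fun q => (f q 0 k)%:C) p) (T p).
by apply/funext => k; rewrite e'.
Qed.

Lemma chart_ball_in W p : open W -> W p -> exists V, [/\ chart_ball V, V p & V `<=` W].
Proof.
move=> oW Wp; have [Ac cp] := chart_atP p; set c := chart_at p in Ac cp.
have [r /= r0 rI] := iffLR (nbhs_ballP _ _) (open_nbhs_nbhs (conj (@chart_image_open _ _ c _ oW)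
  (chart_image_cmap Wp cp))).
exists [set q | cdom c q /\ ball (cmap c p) r (cmap c q)]; split.
- exists c, (cmap c p), r; split => // x /rI [q [Wq cq] <-]; by exists q.
- by split => //; exact: ballxx.
- by move=> q [cq /rI /chart_image_cinv [+ _ _]]; rewrite cmapK.
Qed.

(** The components of gamma are real and closed, so each has a primitive near [p]; a
    common chart ball serves for all of them.  The resulting map has differential
    gamma, hence induces the Webster metric by [webster_metricP], and its d' is
    the class of gamma restricted to T^{1,0}, that is omega.  Any other solution
    [g] also has differential gamma, by [rumin_lift_dprime] and
    [rumin_lift_local]. *)
Lemma isometric_system_integrable n U (omega : 'I_n -> M -> 'rV[C]_3) p :
  open U -> (forall k, section10 S U (omega k)) -> isometric_system S U omega -> U p ->
  exists (V : set M) (f : M -> 'rV[R]_n),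
    [/\ open V, connected V, V p & V `<=` U] /\
    [/\ isometric_immersion S V f, eq_on S V (dprime_map S f) omega &
        forall g : M -> 'rV[R]_n, isometric_immersion S V g ->
          eq_on S V (dprime_map S g) omega -> exists c : 'rV[R]_n, forall q, V q -> g q = f q + c].
Proof.
move=> oU sec sys Up; have [cl rel] := iffLR (isometric_systemP oU sec) sys.
have P k : exists Vf : set M * (M -> R), [/\ open Vf.1, Vf.1 p, smooth Vf.1 (fun q => (Vf.2 q)%:C) &
    forall q, Vf.1 q -> differential (fun q => (Vf.2 q)%:C) q = rumin_lift U (omega k) q].
  have [V [nV Vp VU [f [sf df]]]] := poincare oU Up (smooth_rumin_lift oU (proj1 (sec k)))
    (fun q _ => rumin_lift_real U (omega k) q) (cl k).
  by exists (V, f); split => //; exact: chart_ball_open.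
have [Vf VfP] := choice P.
have nb : nbhs p (fun q => U q /\ forall k, (Vf k).1 q).
  have nbk k : nbhs p (Vf k).1 by have [oVk Vkp _ _] := VfP k; apply: open_nbhs_nbhs.
  apply: filterI; first exact: open_nbhs_nbhs.
  exact: (@filter_forall _ _ _ (nbhs p) _ nbk).
have [V [nV Vp VW]] := chart_ball_in (@open_interior _ _) nb.
have oV := chart_ball_open nV.
have {}VW q : V q -> U q /\ forall k, (Vf k).1 q by move=> /VW /nbhs_singleton.
have VU : V `<=` U by move=> q /VW [].
pose f q : 'rV[R]_n := \row_k (Vf k).2 q.
have fE k : (fun q => (f q 0 k)%:C) = fun q => ((Vf k).2 q)%:C by apply/funext => q; rewrite mxE.
have sf k : smooth V (fun q => (f q 0 k)%:C).
  rewrite fE; have [_ _ s _] := VfP k; apply: smooth_sub s => q Vq; exact: (proj2 (VW q Vq)).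
have df k q : V q -> differential (fun q => (f q 0 k)%:C) q = rumin_lift U (omega k) q.
  by move=> Vq; rewrite fE; have [_ _ _ ->] := VfP k => //; exact: (proj2 (VW q Vq)).
have metric q : V q -> is_webster_metric S q ((jacobian_at f q)^T *m jacobian_at f q).
  move=> Vq; have [W [Z [zeta [Wq WV F]]]] := local_frame_in oV Vq; have [_ _ Fp] := F.
  apply/(webster_metricP f (Fp q Wq)).
  have := rel W Z zeta q F (subset_trans WV VU) Wq.
  have -> : (fun k => ev (omega k q) (Z q)) = fun k =>
    ev (differential (fun q => (f q 0 k)%:C) q) (Z q).
    apply/funext => k; rewrite (df k q Vq).
    by have [-> _ _] := rumin_lift_frame (sec k) F (subset_trans WV VU) Wq oU.
  have -> // : (fun k => ev (rumin_lift U (omega k) q) (T q)) = fun k =>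
    ev (differential (fun q => (f q 0 k)%:C) q) (T q).
  by apply/funext => k; rewrite (df k q Vq).
exists V, f; split; first by split => //; exact: chart_ball_connected.
split.
- split; [exact: sf|by move=> q /metric; exact: webster_rank|exact: metric].
- move=> k q Vq; have [W [Z [zeta [Wq WV F]]]] := local_frame_in oV Vq; have [_ _ Fp] := F.
  have WU := subset_trans WV VU.
  rewrite /dprime_map (dprimeE _ (Fp q Wq)) (df k q Vq).
  have [-> _ _] := rumin_lift_frame (sec k) F WU Wq oU.
  have [t tE] := proj2 (section_coef (sec k) F WU) q Wq.
  by exists (- t); rewrite {2}tE scaleNr addrK.
move=> g ig eg; have [sg _ _] := ig.
have dg k q : V q -> differential (fun q => (g q 0 k)%:C) q = rumin_lift U (omega k) q.
  move=> Vq; rewrite -(rumin_lift_dprime oV (sg k) Vq).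
  exact: rumin_lift_local oU oV VU Vq (sec k) (section10_dprime oV (sg k)) (eg k).
exists (g p - f p) => q Vq; apply/rowP => k; rewrite !mxE -/(Vf k).
have sd : smooth V (fun q => (g q 0 k - f q 0 k)%:C).
  by apply: smooth_ext (smoothB oV (sg k) (sf k)) => // r _; rewrite rmorphB.
have dgf r : V r -> differential (fun q => (g q 0 k - f q 0 k)%:C) r = 0.
  move=> Vr; have -> : (fun q => (g q 0 k - f q 0 k)%:C) = fun q => (g q 0 k)%:C - (f q 0 k)%:C.
    by apply/funext => x; rewrite rmorphB.
  by rewrite (differentialB oV Vr (sg k) (sf k)) (dg k r Vr) (df k r Vr) subrr.
have := chart_ball_const nV sd dgf Vq Vp; rewrite !mxE => <-.
by rewrite addrC subrK.
Qed.

End PseudohermitianFrames.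

Local Close Scope complex_scope.

Theorem theorem3p4 (R : realType) (M : manifold3 R) (H : cr_structure M)
  (S : pseudohermitian H) (n : nat) (hS : levi_positive S) (hn : (0 < n)%N) :
  (forall (U : set M) (f : M -> 'rV[R]_n),
     open U -> isometric_immersion S U f ->
     (forall k, section10 S U (dprime_map S f k)) /\
     isometric_system S U (dprime_map S f)) /\
  (forall (U : set M) (omega : 'I_n -> M -> 'rV[R[i]%C]_3),
     open U -> (forall k, section10 S U (omega k)) ->
     isometric_system S U omega ->
     forall p : M, U p -> exists (V : set M) (f : M -> 'rV[R]_n),
       [/\ open V, connected V, V p & V `<=` U] /\
       [/\ isometric_immersion S V f,
           eq_on S V (dprime_map S f) omega &
           forall g : M -> 'rV[R]_n,
             isometric_immersion S V g ->
             eq_on S V (dprime_map S g) omega ->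
             exists c : 'rV[R]_n, forall q, V q -> g q = f q + c]).
Proof.
split=> [U f oU|U omega oU sec sys p Up]; first exact: isometric_immersion_system hS n U f oU.
exact: isometric_system_integrable hS n U omega p oU sec sys Up.
Qed.
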